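(* There exists a universal constant $C$ such that, for all integers $h,N\geq1$, all real numbers $\alpha,a>0$ and all $\delta\in[-1,1]$, if $f_+$ and $f_-$ are two spectral densities satisfying, for every $\lambda\in[-\pi,\pi]$, $$\min\{f_+(\lambda),f_-(\lambda)\}\ \geq\ \frac{3a}{4\pi},\qquad f_+(\lambda)-f_-(\lambda)=\frac{a\delta}{2\pi}\cos(h\lambda),$$ then $$\sup_{K_{1:N}\in\mathcal M_\alpha^N}\mathcal D\left(P_{f_+,K_{1:N}}^Z\,\middle\|\,P_{f_-,K_{1:N}}^Z\right)\ \leq\ C(\alpha^4\wedge1)(N-h)_+\,\delta^2 .$$
   Context: Notation: $u\wedge v=\min\{u,v\}$, $x_+=\max\{x,0\}$. $\mathcal D(P\|Q)$ is the Kullback--Leibler divergence, $\mathcal D(P\|Q)=\int\log(dP/dQ)\,dP$ if $P\ll Q$ and $+\infty$ otherwise (natural logarithm). A spectral density is a nonnegative, integrable, even function $f$ on $[-\pi,\pi]$; a centered real-valued stationary Gaussian process $X=(X_t)_{t\in\mathbb Z}$ has spectral density $f$ if $\operatorname{Cov}(X_0,X_k)=\int_{-\pi}^{\pi}f(\lambda)e^{ik\lambda}\,d\lambda$ for all $k\in\mathbb Z$. $\mathcal M_\alpha$ is the class of all Markov kernels $K$ from $\mathbb R$ to an arbitrary standard Borel space such that $K(S\mid x)\le e^\alpha K(S\mid x')$ for all $x,x'\in\mathbb R$ and all measurable $S$ in the output space of $K$. $\mathcal M_\alpha^N$ is the set of tuples $K_{1:N}=(K_1,\dots,K_N)$ with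 each $K_i\in\mathcal M_\alpha$. For a spectral density $f$ and $K_{1:N}\in\mathcal M_\alpha^N$, $P_{f,K_{1:N}}$ is the joint law of $(X,Z)$, where $X$ is a centered real stationary Gaussian process with spectral density $f$ and $Z=(Z_1,\dots,Z_N)$ is such that, conditionally on $X$, the $Z_i$ are independent with $Z_i\sim K_i(\cdot\mid X_i)$. $P_{f,K_{1:N}}^Z$ is the marginal law of $Z$ under $P_{f,K_{1:N}}$. *)

(* Defs.v *)
From HB Require Import structures.
From mathcomp Require Import all_boot all_order all_algebra.
From mathcomp Require Import all_classical all_reals all_analysis.

Set Implicit Arguments.
Unset Strict Implicit.
Unset Printing Implicit Defensive.
Import Order.TTheory GRing.Theory Num.Theory.
Import numFieldNormedType.Exports.
Local Open Scope classical_set_scope.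
Local Open Scope charge_scope.
Local Open Scope ring_scope.

Section product_space.
Context {I : Type} {d : I -> measure_display}.
Variable T : forall i, measurableType (d i).

Definition cylinders : set (set (forall i, T i)) :=
  \bigcup_i preimage_set_system setT (fun w => w i) measurable.

Definition prod_space := g_sigma_algebraType cylinders.

End product_space.

Section projections.
Context d1 d2 (T1 : measurableType d1) (T2 : measurableType d2).

HB.instance Definition _ :=
  isMeasurableFun.Build _ _ _ _ (@fst T1 T2) measurable_fst.

HB.instance Definition _ :=
  isMeasurableFun.Build _ _ _ _ (@snd T1 T2) measurable_snd.

End projections.

(* The Radon-Nikodym derivative is everywhere finite and is positive outside a
   [P]-null set, on which the value [-oo] of [lne] is irrelevant. *)
Definition kl {d} {T : measurableType d} {R : realType}
    (P Q : probability T R) : \bar R :=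
  if pselect (P `<< Q) then
    (\int[P]_x lne ('d (charge_of_finite_measure P) '/d Q x))%E
  else +oo%E.

(* [T] is the Borel space of a complete separable metric space, carried over
   along a bijection. *)
Definition standard_borel (R : realType) d (T : measurableType d) : Prop :=
  exists (M : metricType R) (phi : T -> M),
    [/\ bijective phi,
        forall F : set_system M, ProperFilter F -> cauchy F ->
          exists l : M, F --> l,
        exists2 D : set M, countable D & dense D
      & @measurable _ T = preimage_set_system setT phi
          <<s [set U : set M | open U] >>].

Record channel (R : realType) (alpha : R) := Channel {
  channel_display : measure_display;
  output : measurableType channel_display;
  channel_kernel :> R.-pker (measurableTypeR R) ~> output;
  output_standard : standard_borel R output;
  channel_private : forall (x x' : R) (S : set output), measurable S ->
    (channel_kernel x S <= (expR alpha)%:E * channel_kernel x' S)%E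
}.

Section processes.
Variable R : realType.
Local Notation mu := (@lebesgue_measure R).

Definition spectral_density (f : R -> R) : Prop :=
  [/\ forall l, l \in `[- pi, pi] -> 0 <= f l,
      forall l, l \in `[- pi, pi] -> f (- l) = f l
    & mu.-integrable `[- pi, pi] (EFin \o f)].

Definition path_space := prod_space (fun _ : int => measurableTypeR R).

Definition time_shift (s : int) (x : path_space) : path_space :=
  fun k => x (k + s).

(* [normal_prob m 0] is a uniform law by convention, so the degenerate case is
   stated separately. *)
Definition univariate_gaussian (nu : set R -> \bar R) : Prop :=
  exists m s : R, forall A : set (measurableTypeR R), measurable A ->
    nu A = (if s == 0 then \d_m A else normal_prob m s A).

(* [P] is the law of the process; the last two equations are the real and
   imaginary parts of
   [Cov(X_0, X_k) = int_{-pi}^{pi} f(l) exp(i k l) dl]. *)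
Definition stationary_gaussian_law (f : R -> R) (P : probability path_space R) :
    Prop :=
  [/\ forall n (k : 'I_n -> int) (c : 'I_n -> R),
        univariate_gaussian
          (fun A => P [set x | A (\sum_(i < n) c i * x (k i))]),
      forall k : int, ('E_P[fun x => x k] = 0)%E,
      forall (s : int) (A : set path_space), measurable A ->
        P (time_shift s @^-1` A) = P A,
      forall k : int, (covariance P (fun x => x 0%R) (fun x => x k) =
        \int[mu]_(l in `[(- pi)%R, pi]) (f l * cos (k%:~R * l))%:E)%E
    & forall k : int, (0 =
        \int[mu]_(l in `[(- pi)%R, pi]) (f l * sin (k%:~R * l))%:E)%E].

Section privatized.
Variables (alpha : R) (N : nat) (K : 'I_N -> channel alpha).

Definition output_space := prod_space (fun i => output (K i)).

(* [P] disintegrates over the law of [X] with conditional law the product of the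
   kernels; rectangles form a pi-system, so this determines [P] uniquely. The
   observation indexed by [i : 'I_N] comes from [X_{i+1}]. *)
Definition joint_law (f : R -> R)
    (P : probability (path_space * output_space)%type R) : Prop :=
  stationary_gaussian_law f (distribution P fst) /\
  forall (A : set path_space) (B : forall i, set (output (K i))),
    measurable A -> (forall i, measurable (B i)) ->
    (P (A `*` [set z | forall i, B i (z i)]) =
     \int[distribution P fst]_(x in A) \prod_(i < N) K i (x i.+1%:Z) (B i))%E.

Definition output_law (P : probability (path_space * output_space)%type R) :
    probability output_space R := distribution P snd.

End privatized.

End processes.

(* Main.v *)
(**
Since [min f_+ f_- >= 3a/(4 pi)], the covariance of [X] under [f_-] dominates [a (1 + rho^2) I],
where [rho = delta/2]; so under both laws [X_i = U_i + sqrt a V_i] with the same Gaussian [U]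
independent of [V], where [V_i = w_(i+h) + rho w_i] for a single white noise [w] under [f_+], and
where the [V_i] are iid of variance [1 + rho^2] under [f_-]. Given [U] and the past, the law of
[Z_n] under [f_+] differs from the product law only through [w_n], which the past sees only through
[Z_(n-h)]. For [n < h] there is no cost; otherwise the cost is at most [rho^2] by the entropy of a
Gaussian shift, and [O(alpha^4 delta^2)] for [alpha <= 1] because privacy contributes a factor
[e^alpha - 1] twice, once for the dependence of [Z_n] on [w_n] and once for that of [Z_(n-h)].

The divergence is handled by the linearised Donsker-Varadhan inequality
[E_P g <= E_Q e^g - 1 + B] for all bounded [g]. It is affine in [P] and [Q], hence survives
averaging over [U]; it need only be checked for [g] depending on finite quantisations of the
outputs, and for all bounded measurable [g] it is equivalent to [D(P || Q) <= B].
*)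

Require Import Defs.
From HB Require Import structures.
From mathcomp Require Import all_boot all_order all_algebra.
From mathcomp Require Import all_classical all_reals all_analysis.
From mathcomp Require Import measurable_realfun ring lra.
Import Order.TTheory GRing.Theory Num.Theory.
Import numFieldNormedType.Exports.
Local Open Scope classical_set_scope.
Local Open Scope ring_scope.

Set Implicit Arguments.
Unset Strict Implicit.
Unset Printing Implicit Defensive.

(** * Expectations of bounded measurable functions *)

(** The shape of the removed noise is dictated by the perturbation: [w_(i+h) + rho w_i] has
    covariance [rho] at the lags [h] and [-h], and [a rho = a delta / 2] is exactly what
    [a delta / (2 pi) cos (h l)] adds to the autocovariance there. The lower bound on the densities
    is worth [3a/2] of white noise and [rho^2 <= 1/4], so at least [a/4] is left after the removal.
    This strict margin makes a Cholesky factorisation possible, and its single factor produces [U]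
    for both laws.

    Two obstacles shape the rest. Gaussian processes are given through the laws of their linear
    combinations, so replacing them by the explicit model takes a Fourier uniqueness theorem;
    products of functions of one coordinate are enough, because the outputs are conditionally
    independent. Outputs live in arbitrary spaces, where conditional laws given the past are
    awkward; over a finite alphabet they are ratios of finite sums, and the chain rule for the
    divergence becomes the splitting of a test function into a log-normaliser and a normalised
    remainder. *)

Section expectation.
Context {d} {T : measurableType d} {R : realType}.
Implicit Types (P : probability T R) (f g : T -> R).

(** Such functions are summable for every probability and stable under products and partial
    integration, so Fubini applies to them without a separate integrability argument. *)
Definition bounded_measurable f :=
  measurable_fun setT f /\ exists M : R, forall x, `|f x| <= M.

Definition summable_rv P f := P.-integrable setT (EFin \o f).

Definition Ex P f : R := \int[P]_x f x.

Lemma ExE P f : Ex P f = fine (\int[P]_x (f x)%:E)%E.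
Proof. by []. Qed.

Lemma summable_bmf P f : bounded_measurable f -> summable_rv P f.
Proof.
move=> [mf [M fM]]; apply: measurable_bounded_integrable => //.
  by apply: le_lt_trans (ltry 1%R); exact: probability_le1.
by exists M; split=> [|x Mx y _]; [exact: num_real|exact: le_trans (fM y) (ltW Mx)].
Qed.

Lemma summable_measurable P f : summable_rv P f -> measurable_fun setT f.
Proof. by case/integrableP => /measurable_EFinP. Qed.

Lemma ExD P f g : summable_rv P f -> summable_rv P g ->
  Ex P (fun x => f x + g x) = Ex P f + Ex P g.
Proof. by move=> *; rewrite /Ex RintegralD. Qed.

Lemma ExB P f g : summable_rv P f -> summable_rv P g ->
  Ex P (fun x => f x - g x) = Ex P f - Ex P g.
Proof. by move=> *; rewrite /Ex RintegralB. Qed.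

Lemma ExZ P r f : summable_rv P f -> Ex P (fun x => r * f x) = r * Ex P f.
Proof. by move=> *; rewrite /Ex RintegralZl. Qed.

Lemma Ex_cst P r : Ex P (fun=> r) = r.
Proof. by rewrite /Ex Rintegral_cst //= probability_setT mulr1. Qed.

Lemma Ex_le P f g : summable_rv P f -> summable_rv P g ->
  (forall x, f x <= g x) -> Ex P f <= Ex P g.
Proof. by move=> ? ? fg; rewrite /Ex le_Rintegral. Qed.

Lemma Ex_ge0 P f : (forall x, 0 <= f x) -> 0 <= Ex P f.
Proof. by move=> f0; apply: Rintegral_ge0. Qed.

Lemma Ex_norm P f : summable_rv P f -> `|Ex P f| <= Ex P (fun x => `|f x|).
Proof. by move=> *; apply: le_normr_Rintegral. Qed.

Lemma eq_Ex P f g : f =1 g -> Ex P f = Ex P g.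
Proof. by move=> fg; congr Ex; apply/funext. Qed.

Lemma EFin_Ex P f : summable_rv P f ->
  (\int[P]_x (f x)%:E)%E = (Ex P f)%:E.
Proof. by move=> intf; rewrite fineK //; apply: integrable_fin_num. Qed.

Lemma summableD P f g : summable_rv P f -> summable_rv P g ->
  summable_rv P (fun x => f x + g x).
Proof. by move=> fi gi; have := integrableD measurableT fi gi. Qed.

Lemma summableB P f g : summable_rv P f -> summable_rv P g ->
  summable_rv P (fun x => f x - g x).
Proof. by move=> fi gi; have := integrableB measurableT fi gi. Qed.

Lemma summableZ P r f : summable_rv P f -> summable_rv P (fun x => r * f x).
Proof. by move=> fi; have := integrableZl measurableT r fi. Qed.

Lemma summable_norm P f : summable_rv P f -> summable_rv P (fun x => `|f x|).
Proof. by move=> fi; have := integrable_norm fi. Qed.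

Lemma summable_le P f g : measurable_fun setT f -> summable_rv P g ->
  (forall x, `|f x| <= g x) -> summable_rv P f.
Proof.
move=> mf ig fg; apply: (le_integrable _ _ _ ig) => //; first exact/measurable_EFinP.
by move=> x _ /=; rewrite lee_fin (le_trans (fg x)) // ler_norm.
Qed.

Lemma summable_sum P (I : Type) (s : seq I) (F : I -> T -> R) :
  (forall i, summable_rv P (F i)) -> summable_rv P (fun x => \sum_(i <- s) F i x).
Proof.
move=> iF; elim: s => [|i s IH].
  rewrite (_ : (fun _ => _) = cst 0); last by apply/funext => x; rewrite big_nil.
  by apply: summable_bmf; split => //; exists 0 => x; rewrite normr0.
rewrite (_ : (fun _ => _) = (fun x => F i x + \sum_(j <- s) F j x)).
  exact: summableD.
by apply/funext => x; rewrite big_cons.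
Qed.

Lemma Ex_sum P (I : Type) (s : seq I) (F : I -> T -> R) :
  (forall i, summable_rv P (F i)) ->
  Ex P (fun x => \sum_(i <- s) F i x) = \sum_(i <- s) Ex P (F i).
Proof.
move=> iF; elim: s => [|i s IH].
  rewrite big_nil -[RHS](Ex_cst P); apply: eq_Ex => x; exact: big_nil.
rewrite big_cons -IH -ExD //; last exact: summable_sum.
by apply: eq_Ex => x; rewrite big_cons.
Qed.

Lemma bmf_cst r : bounded_measurable (fun=> r : R).
Proof. by split => //; exists `|r|. Qed.

Lemma bmfD f g : bounded_measurable f -> bounded_measurable g ->
  bounded_measurable (fun x => f x + g x).
Proof.
move=> [mf [M fM]] [mg [N gN]]; split; first exact: measurable_funD.
by exists (M + N) => x; rewrite (le_trans (ler_normD _ _)) // lerD.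
Qed.

Lemma bmfM f g : bounded_measurable f -> bounded_measurable g ->
  bounded_measurable (fun x => f x * g x).
Proof.
move=> [mf [M fM]] [mg [N gN]]; split; first exact: measurable_funM.
by exists (M * N) => x; rewrite normrM ler_pM.
Qed.

Lemma bmfZ r f : bounded_measurable f -> bounded_measurable (fun x => r * f x).
Proof. by move=> bf; apply: bmfM => //; exact: bmf_cst. Qed.

Lemma bmfB f g : bounded_measurable f -> bounded_measurable g ->
  bounded_measurable (fun x => f x - g x).
Proof.
move=> bf /(bmfZ (-1)) /(bmfD bf) h; rewrite (_ : (fun _ => _) = (fun x => f x + -1 * g x)) //.
by apply/funext => x; rewrite mulN1r.
Qed.

Lemma bmf_norm f : bounded_measurable f -> bounded_measurable (fun x => `|f x|).
Proof.
move=> [mf [M fM]]; split; first exact: measurableT_comp.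
by exists M => x; rewrite normr_id.
Qed.

Lemma bmf_sum (I : Type) (s : seq I) (F : I -> T -> R) :
  (forall i, bounded_measurable (F i)) ->
  bounded_measurable (fun x => \sum_(i <- s) F i x).
Proof.
move=> bF; elim: s => [|i s IH].
  under [X in bounded_measurable X]funext do rewrite big_nil; exact: bmf_cst.
under [X in bounded_measurable X]funext do rewrite big_cons; exact: bmfD.
Qed.

Lemma bmf_prod (I : Type) (s : seq I) (p : pred I) (F : I -> T -> R) :
  (forall i, bounded_measurable (F i)) ->
  bounded_measurable (fun x => \prod_(i <- s | p i) F i x).
Proof.
move=> bF; elim: s => [|i s IH].
  under [X in bounded_measurable X]funext do rewrite big_nil; exact: bmf_cst.
under [X in bounded_measurable X]funext do rewrite big_cons.
by case: (p i) => //; exact: bmfM.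
Qed.

Lemma bmf_indic (A : set T) : measurable A -> bounded_measurable (\1_A : T -> R).
Proof.
move=> mA; split; first exact: measurable_indic.
by exists 1 => x; rewrite indicE; case: (_ \in _); rewrite ?normr1 // normr0.
Qed.

Lemma Ex_indic P (A : set T) : measurable A -> Ex P \1_A = fine (P A).
Proof. by move=> mA; rewrite /Ex /Rintegral integral_indic // setIT. Qed.

End expectation.

#[global] Hint Resolve bmf_cst : core.

Lemma bmf_comp {d d'} {T : measurableType d} {T' : measurableType d'}
    {R : realType} (f : T' -> R) (X : T -> T') :
  bounded_measurable f -> measurable_fun setT X ->
  bounded_measurable (fun x => f (X x)).
Proof.
move=> [mf [M fM]] mX; split; first exact: measurableT_comp.
by exists M => x.
Qed.

Section bounded_images.
Context {d} {T : measurableType d} {R : realType}.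
Implicit Types f : T -> R.

Lemma bmf_cos f : measurable_fun setT f -> bounded_measurable (fun x => cos (f x)).
Proof.
move=> mf; split.
  by apply: measurableT_comp mf; apply: continuous_measurable_fun; exact: continuous_cos.
by exists 1 => x; exact: cos_max.
Qed.

Lemma bmf_expR f : bounded_measurable f -> bounded_measurable (fun x => expR (f x)).
Proof.
move=> [mf [M fM]]; split; first exact: measurableT_comp.
exists (expR M) => x; rewrite ger0_norm ?expR_ge0 // ler_expR.
by rewrite (le_trans _ (fM x)) // ler_norm.
Qed.

End bounded_images.

Section pushforward.
Context {d d'} {T : measurableType d} {T' : measurableType d'} {R : realType}.
Variables (P : probability T R) (X : T -> T') (mX : measurable_fun setT X).

Let X_mfun : {mfun T >-> T'} := HB.pack X (isMeasurableFun.Build _ _ _ _ _ mX).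

Definition push : probability T' R := distribution P X_mfun.

Lemma pushE A : push A = P (X @^-1` A). Proof. by []. Qed.

Lemma ge0_integral_push (f : T' -> \bar R) : measurable_fun setT f ->
  (forall y, 0 <= f y)%E -> (\int[push]_y f y = \int[P]_x f (X x))%E.
Proof. by move=> mf f0; exact: (@ge0_integral_distribution _ _ T T' R P X_mfun f). Qed.

Lemma Ex_push (f : T' -> R) : measurable_fun setT f ->
  summable_rv P (f \o X) -> Ex push f = Ex P (f \o X).
Proof.
move=> mf iX; rewrite /Ex /Rintegral.
rewrite (integral_distribution (X := X_mfun)) //; exact/measurable_EFinP.
Qed.

Lemma Ex_push_bmf (f : T' -> R) : bounded_measurable f ->
  Ex push f = Ex P (f \o X).
Proof.
by move=> bf; apply: Ex_push; [case: bf|apply: summable_bmf; exact: bmf_comp].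
Qed.

End pushforward.

Section fubini_real.
Context {d1 d2} {T1 : measurableType d1} {T2 : measurableType d2} {R : realType}.
Variables (P : probability T1 R) (Q : probability T2 R).

Definition prodP : probability (T1 * T2)%type R := (P \x Q)%E.

Variable f : T1 * T2 -> R.

Lemma bmf_fst (bf : bounded_measurable f) x : bounded_measurable (fun y => f (x, y)).
Proof. by apply: (bmf_comp bf); exact: measurable_pair1. Qed.

Lemma bmf_snd (bf : bounded_measurable f) y : bounded_measurable (fun x => f (x, y)).
Proof. by apply: (bmf_comp bf); exact: measurable_pair2. Qed.

Lemma Ex_prod_l : bounded_measurable f ->
  Ex prodP f = Ex P (fun x => Ex Q (fun y => f (x, y))).
Proof.
move=> bf; rewrite {1}/Ex /Rintegral -integral12_prod_meas1; last exact: summable_bmf.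
congr fine; apply: eq_integral => x _; rewrite /fubini_F /= EFin_Ex //.
by apply: summable_bmf; exact: bmf_fst.
Qed.

Lemma Ex_prod_r : bounded_measurable f ->
  Ex prodP f = Ex Q (fun y => Ex P (fun x => f (x, y))).
Proof.
move=> bf; rewrite {1}/Ex /Rintegral -integral21_prod_meas1; last exact: summable_bmf.
congr fine; apply: eq_integral => x _; rewrite /fubini_G /= EFin_Ex //.
by apply: summable_bmf; exact: bmf_snd.
Qed.

Lemma bmf_Ex_l : bounded_measurable f ->
  bounded_measurable (fun x => Ex Q (fun y => f (x, y))).
Proof.
move=> bf; split.
  apply: measurableT_comp => //.
  by apply: (@measurable_fubini_F _ _ _ _ _ P Q (EFin \o f)); exact: (summable_bmf prodP).
have [_ [M fM]] := bf; exists M => x.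
rewrite (le_trans (Ex_norm _)) //; first by apply: summable_bmf; exact: bmf_fst.
rewrite -[leRHS](Ex_cst Q); apply: Ex_le => //; apply: summable_bmf => //.
by apply: bmf_norm; exact: bmf_fst.
Qed.

End fubini_real.

Section fubini_swap.
Context {d1 d2} {T1 : measurableType d1} {T2 : measurableType d2} {R : realType}.
Variables (P : probability T1 R) (Q : probability T2 R).

Lemma Ex_swap (f : T1 -> T2 -> R) : bounded_measurable (fun z => f z.1 z.2) ->
  Ex P (fun x => Ex Q (fun y => f x y)) = Ex Q (fun y => Ex P (fun x => f x y)).
Proof. by move=> bf; rewrite -(Ex_prod_l P Q bf) (Ex_prod_r P Q bf). Qed.

End fubini_swap.

Lemma Ex_derive {d} {T : measurableType d} {R : realType} (P : probability T R)
    (f f' : R -> T -> R) (a : R) (G : T -> R) :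
  (forall x, a - 1 < x < a + 1 -> summable_rv P (f x)) ->
  (forall x y, a - 1 < x < a + 1 -> is_derive x 1 (f^~ y) (f' x y)) ->
  summable_rv P G ->
  (forall x y, a - 1 < x < a + 1 -> `|f' x y| <= G y) ->
  is_derive a (1 : R) (fun x => Ex P (f x)) (Ex P (f' a)).
Proof.
move=> intf derf intG f'G.
have Ia : `]a - 1, a + 1[%classic a by rewrite /= in_itv /=; apply/andP; split; lra.
have f1 x y : `]a - 1, a + 1[%classic x -> partial1of2 f x y = f' x y.
  by rewrite /= in_itv /= => /derf df; rewrite partial1of2E; apply: derive_val.
have G0 y : 0 <= G y by rewrite (le_trans _ (f'G a y _)) //; apply/andP; split; lra.
have h1 x : `]a - 1, a + 1[%classic x -> P.-integrable setT (EFin \o f x).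
  by rewrite /= in_itv /=; exact: intf.
have h2 x y : `]a - 1, a + 1[%classic x -> setT y -> derivable (f^~ y) x 1.
  by rewrite /= in_itv /= => /derf df _; exact: ex_derive.
have h3 x y : `]a - 1, a + 1[%classic x -> setT y -> `|partial1of2 f x y| <= G y.
  by move=> Ix _; rewrite f1 //; apply: f'G; move: Ix; rewrite /= in_itv.
apply: DeriveDef.
  exact: (derivable_under_integral measurableT Ia h1 h2 G0 intG h3).
rewrite -derive1E (differentiation_under_integral measurableT Ia h1 h2 G0 intG h3).
by apply: eq_Rintegral => y _; rewrite f1.
Qed.

(** * Gaussian integrals *)

Section gaussian.
Context {R : realType}.
Local Notation mu := (@lebesgue_measure R).
Local Notation RB := (measurableTypeR R).
Implicit Types (m s t b : R).

Definition gauss : probability RB R := normal_prob 0 1.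

(** [normal_prob] is defined by its values on sets; the density enters integrals through the
    Radon-Nikodym derivative, which agrees almost everywhere with [normal_pdf] because both have the
    same integral over every measurable set. *)
Lemma ge0_integral_normal_prob m s (f : R -> \bar R) :
  measurable_fun setT f -> (forall x, 0 <= f x)%E ->
  (\int[normal_prob m s]_x f x = \int[mu]_x (f x * (normal_pdf m s x)%:E))%E.
Proof.
move=> mf f0; have dom := normal_prob_dominates m s.
rewrite -(Radon_Nikodym_SigmaFinite.change_of_variables dom) //.
apply: ae_eq_integral => //.
- apply: emeasurable_funM => //.
  exact: (measurable_int mu (Radon_Nikodym_SigmaFinite.f_integrable dom)).
- apply: emeasurable_funM => //.
  by apply/measurable_EFinP; exact: measurable_normal_pdf.
- apply: ae_eqe_mul2l; apply: integral_ae_eq => //.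
  + exact: Radon_Nikodym_SigmaFinite.f_integrable.
  + by apply/measurable_EFinP; exact: measurable_normal_pdf.
  + by move=> E _ mE; rewrite -Radon_Nikodym_SigmaFinite.f_integral.
Qed.

Lemma measurable_affine m s : measurable_fun setT (fun x : RB => m + s * x : RB).
Proof. by apply: measurable_funD => //; exact: measurable_funM. Qed.

Lemma normal_pdf_affine m s x : 0 < s ->
  normal_pdf m s (m + s * x) * s = normal_pdf 0 1 x.
Proof.
move=> s0; rewrite !normal_pdfE ?gt_eqF // /normal_peak /normal_fun.
have -> : Num.sqrt (s ^+ 2 * pi *+ 2) = s * Num.sqrt (1 ^+ 2 * pi *+ 2).
  by rewrite expr1n mul1r -mulrnAr sqrtrM ?sqr_ge0 // sqrtr_sqr gtr0_norm.
rewrite mulrAC; congr (_ * expR _); first by rewrite invfM mulrAC mulVf ?gt_eqF // mul1r.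
by field; rewrite gt_eqF.
Qed.

Lemma gauss_affine m s (A : set RB) : 0 < s -> measurable A ->
  push gauss (measurable_affine m s) A = normal_prob m s A.
Proof.
move=> s0; apply: (@measure_unique _ R RB [set A | exists x : R, A = `]-oo, x[%classic]
  (fun n => `]-oo, n%:R[%classic) _ _ _ _ (push gauss (measurable_affine m s)) (normal_prob m s)).
- exact: RGenInftyO.measurableE.
- move=> _ _ [x ->] [y ->]; exists (Order.min x y).
  by apply/seteqP; split => z; rewrite /= !in_itv /= lt_min; [case=> -> ->|case/andP].
- by move=> n; exists n%:R.
- apply/seteqP; split => // x _; exists (Num.truncn x).+1 => //=.
  by rewrite in_itv /=; exact: truncnS_gt.
(* Only open half-lines have to be compared, a pi-system generating the Borel sets; there the
   substitution [x -> m + s x] turns one density into the other. *)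
- move=> _ [b ->].
  have e : (fun x => m + s * x) @^-1` `]-oo, b[ = `]-oo, ((b - m) / s)[%classic.
    by apply/seteqP; split => z; rewrite /= !in_itv /= ltr_pdivlMr // mulrC ltrBrDl.
  transitivity (\int[mu]_(x in `]-oo, ((b - m) / s)%R[) (normal_pdf 0 1 x)%:E)%E.
    by rewrite -e.
  transitivity (\int[mu]_(x in `]-oo, b[) (normal_pdf m s x)%:E)%E; last by [].
  have cpdf n t : t != 0 -> continuous (normal_pdf n t) by exact: continuous_normal_pdf.
  rewrite !integral_itv_bndo_bndc; last 2 first.
  + by apply/measurable_EFinP/measurable_funTS; exact: measurable_normal_pdf.
  + by apply/measurable_EFinP/measurable_funTS; exact: measurable_normal_pdf.
  pose F x : R := m + s * x.
  have F' : F^`()%classic = cst s.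
    apply/funext => x; rewrite derive1E /F deriveD // derive_cst add0r deriveM //.
    by rewrite derive_id derive_cst scaler0 addr0 [_ *: _]mulr1.
  have Fb : F ((b - m) / s) = b by rewrite /F; field; rewrite gt_eqF.
  rewrite -[in RHS]Fb (@increasing_ge0_integration_by_substitutionNy R F (normal_pdf m s)).
  + by apply: eq_integral => x _; rewrite F' -(normal_pdf_affine m x s0).
  + by move=> x y _ _ xy; rewrite /F ltrD2l ltr_pM2l.
  + by rewrite F' => x _; exact: cst_continuous.
  + rewrite F'; exact: is_cvg_cst.
  + rewrite F'; exact: cvg_cst.
  + split.
      by move=> x _; rewrite /F.
    rewrite /F; apply: cvg_at_left_filter; apply: cvgD; first exact: cvg_cst.
    by apply: cvgM; [exact: cvg_cst|exact: cvg_id].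
  + rewrite /F; apply/cvgrNyPle => M; near=> x.
    rewrite -lerBrDl mulrC -ler_pdivlMr //.
  + apply: continuous_subspaceT; apply: cpdf; rewrite gt_eqF //.
  + by move=> x _; exact: normal_pdf_ge0.
- by move=> n; rewrite (le_lt_trans (probability_le1 _ _)) ?ltry.
Unshelve. all: by end_near. Qed.

Lemma ge0_integral_gauss_affine m s (f : R -> \bar R) : 0 < s ->
  measurable_fun setT f -> (forall x, 0 <= f x)%E ->
  (\int[normal_prob m s]_x f x = \int[gauss]_x f (m + s * x)%R)%E.
Proof.
move=> s0 mf f0.
transitivity (\int[push gauss (measurable_affine m s)]_x f x)%E; last first.
  exact: (ge0_integral_push gauss (measurable_affine m s) mf f0).
by apply: eq_measure_integral => A mA _; exact/esym/gauss_affine.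
Qed.

(** Density of the normal law of mean [t] and variance 1 with respect to [gauss]. *)
Definition tilt t (x : R) : R := expR (t * x - t ^+ 2 / 2).

Lemma measurable_tilt t : measurable_fun setT (tilt t : RB -> R).
Proof.
by apply: measurableT_comp => //; apply: measurable_funB.
Qed.

Lemma tilt_ge0 t x : 0 <= tilt t x. Proof. exact: expR_ge0. Qed.

Lemma normal_pdf_tilt t x : normal_pdf t 1 x = tilt t x * normal_pdf 0 1 x.
Proof.
rewrite !normal_pdfE ?oner_eq0 // /normal_fun mulrCA -expRD; congr (_ * expR _).
by field.
Qed.

Lemma ge0_integral_tilt t (f : R -> \bar R) :
  measurable_fun setT f -> (forall x, 0 <= f x)%E ->
  (\int[gauss]_x f (x + t)%R = \int[gauss]_x (f x * (tilt t x)%:E))%E.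
Proof.
move=> mf f0; transitivity (\int[normal_prob t 1]_x f x)%E.
  rewrite ge0_integral_gauss_affine //; apply: eq_integral => x _.
  by rewrite mul1r addrC.
have mg : measurable_fun setT (fun x => f x * (tilt t x)%:E)%E.
  by apply: emeasurable_funM => //; apply/measurable_EFinP; exact: measurable_tilt.
have g0 x : (0 <= f x * (tilt t x)%:E)%E by rewrite mule_ge0 // lee_fin tilt_ge0.
have -> := ge0_integral_normal_prob t 1 mf f0.
transitivity (\int[mu]_x (f x * (tilt t x)%:E * (normal_pdf 0 1 x)%:E))%E.
  by apply: eq_integral => x _; rewrite normal_pdf_tilt EFinM muleA.
exact/esym/(ge0_integral_normal_prob 0 1 mg g0).
Qed.

Lemma summable_tilt t (f : RB -> R) : measurable_fun setT f ->
  summable_rv gauss (fun x => f (x + t)) -> summable_rv gauss (fun x => f x * tilt t x).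
Proof.
move=> mf /integrableP[_ h]; apply/integrableP; split.
  by apply/measurable_EFinP/measurable_funM => //; exact: measurable_tilt.
have mf' : measurable_fun setT (fun x : R => `|(f x)%:E|%E).
  by apply: measurableT_comp => //; exact/measurable_EFinP.
have := ge0_integral_tilt t mf' (fun x => abse_ge0 _) => e.
move: h; rewrite e; congr (_ < _)%E; apply: eq_integral => x _ /=.
by rewrite normrM (ger0_norm (tilt_ge0 _ _)) EFinM.
Qed.

(** The Cameron-Martin formula in dimension one. The nonnegative case applies to [f + |f|] and to
    [|f|], and the difference is legitimate because both are integrable. *)
Lemma Ex_tilt t (f : RB -> R) : measurable_fun setT f ->
  summable_rv gauss (fun x => f (x + t)) ->
  Ex gauss (fun x => f x * tilt t x) = Ex gauss (fun x => f (x + t)).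
Proof.
move=> mf sf.
have pos (g : RB -> R) : measurable_fun setT g -> (forall x, 0 <= g x) ->
    Ex gauss (fun x => g x * tilt t x) = Ex gauss (fun x => g (x + t)).
  move=> mg g0; congr fine.
  have mg' : measurable_fun setT (EFin \o g) by exact/measurable_EFinP.
  rewrite (ge0_integral_tilt t mg') //.
have mshift : measurable_fun setT (fun x : RB => x + t : RB) by exact: measurable_funD.
have sn : summable_rv gauss (fun x => `|f (x + t)|) by exact: summable_norm.
have mn : measurable_fun setT (fun x : RB => `|f x|) by exact: measurableT_comp.
have e : Ex gauss (fun x => (f x + `|f x|) * tilt t x) = Ex gauss (fun x => f (x + t) + `|f (x + t)|).
  rewrite (pos (fun x => f x + `|f x|)) //; first exact: measurable_funD.
  by move=> x; rewrite -lerBlDl sub0r -normrN ler_norm.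
have st := summable_tilt mf sf; have stn := summable_tilt mn sn.
have h : Ex gauss (fun x => f x * tilt t x) + Ex gauss (fun x => `|f x| * tilt t x) =
   Ex gauss (fun x => f (x + t)) + Ex gauss (fun x => `|f (x + t)|).
  by rewrite -!ExD // -e; apply: eq_Ex => x; rewrite mulrDl.
by move: h; rewrite (pos _ mn) // => /addIr.
Qed.

Lemma Ex_tilt1 t : Ex gauss (tilt t) = 1.
Proof.
rewrite -[RHS](Ex_cst gauss 1) -(@Ex_tilt t (fun=> 1)) //; last exact: summable_bmf.
by apply: eq_Ex => x; rewrite mul1r.
Qed.

Lemma summable_expR t : summable_rv gauss (fun x => expR (t * x)).
Proof.
have h := @summable_tilt t (fun=> 1) (measurable_cst _) (summable_bmf gauss (bmf_cst 1)).
have := summableZ (expR (t ^+ 2 / 2)) h; congr summable_rv; apply/funext => x.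
by rewrite mul1r /tilt -expRD; congr expR; ring.
Qed.

Lemma summable_exp_norm t : summable_rv gauss (fun x => expR (t * `|x|)).
Proof.
apply: (@summable_le _ RB R gauss _ (fun x => expR (t * x) + expR (- t * x))).
- by apply: measurableT_comp => //; apply: measurable_funM => //; exact: measurableT_comp.
- by apply: summableD; exact: summable_expR.
- move=> x; rewrite ger0_norm ?expR_ge0 //; have [x0|x0] := leP 0 x.
    by rewrite (ger0_norm x0) lerDl expR_ge0.
  by rewrite (ltr0_norm x0) mulrN mulNr lerDr expR_ge0.
Qed.

Lemma summable_exp_le k (f : RB -> R) : measurable_fun setT f ->
  (forall x, `|f x| <= expR (k * `|x|)) -> summable_rv gauss f.
Proof. by move=> mf fk; apply: summable_le fk => //; exact: summable_exp_norm. Qed.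

(* Stein: differentiating [E f(x + t)] at [t = 0] after moving the shift onto the density *)
Lemma gauss_stein (f : RB -> R) (l : R) : measurable_fun setT f ->
  (forall x, `|f x| <= expR `|x|) ->
  is_derive (0 : R) (1 : R) (fun t => Ex gauss (fun x => f (x + t))) l ->
  Ex gauss (fun x => f x * x) = l.
Proof.
move=> mf fe df.
have sfs t : summable_rv gauss (fun x => f (x + t)).
  apply: (@summable_le _ RB R gauss _ (fun x => expR `|t| * expR (1 * `|x|))).
  - by apply: measurableT_comp mf _; exact: measurable_funD.
  - by apply: summableZ; exact: summable_exp_norm.
  - by move=> x; rewrite (le_trans (fe _)) // mul1r -expRD ler_expR addrC ler_normD.
have dg : is_derive (0 : R) (1 : R) (fun t => Ex gauss (fun x => f x * tilt t x))
    (Ex gauss (fun x => f x * ((x - 0) * tilt 0 x))).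
  apply: (@Ex_derive _ _ _ _ (fun t x => f x * tilt t x) (fun t x => f x * ((x - t) * tilt t x)) _
    (fun x => expR (3 * `|x| + 1))).
  - by move=> t _; apply: summable_tilt.
  - move=> t x _; rewrite /tilt.
    apply: (@is_derive_eq _ _ _ (fun t : R => f x * expR (t * x - t ^+ 2 / 2))).
    by rewrite /GRing.scale /=; field.
  - have := summableZ (expR 1) (summable_exp_norm 3); congr summable_rv; apply/funext => x.
    by rewrite -expRD addrC.
  (* For [|t| < 1] the factors [f x], [x - t] and [tilt t x] are at most [exp |x|], [exp (|x| + 1)]
     and [exp |x|] in absolute value. *)
  - move=> t x /andP[t1 t2]; rewrite !normrM (_ : 3 * `|x| + 1 = `|x| + ((`|x| + 1) + `|x|)); last by ring.
    rewrite expRD ler_pM // ?mulr_ge0 // expRD ler_pM //.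
      rewrite (le_trans (ler_normB _ _)) // (le_trans _ (expR_ge1Dx _)) // addrCA lerD2l.
      rewrite ler_wpDl //  ler_norml; apply/andP; split; lra.
    rewrite ger0_norm ?tilt_ge0 // /tilt ler_expR lerBlDr.
    rewrite ler_wpDr ?divr_ge0 ?sqr_ge0 // (le_trans (ler_norm _)) // normrM.
    rewrite ler_piMl // ler_norml; apply/andP; split; lra.
have -> : Ex gauss (fun x => f x * x) = Ex gauss (fun x => f x * ((x - 0) * tilt 0 x)).
  by apply: eq_Ex => x; rewrite /tilt subr0 mul0r expr0n /= mul0r subr0 expR0 mulr1.
have <- := @derive_val _ _ _ _ _ _ _ dg; have <- := @derive_val _ _ _ _ _ _ _ df.
suff -> : (fun t => Ex gauss (fun x => f x * tilt t x)) = (fun t => Ex gauss (fun x => f (x + t))) by [].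
by apply/funext => t; rewrite Ex_tilt.
Qed.

Lemma norm_le_exp_norm (x : R) : `|x| <= expR `|x|.
Proof. by rewrite (le_trans _ (expR_ge1Dx _)) // lerDr. Qed.

Lemma summable_gauss_id : summable_rv gauss (fun x => x).
Proof.
by apply: (@summable_exp_le 1) => // x; rewrite mul1r norm_le_exp_norm.
Qed.

Lemma summable_gauss_sqr : summable_rv gauss (fun x => x ^+ 2).
Proof.
apply: (@summable_exp_le 2) => [|x]; first exact: measurable_funX.
by rewrite normrX mulr_natl mulr2n expRD expr2 ler_pM ?normr_ge0 ?norm_le_exp_norm.
Qed.

Lemma Ex_gauss_id : Ex gauss (fun x => x) = 0.
Proof.
transitivity (Ex gauss (fun x => 1 * x)); first by apply: eq_Ex => x; rewrite mul1r.
apply: (@gauss_stein (fun=> 1)) => //.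
- by move=> x; rewrite normr1 -[leLHS]expR0 ler_expR.
- have -> : (fun t : R => Ex gauss (fun _ : RB => 1)) = cst 1.
    by apply/funext => t; rewrite Ex_cst.
  exact: is_derive_cst.
Qed.

Lemma Ex_gauss_sqr : Ex gauss (fun x => x ^+ 2) = 1.
Proof.
apply: (@gauss_stein (fun x => x)) => //; first exact: norm_le_exp_norm.
have -> : (fun t : R => Ex gauss (fun x : RB => x + t)) = (fun t => t).
  apply/funext => t; rewrite ExD ?Ex_cst; last 2 first.
  - exact: summable_gauss_id.
  - exact: summable_bmf.
  by rewrite Ex_gauss_id add0r.
exact: is_derive_id.
Qed.

Lemma Ex_gauss_norm : Ex gauss (fun x => `|x|) <= 1.
Proof.
have h : Ex gauss (fun x => 2^-1 * (1 + x ^+ 2)) = 1.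
  have ? := summable_gauss_sqr; have ? := summable_bmf gauss (bmf_cst 1).
  by rewrite ExZ ?ExD ?Ex_cst ?Ex_gauss_sqr //; [field|exact: summableD].
rewrite -[leRHS]h; apply: Ex_le.
- by apply: summable_norm; exact: summable_gauss_id.
- by apply/summableZ/summableD; [exact: summable_bmf|exact: summable_gauss_sqr].
- by move=> x; rewrite -real_normK ?num_real //; have := sqr_ge0 (`|x| - 1); nra.
Qed.

Lemma sin_shift (a c b : R) : sin (a + c + b) = cos c * sin (a + b) + sin c * cos (a + b).
Proof. by rewrite (_ : a + c + b = (a + b) + c) ?(sinD (a + b) c); ring. Qed.

Lemma bmf_trig t b : bounded_measurable (fun x : RB => cos (t * x + b)).
Proof. by apply: bmf_cos; apply: measurable_funD => //; exact: measurable_funM. Qed.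

Lemma sin_cos_shift (x : R) : sin x = cos (x - pi / 2).
Proof. by rewrite cosD cosN sinN cos_pihalf sin_pihalf; ring. Qed.

Lemma bmf_trig_sin t b : bounded_measurable (fun x : RB => sin (t * x + b)).
Proof.
have := bmf_trig t (b - pi / 2); congr bounded_measurable; apply/funext => x.
by rewrite sin_cos_shift addrA.
Qed.

(** Stein's identity for the sine; it turns the derivative of the cosine transform into a multiple
    of the transform itself. *)
Lemma Ex_gauss_sinM t b :
  Ex gauss (fun x => sin (t * x + b) * x) = t * Ex gauss (fun x => cos (t * x + b)).
Proof.
have [mf _] := bmf_trig_sin t b.
apply: gauss_stein => //.
  by move=> x; rewrite (le_trans (sin_max _)) // -[leLHS]expR0 ler_expR.
have -> : (fun u => Ex gauss (fun x : RB => sin (t * (x + u) + b))) =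
    (fun u => cos (t * u) * Ex gauss (fun x : RB => sin (t * x + b)) +
      sin (t * u) * Ex gauss (fun x : RB => cos (t * x + b))).
  apply/funext => u; rewrite -!ExZ -?ExD; last 4 first.
  - exact/summableZ/summable_bmf/bmf_trig_sin.
  - exact/summableZ/summable_bmf/bmf_trig.
  - exact/summable_bmf/bmf_trig.
  - exact/summable_bmf/bmf_trig_sin.
  by apply: eq_Ex => x; rewrite mulrDr sin_shift.
set A := Ex gauss _; set B := Ex gauss _.
apply: (@is_derive_eq _ _ _ (fun u : R => cos (t * u) * A + sin (t * u) * B)).
by rewrite mulr0 sin0 cos0 /GRing.scale /=; ring.
Qed.

Lemma is_derive_gauss_cos t b :
  is_derive t (1 : R) (fun t => Ex gauss (fun x => cos (t * x + b)))
   (- t * Ex gauss (fun x => cos (t * x + b))).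
Proof.
have -> : - t * Ex gauss (fun x => cos (t * x + b)) =
    Ex gauss (fun x => - 1 * (sin (t * x + b) * x)).
  rewrite ExZ ?Ex_gauss_sinM ?mulN1r ?mulNr //.
  apply: (@summable_exp_le 1) => [|x].
    by apply: measurable_funM => //; case: (bmf_trig_sin t b).
  by rewrite mul1r normrM (le_trans _ (norm_le_exp_norm _)) // ler_piMl // sin_max.
apply: (@Ex_derive _ RB R gauss (fun t x => cos (t * x + b)) (fun t x => - 1 * (sin (t * x + b) * x)) t
  (fun x => `|x|)).
- by move=> u _; exact/summable_bmf/bmf_trig.
- move=> u x _; apply: (@is_derive_eq _ _ _ (fun u : R => cos (u * x + b))).
  by rewrite /GRing.scale /=; ring.
- exact/summable_norm/summable_gauss_id.
- by move=> u x _; rewrite mulN1r normrN normrM ler_piMl // sin_max.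
Qed.

(** As a function [y] of [t] the left side solves [y' = - t y], so [exp (t^2 / 2) y] is constant.
    The phase [b] covers the sine transform as well, and later absorbs all the other coordinates of
    a linear combination. *)
Lemma Ex_gauss_cos t b : Ex gauss (fun x => cos (t * x + b)) = expR (- (t ^+ 2 / 2)) * cos b.
Proof.
pose y u := Ex gauss (fun x => cos (u * x + b)).
pose w u := expR (u ^+ 2 / 2) * y u.
have dw u : is_derive u (1 : R) w 0.
  have dy : is_derive u (1 : R) y (- u * y u) by exact: is_derive_gauss_cos.
  apply: (@is_derive_eq _ _ _ (fun u : R => expR (u ^+ 2 / 2) * y u)).
  by rewrite /GRing.scale /=; field.
have := @is_derive_0_is_cst _ w t 0 dw; rewrite /w expr0n /= mul0r expR0 mul1r.
have -> : y 0 = cos b.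
  by rewrite -(Ex_cst gauss (cos b)); apply: eq_Ex => x; rewrite mul0r add0r.
by move=> <-; rewrite mulrA -expRD addNr expR0 mul1r.
Qed.

Lemma eq_Ex_prob {d} {T : measurableType d} (P Q : probability T R) (f : T -> R) :
  (forall A, measurable A -> P A = Q A) -> Ex P f = Ex Q f.
Proof.
move=> PQ; rewrite /Ex /Rintegral; congr fine.
by apply: eq_measure_integral => A mA _; exact: PQ.
Qed.

Lemma normal_prob_norm m s (A : set RB) : s != 0 -> normal_prob m s A = normal_prob m `|s| A.
Proof.
move=> s0; rewrite /normal_prob; apply: eq_integral => x _; congr EFin.
by rewrite !normal_pdfE ?normr_eq0 // /normal_peak /normal_fun !real_normK ?num_real.
Qed.

Lemma Ex_norm_le {d} {T : measurableType d} (P : probability T R) (f : T -> R) M :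
  bounded_measurable f -> (forall x, `|f x| <= M) -> `|Ex P f| <= M.
Proof.
move=> bf fM; rewrite (le_trans (Ex_norm (summable_bmf P bf))) // -[leRHS](Ex_cst P).
by apply: Ex_le => //; apply: summable_bmf => //; exact: bmf_norm.
Qed.

(** The inequality [1 + u <= exp u] at [u = g - ln x]: [x ln x - x] is the convex conjugate of the
    exponential. This is the pointwise form of the linearised Donsker-Varadhan inequality. *)
Lemma fenchel_exp (x g : R) : 0 < x -> x * g <= x * ln x - x + expR g.
Proof.
move=> x0; have := expR_ge1Dx (g - ln x); rewrite expRB lnK ?posrE //.
rewrite ler_pdivlMr // => h; lra.
Qed.

Lemma ln_tilt t x : ln (tilt t x) = t * x - t ^+ 2 / 2.
Proof. by rewrite /tilt expRK. Qed.

Lemma tilt_gt0 t x : 0 < tilt t x. Proof. exact: expR_gt0. Qed.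

Lemma measurable_shift t : measurable_fun setT (fun x : RB => x + t : RB).
Proof. exact: measurable_funD. Qed.

Lemma bmf_shift t (f : RB -> R) : bounded_measurable f ->
  bounded_measurable (fun x : RB => f (x + t)).
Proof. by move=> bf; apply: (bmf_comp bf); exact: measurable_shift. Qed.

Lemma summable_bmf_tilt t (f : RB -> R) : bounded_measurable f ->
  summable_rv gauss (fun x => f x * tilt t x).
Proof.
move=> bf; apply: summable_tilt; first by case: bf.
exact/summable_bmf/bmf_shift.
Qed.

Lemma summable_gauss_shift t : summable_rv gauss (fun x => x + t).
Proof. by apply: summableD; [exact: summable_gauss_id|exact: summable_bmf]. Qed.

Lemma Ex_gauss_shift t : Ex gauss (fun x => x + t) = t.
Proof.
by rewrite ExD ?Ex_cst ?Ex_gauss_id ?add0r //;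
  [exact: summable_gauss_id|exact: summable_bmf].
Qed.

(** The relative entropy of the normal law of mean [t] with respect to the centred one: the
    logarithm of the density, integrated under the shifted law. *)
Lemma Ex_entropy_tilt t : Ex gauss (fun x => (t * x - t ^+ 2 / 2) * tilt t x) = t ^+ 2 / 2.
Proof.
have s1 : summable_rv gauss (fun x => t * (x + t)) by apply: summableZ; exact: summable_gauss_shift.
have s2 : summable_rv gauss (fun=> t ^+ 2 / 2) by exact: summable_bmf.
rewrite Ex_tilt.
- rewrite ExB // Ex_cst ExZ ?Ex_gauss_shift; first by field.
  exact: summable_gauss_shift.
- by apply: measurable_funB => //; exact: measurable_funM.
- exact: summableB.
Qed.

Lemma summable_entropy_tilt t : summable_rv gauss (fun x => (t * x - t ^+ 2 / 2) * tilt t x).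
Proof.
apply: summable_tilt.
- by apply: measurable_funB => //; exact: measurable_funM.
- apply: summableB; last exact: summable_bmf.
  by apply: summableZ; exact: summable_gauss_shift.
Qed.

Section shift_kl.
Variables (T : finType) (K : R -> T -> R).
Hypothesis bK : forall w : T, bounded_measurable (fun x : RB => K x w).
Hypothesis K0 : forall x (w : T), 0 <= K x w.
Hypothesis K1 : forall x, \sum_(w : T) K x w = 1.

(** Data processing for two unit normal laws with means [y] and [y']: the shift is moved onto the
    density [tilt (y - y')], and [fenchel_exp] with this density as [x] is averaged over the kernel
    [K]. What remains is the entropy of the tilt. *)
Lemma gauss_shift_kl (g : T -> R) (y y' : R) :
  Ex gauss (fun e => \sum_(w : T) K (e + y) w * g w) <=
  Ex gauss (fun e => \sum_(w : T) K (e + y') w * expR (g w)) - 1 + (y - y') ^+ 2 / 2.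
Proof.
pose tau := y - y'.
have bS (h : T -> R) : bounded_measurable (fun e : RB => \sum_(w : T) K e w * h w).
  by apply: bmf_sum => w; apply: bmfM.
have bS' (h : T -> R) := bmf_shift y' (bS h).
have -> : Ex gauss (fun e => \sum_(w : T) K (e + y) w * g w) =
    Ex gauss (fun e => (\sum_(w : T) K (e + y') w * g w) * tilt tau e).
  rewrite Ex_tilt; first by apply: eq_Ex => x; rewrite -addrA subrK.
    by case: (bS' g).
  exact/summable_bmf/(bmf_shift tau (bS' g)).
have e1 : Ex gauss (fun e => (tau * e - tau ^+ 2 / 2) * tilt tau e - tilt tau e) = tau ^+ 2 / 2 - 1.
  rewrite ExB ?Ex_entropy_tilt ?Ex_tilt1 //; first exact: summable_entropy_tilt.
  have := summable_bmf_tilt tau (bmf_cst 1); congr summable_rv.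
  by apply/funext => x; rewrite mul1r.
have s2 : summable_rv gauss (fun e => (tau * e - tau ^+ 2 / 2) * tilt tau e - tilt tau e).
  apply: summableB; first exact: summable_entropy_tilt.
  have := summable_bmf_tilt tau (bmf_cst 1); congr summable_rv.
  by apply/funext => x; rewrite mul1r.
rewrite -addrA (addrC (- 1)) -e1 -ExD //; last by exact/summable_bmf/bS'.
apply: Ex_le.
- exact/summable_bmf_tilt/bS'.
- by apply: summableD => //; exact/summable_bmf/bS'.
- move=> e; rewrite mulr_suml.
  have -> : (tau * e - tau ^+ 2 / 2) * tilt tau e - tilt tau e =
    \sum_(w : T) K (e + y') w * ((tau * e - tau ^+ 2 / 2) * tilt tau e - tilt tau e).
    by rewrite -mulr_suml K1 mul1r.
  rewrite -big_split; apply: ler_sum => w _ /=; rewrite -mulrDr -mulrA ler_wpM2l //.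
  by rewrite [g w * _]mulrC (le_trans (fenchel_exp _ (tilt_gt0 _ _))) // ln_tilt; lra.
Qed.

End shift_kl.

(** With [tau = y - y'] the difference is the expectation of [F (e + y') (tilt tau e - 1)]. Since
    [tilt tau e - 1 >= tau e - tau^2 / 2], the absolute value of this last factor is at most
    [tilt tau e - 1 + 2 |tau e| + tau^2], of expectation at most [2 |tau| + tau^2]. This gives the
    constant 3 for [|tau| < 1]; otherwise the trivial bound [2 M] is enough. *)
Lemma gauss_shift_tv (F : RB -> R) (M y y' : R) : measurable_fun setT F ->
  (forall x, `|F x| <= M) ->
  `|Ex gauss (fun e => F (e + y)) - Ex gauss (fun e => F (e + y'))| <= 3 * M * `|y - y'|.
Proof.
move=> mF FM; pose tau := y - y'.
have M0 : 0 <= M by rewrite (le_trans _ (FM 0)).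
have bF : bounded_measurable F by split => //; exists M.
have [t1|t1] := leP 1 `|tau|.
  apply: (@le_trans _ _ (M + M)); last by rewrite /tau in t1; nra.
  by rewrite (le_trans (ler_normB _ _)) // lerD // Ex_norm_le //; exact: bmf_shift.
have bF' := bmf_shift y' bF.
have -> : Ex gauss (fun e => F (e + y)) = Ex gauss (fun e => F (e + y') * tilt tau e).
  rewrite Ex_tilt; first by apply: eq_Ex => x; rewrite -addrA subrK.
    by case: bF'.
  exact/summable_bmf/(bmf_shift tau bF').
rewrite -ExB; last 2 first.
- exact: summable_bmf_tilt.
- exact: summable_bmf.
have s0 : summable_rv gauss (tilt tau).
  have := summable_bmf_tilt tau (bmf_cst 1); congr summable_rv.
  by apply/funext => x; rewrite mul1r.
have sG : summable_rv gauss (fun e => tilt tau e - 1 + (2 * `|tau| * `|e| + tau ^+ 2)).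
  apply: summableD; first by apply: summableB => //; exact: summable_bmf.
  by apply: summableD; [apply/summableZ/summable_norm/summable_gauss_id|exact: summable_bmf].
have eG : Ex gauss (fun e => tilt tau e - 1 + (2 * `|tau| * `|e| + tau ^+ 2)) <= 3 * `|tau|.
  have s3 := summable_norm summable_gauss_id.
  have s4 := summableZ (2 * `|tau|) s3.
  have s5 r : summable_rv gauss (fun=> r : R) by exact: summable_bmf.
  rewrite ExD; [|exact: summableB|exact: summableD].
  rewrite ExB // ExD // (ExZ (2 * `|tau|) s3) !Ex_cst Ex_tilt1.
  have := Ex_gauss_norm; have : `|tau| ^+ 2 = tau ^+ 2 by rewrite real_normK ?num_real.
  have := normr_ge0 tau; nra.
have sD : summable_rv gauss (fun e => F (e + y') * tilt tau e - F (e + y')).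
  by apply: summableB; [exact: summable_bmf_tilt|exact: summable_bmf].
rewrite (le_trans (Ex_norm sD)) // -mulrA mulrCA -/tau (le_trans _ (ler_wpM2l M0 eG)) //.
rewrite -ExZ //; apply: Ex_le; [exact: summable_norm|exact: summableZ|] => e.
rewrite -{2}[F (e + y')]mulr1 -mulrBr normrM ler_pM //.
have := expR_ge1Dx (tau * e - tau ^+ 2 / 2); rewrite -/(tilt tau e) => h.
have := ler_norm (- (tau * e)); rewrite normrN normrM => h2.
by rewrite ler_norml; apply/andP; split; have := sqr_ge0 tau; have := normr_ge0 (tau * e); rewrite normrM; lra.
Qed.

End gaussian.

Lemma measurable_coord {I : Type} {d : I -> measure_display}
    (T : forall i, measurableType (d i)) i :
  measurable_fun setT (fun w : prod_space T => w i).
Proof.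
move=> _ A mA; rewrite setTI; apply: sub_sigma_algebra.
by exists i => //; exists A => //; rewrite setTI.
Qed.

Lemma measurable_prod_space {I : Type} {d : I -> measure_display}
    (T : forall i, measurableType (d i)) {d'} {S : measurableType d'}
    (X : S -> prod_space T) :
  (forall i, measurable_fun setT (fun s => X s i)) -> measurable_fun setT X.
Proof.
move=> mX; apply: (@measurability _ _ S (prod_space T) setT X (@cylinders I d T)) => //.
move=> _ [_ [i _ [A mA <-]] <-]; rewrite setTI.
by have := mX i measurableT A mA; rewrite !setTI.
Qed.

Lemma Ex_dct {d} {T : measurableType d} {R : realType} (P : probability T R)
    (F : nat -> T -> R) (f : T -> R) (M : R) :
  (forall n, measurable_fun setT (F n)) -> measurable_fun setT f ->
  (forall n x, `|F n x| <= M) -> (forall x, F n x @[n --> \oo] --> f x) ->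
  Ex P (F n) @[n --> \oo] --> Ex P f.
Proof.
move=> mF mf FM Ff.
have m1 n : measurable_fun setT (EFin \o F n) by exact/measurable_EFinP.
have m2 : measurable_fun setT (EFin \o f) by exact/measurable_EFinP.
have cv : {ae P, forall x, setT x -> (EFin \o F n) x @[n --> \oo] --> (EFin \o f) x}.
  by apply: aeW => x _; apply: cvg_EFin; [exact: nearW|exact: Ff].
have bd : {ae P, forall x n, setT x -> (`|(EFin \o F n) x| <= (cst M x)%:E)%E}.
  by apply: aeW => x n _; rewrite lee_fin.
have [_ _ h] := dominated_convergence measurableT m1 m2 cv (summable_bmf P (bmf_cst M)) bd.
apply: fine_cvg; rewrite fineK //; apply: integrable_fin_num => //.
apply: summable_bmf; split => //; exists M => x.
have h' : `|F n x| @[n --> \oo] --> `|f x| by apply: cvg_norm; exact: Ff.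
 rewrite -(cvg_lim _ h') //.
by apply: limr_le; [apply: cvgP h'|apply: nearW => n; exact: FM].
Qed.

(** * Gaussian white noise *)

Section gaussian_sequences.
Context {R : realType}.
Local Notation RB := (measurableTypeR R).
Local Notation Om := (prod_space (fun _ : nat => RB)).
Implicit Types (w : Om).

Lemma measurable_coordR i : measurable_fun setT (fun w : Om => w i : RB).
Proof. exact (@measurable_coord nat _ (fun _ : nat => RB) i). Qed.

Definition upd w (n : nat) (y : RB) : Om := fun i => if i == n then y else w i.

Lemma measurable_upd n : measurable_fun setT (fun p : Om * RB => upd p.1 n p.2).
Proof.
apply: measurable_prod_space => i; rewrite /upd; case: eqP => _.
  exact: measurable_snd.
exact: (measurableT_comp (measurable_coordR i) measurable_fst).
Qed.

(* Coordinates below [n] are iid standard normal, the others vanish. *)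
Fixpoint iid_gauss (n : nat) : probability Om R :=
  if n is m.+1 then push (prodP (iid_gauss m) gauss) (measurable_upd m)
  else (\d_((fun=> 0) : Om) : probability Om R).

Lemma updK w n y y' : upd (upd w n y) n y' = upd w n y'.
Proof. by apply/funext => i; rewrite /upd; case: eqP. Qed.

Lemma updC w m n y z : m != n -> upd (upd w m y) n z = upd (upd w n z) m y.
Proof.
move=> mn; apply/funext => i; rewrite /upd; case: (i =P n) => [->|//].
by rewrite eq_sym (negbTE mn).
Qed.

Lemma bmf_upd (F : Om -> R) n : bounded_measurable F ->
  bounded_measurable (fun p : Om * RB => F (upd p.1 n p.2)).
Proof. by move=> bF; apply: (bmf_comp bF); exact: measurable_upd. Qed.

Lemma bmf_upd_pt (F : Om -> R) n w : bounded_measurable F ->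
  bounded_measurable (fun y : RB => F (upd w n y)).
Proof. by move=> bF; exact: (bmf_fst (bmf_upd n bF)). Qed.

Lemma bmf_resample (F : Om -> R) n : bounded_measurable F ->
  bounded_measurable (fun w => Ex gauss (fun y => F (upd w n y))).
Proof. by move=> bF; have := bmf_Ex_l (iid_gauss n) gauss (bmf_upd n bF). Qed.

Lemma Ex_iid_gaussS n (F : Om -> R) : bounded_measurable F ->
  Ex (iid_gauss n.+1) F = Ex (iid_gauss n) (fun w => Ex gauss (fun y => F (upd w n y))).
Proof.
move=> bF; rewrite /= Ex_push_bmf // Ex_prod_l //.
exact: bmf_upd.
Qed.

(** The working form of independence: coordinate [j] may be redrawn with all the others held fixed.
    For the last coordinate a second draw overwrites the first; for an earlier one Fubini exchanges
    the two draws. *)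
Lemma resample n j (F : Om -> R) : (j < n)%N -> bounded_measurable F ->
  Ex (iid_gauss n) F = Ex (iid_gauss n) (fun w => Ex gauss (fun y => F (upd w j y))).
Proof.
elim: n F => // n IH F; rewrite ltnS leq_eqVlt => /predU1P[->|jn] bF.
  rewrite (Ex_iid_gaussS n (bmf_resample n bF)) (Ex_iid_gaussS n bF); apply: eq_Ex => w.
  rewrite -[LHS](Ex_cst gauss); apply: eq_Ex => y; apply: eq_Ex => y'.
  by rewrite updK.
rewrite (Ex_iid_gaussS n (bmf_resample j bF)) (Ex_iid_gaussS n bF).
rewrite (IH _ jn (bmf_resample n bF)).
apply: eq_Ex => w; rewrite Ex_swap.
  by apply: eq_Ex => y; apply: eq_Ex => z; rewrite updC // neq_ltn jn.
apply: (bmf_comp bF).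
apply: measurable_prod_space => i; rewrite /upd; case: eqP => _ //.
by case: eqP.
Qed.

Lemma Ex_iid_gauss_cos_sum (c : nat -> R) (m n : nat) b : (m <= n)%N ->
  Ex (iid_gauss n) (fun w => cos (\sum_(j < m) c j * w j + b)) =
  expR (- ((\sum_(j < m) c j ^+ 2) / 2)) * cos b.
Proof.
have mc k : measurable_fun setT (fun w : Om => \sum_(j < k) c j * w j).
  apply: measurable_sum => j; apply: measurable_funM => //; exact: measurable_coordR.
elim: m b => [|m IH] b mn.
  rewrite big_ord0 mul0r oppr0 expR0 mul1r -[RHS](Ex_cst (iid_gauss n)).
  by apply: eq_Ex => w; rewrite big_ord0 add0r.
rewrite (resample mn); last by apply: bmf_cos; apply: measurable_funD => //; exact: mc.
(* The last summand is integrated out, the remaining sum being part of the phase. *)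
transitivity (Ex (iid_gauss n) (fun w => expR (- (c m ^+ 2 / 2)) * cos (\sum_(j < m) c j * w j + b))).
  apply: eq_Ex => w; rewrite -Ex_gauss_cos; apply: eq_Ex => y.
  rewrite big_ord_recr /= /upd eqxx addrAC [X in cos X]addrC; congr (cos (_ + (_ + _))).
  by apply: eq_bigr => i _; rewrite ltn_eqF.
rewrite ExZ; last by apply/summable_bmf/bmf_cos; apply: measurable_funD => //; exact: mc.
rewrite IH ?(ltnW mn) // mulrA -expRD big_ord_recr /=; congr (expR _ * _).
by rewrite mulrDl opprD addrC.
Qed.

Lemma iid_gauss_coord_prob n j (A : set RB) : (j < n)%N -> measurable A ->
  push (iid_gauss n) (measurable_coordR j) A = gauss A.
Proof.
move=> jn mA.
have bA := bmf_indic (R := R) mA.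
have e : Ex (push (iid_gauss n) (measurable_coordR j)) \1_A = Ex gauss \1_A.
  rewrite Ex_push_bmf // (resample jn); last first.
    by apply: (bmf_comp bA); exact: measurable_coordR.
  rewrite -[RHS](Ex_cst (iid_gauss n)); apply: eq_Ex => w; apply: eq_Ex => y.
  by rewrite /= /upd eqxx.
move: e; rewrite !Ex_indic // => e.
by rewrite -[LHS]fineK ?fin_num_measure // -[RHS]fineK ?fin_num_measure // e.
Qed.

Lemma summable_coord n j (f : RB -> R) : (j < n)%N -> summable_rv gauss f ->
  summable_rv (iid_gauss n) (fun w => f (w j)).
Proof.
move=> jn /integrableP[mf hf]; have mf' := proj1 (measurable_EFinP _ _) mf.
apply/integrableP; split.
  by apply/measurable_EFinP; apply: (measurableT_comp mf'); exact: measurable_coordR.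
have mff : measurable_fun setT (fun x : RB => `|(f x)%:E|%E) by exact: measurableT_comp.
have := ge0_integral_push (iid_gauss n) (measurable_coordR j) mff (fun x => abse_ge0 _).
move=> <-; move: hf; congr (_ < _)%E; apply: eq_measure_integral => A mA _.
exact/esym/iid_gauss_coord_prob.
Qed.

Lemma Ex_coord n j (f : RB -> R) : (j < n)%N -> summable_rv gauss f ->
  Ex (iid_gauss n) (fun w => f (w j)) = Ex gauss f.
Proof.
move=> jn sf; have mf := summable_measurable sf.
have <- := Ex_push (measurable_coordR j) mf (summable_coord jn sf).
by apply: eq_Ex_prob => A mA; exact: iid_gauss_coord_prob.
Qed.

End gaussian_sequences.

(** The sum counts the positive integers up to [v], so it is the integer part of [v]. *)
Lemma layer_count {R : realType} (N : nat) (v : R) : 0 <= v -> v <= N%:R ->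
  `|\sum_(j < N) (j.+1%:R <= v)%R%:R - v| <= 1.
Proof.
move=> v0; have full n : n%:R <= v -> \sum_(j < n) (j.+1%:R <= v)%R%:R = n%:R :> R.
  move=> nv; rewrite (eq_bigr (fun=> 1)).
    by rewrite sumr_const card_ord.
  by move=> j _; rewrite (le_trans _ nv) // ler_nat.
elim: N => [|N IH] vN.
  by rewrite big_ord0 sub0r normrN ger0_norm // (le_trans vN).
rewrite big_ord_recr /=; have [Nv|vN'] := leP N.+1%:R v.
  have e : v = N.+1%:R by apply/eqP; rewrite eq_le vN Nv.
  rewrite full; last by rewrite e ler_nat.
  by rewrite {1}e -natr1 subrr normr0.
rewrite addr0; have [vN''|Nv] := leP v N%:R; first exact: IH.
rewrite full ?(ltW Nv) // distrC ler_norml; move: vN; rewrite -natr1 => vN.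
by apply/andP; split; lra.
Qed.

Section layer_cake.
Context {d} {T : measurableType d} {R : realType}.
Variables (f : T -> R) (C : R).
Hypotheses (mf : measurable_fun setT f) (f0 : forall x, 0 <= f x)
  (fC : forall x, f x <= C) (C0 : 0 < C).

Definition layer (n j : nat) : set T := [set x | j.+1%:R * (C / n.+1%:R) <= f x].

Lemma measurable_layer n j : measurable (layer n j).
Proof.
pose r := j.+1%:R * (C / n.+1%:R); have := mf measurableT (measurable_itv `[r, +oo[).
rewrite setTI; congr (measurable _); apply/seteqP.
by split => x; rewrite /layer /= in_itv /= andbT.
Qed.

(** In units of the step [C / n.+1] the sum is an integer part, hence an error of at most one step,
    uniformly in [x]. *)
Lemma layer_cake n x :
  `|\sum_(j < n.+1) C / n.+1%:R * \1_(layer n j) x - f x| <= C / n.+1%:R.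
Proof.
have s0 : 0 < C / n.+1%:R by rewrite divr_gt0.
have := @layer_count R n.+1 (f x / (C / n.+1%:R)).
rewrite divr_ge0 // ?(ltW s0) // ler_pdivrMr // mulrC divfK ?pnatr_eq0 // fC => /(_ isT isT).
rewrite -(ler_pM2l s0) mulr1; apply: le_trans.
rewrite -[X in _ <= X * _](gtr0_norm s0) -normrM mulrBr mulr_sumr.
rewrite mulrCA divff ?gt_eqF // mulr1 le_eqVlt; apply/orP; left; apply/eqP; congr `|_ - _|.
apply: eq_bigr => j _; congr (_ * _); rewrite indicE; congr (_%:R); congr nat_of_bool.
by rewrite /layer /= ler_pdivlMr //; apply/asboolP/idP.
Qed.

End layer_cake.

(** * Fourier uniqueness *)

Section smoothing.
Context {d} {T : measurableType d} {R : realType}.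
Local Notation RB := (measurableTypeR R).
Local Notation mu := (@lebesgue_measure R).
Variables (P : probability T R) (h : T -> R) (X : T -> RB).
Hypotheses (bh : bounded_measurable h) (mX : measurable_fun setT X).

(** [Ex_gauss_cos] read backwards: a Gaussian density is the cosine transform of a Gaussian, so
    Fourier inversion for smoothed laws reduces to an exchange of two integrals. *)
Lemma normal_pdf_fourier (x v s : R) : 0 < s ->
  normal_pdf x s v = normal_peak s * Ex gauss (fun t => cos (- t / s * x + t * v / s)).
Proof.
move=> s0; rewrite normal_pdfE ?gt_eqF // /normal_fun; congr (_ * _).
transitivity (expR (- (((v - x) / s) ^+ 2 / 2)) * cos 0).
  by rewrite cos0 mulr1; congr expR; field; rewrite gt_eqF.
rewrite -Ex_gauss_cos; apply: eq_Ex => t; congr cos; field; rewrite gt_eqF //.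
Qed.

Lemma Ex_normal_pdf_fourier (v s : R) : 0 < s ->
  Ex P (fun w => h w * normal_pdf (X w) s v) =
  normal_peak s * Ex gauss (fun t => Ex P (fun w => h w * cos (- t / s * X w + t * v / s))).
Proof.
move=> s0.
have mc : measurable_fun setT (fun z : T * RB => - z.2 / s * X z.1 + z.2 * v / s).
  have m1 : measurable_fun setT (fun z : T * RB => z.2 : RB) by exact: measurable_snd.
  have m2 : measurable_fun setT (fun z : T * RB => X z.1) by exact: (measurableT_comp mX measurable_fst).
  apply: measurable_funD; last by apply: measurable_funM => //; exact: measurable_funM.
  by apply: measurable_funM => //; apply: measurable_funM => //; exact: measurable_funN.
have bz : bounded_measurable (fun z : T * RB => h z.1 * cos (- z.2 / s * X z.1 + z.2 * v / s)).
  apply: bmfM; last exact: bmf_cos.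
  by apply: (bmf_comp bh); exact: measurable_fst.
have <- := @Ex_swap _ _ _ _ _ P gauss (fun w t => h w * cos (- t / s * X w + t * v / s)) bz.
rewrite -ExZ; last by apply: summable_bmf; exact: (bmf_Ex_l P gauss bz).
apply: eq_Ex => w; rewrite normal_pdf_fourier // mulrCA; congr (_ * _).
rewrite -ExZ //; apply: summable_bmf; apply: bmf_cos.
exact: (measurableT_comp mc (measurable_pair1 w)).
Qed.

Hypothesis h0 : forall w, 0 <= h w.

(** Adding Gaussian noise of scale [s] gives the weighted law of [X] a Lebesgue density, the last
    factor, which by [Ex_normal_pdf_fourier] depends on the weighted cosine transforms only. The
    signs of [h] and [g] permit Tonelli. *)
Lemma Ex_smooth_fourier (g : RB -> R) (s : R) : 0 < s -> bounded_measurable g ->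
  (forall x, 0 <= g x) ->
  (Ex P (fun w => h w * Ex gauss (fun y => g (X w + s * y))))%:E =
  (\int[mu]_v ((g v)%:E * (Ex P (fun w => h w * normal_pdf (X w) s v))%:E))%E.
Proof.
move=> s0 bg g0.
have [mg _] := bg.
have mg' : measurable_fun setT (EFin \o g) by exact/measurable_EFinP.
have g0' x : (0 <= (EFin \o g) x)%E by rewrite lee_fin.
have bgs w : bounded_measurable (fun y : RB => g (X w + s * y)).
  by apply: (bmf_comp bg); exact: measurable_affine.
have inner w : (Ex gauss (fun y => g (X w + s * y)))%:E =
    (\int[mu]_v ((g v)%:E * (normal_pdf (X w) s v)%:E))%E.
  rewrite -EFin_Ex; last exact: summable_bmf.
  have <- := ge0_integral_gauss_affine (X w) s0 mg' g0'.
  exact: (ge0_integral_normal_prob (X w) s mg' g0').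
have mpdf : measurable_fun setT (fun z : T * RB => normal_pdf (X z.1) s z.2).
  have m1 : measurable_fun setT (fun z : T * RB => z.2 : RB) by exact: measurable_snd.
  have m2 : measurable_fun setT (fun z : T * RB => X z.1) by exact: (measurableT_comp mX measurable_fst).
  rewrite (_ : (fun _ => _) = (fun z : T * RB => normal_peak s * expR (- (z.2 - X z.1) ^+ 2 / (s ^+ 2 *+ 2)))).
    apply: measurable_funM => //; apply: measurableT_comp => //; apply: measurable_funM => //.
    by apply: measurable_funN; apply: measurable_funX; exact: measurable_funB.
  by apply/funext => z; rewrite normal_pdfE ?gt_eqF.
pose f (z : T * RB) := (h z.1 * (g z.2 * normal_pdf (X z.1) s z.2))%:E.
have f0 z : (0 <= f z)%E by rewrite lee_fin !mulr_ge0 // normal_pdf_ge0.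
have mf : measurable_fun setT f.
  apply/measurable_EFinP; apply: measurable_funM.
    exact: (measurableT_comp (proj1 bh) measurable_fst).
  by apply: measurable_funM => //; exact: (measurableT_comp mg measurable_snd).
have mpdfw w : measurable_fun setT (fun v : RB => normal_pdf (X w) s v) by exact: measurable_normal_pdf.
have bpdfv v : bounded_measurable (fun w => normal_pdf (X w) s v).
  split.
    exact: (measurableT_comp mpdf (measurable_pair2 v)).
  by exists (normal_peak s) => w; rewrite ger0_norm ?normal_pdf_ge0 // normal_pdf_ub ?gt_eqF.
rewrite -EFin_Ex; last first.
  apply: summable_bmf; apply: bmfM => //.
  have bz : bounded_measurable (fun z : T * RB => g (X z.1 + s * z.2)).
    apply: (bmf_comp bg); apply: measurable_funD.
      exact: (measurableT_comp mX measurable_fst).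
    by apply: measurable_funM => //; exact: measurable_snd.
  exact: (bmf_Ex_l P gauss bz).
transitivity (\int[P]_w \int[mu]_v f (w, v))%E.
  apply: eq_integral => w _; rewrite EFinM inner -ge0_integralZl //.
  - apply: emeasurable_funM => //; exact/measurable_EFinP.
  - by move=> v _; rewrite mule_ge0 // lee_fin ?normal_pdf_ge0.
  - by rewrite lee_fin.
rewrite (fubini_tonelli f mf f0); apply: eq_integral => v _.
rewrite -EFin_Ex; last exact/summable_bmf/bmfM.
rewrite -ge0_integralZl //.
- by apply: eq_integral => w _; rewrite -EFinM mulrCA.
- by apply/measurable_EFinP; case: (bmfM bh (bpdfv v)).
- by move=> w _; rewrite lee_fin mulr_ge0 // normal_pdf_ge0.
- by rewrite lee_fin.
Qed.

Lemma cvg_smooth (g : RB -> R) : bounded_measurable g -> (continuous (g : R -> R)) ->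
  Ex P (fun w => h w * Ex gauss (fun y => g (X w + n.+1%:R^-1 * y))) @[n --> \oo] -->
  Ex P (fun w => h w * g (X w)).
Proof.
move=> bg cg.
have mXs (s : R) : measurable_fun setT (fun z : T * RB => X z.1 + s * z.2).
  apply: measurable_funD; first exact: (measurableT_comp mX measurable_fst).
  by apply: measurable_funM => //; exact: measurable_snd.
have bF (s : R) : bounded_measurable (fun z : T * RB => h z.1 * g (X z.1 + s * z.2)).
  apply: bmfM; first by apply: (bmf_comp bh); exact: measurable_fst.
  exact: (bmf_comp bg (mXs s)).
have e (s : R) : Ex P (fun w => h w * Ex gauss (fun y => g (X w + s * y))) =
    Ex (prodP P gauss) (fun z => h z.1 * g (X z.1 + s * z.2)).
  rewrite Ex_prod_l //; apply: eq_Ex => w; rewrite -ExZ //.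
  by apply: summable_bmf; apply: (bmf_comp bg); exact: measurable_affine.
have -> : Ex P (fun w => h w * g (X w)) = Ex (prodP P gauss) (fun z => h z.1 * g (X z.1 + 0 * z.2)).
  rewrite -e; apply: eq_Ex => w; congr (_ * _); rewrite -[LHS](Ex_cst gauss).
  by apply: eq_Ex => y; rewrite mul0r addr0.
under eq_fun do rewrite e.
have [_ [M hM]] := bh; have [_ [N gN]] := bg.
apply: (@Ex_dct _ _ _ _ _ _ (M * N)).
- by move=> n; case: (bF n.+1%:R^-1).
- by case: (bF 0).
- by move=> n z; rewrite normrM ler_pM.
- move=> z; apply: cvgM; first exact: cvg_cst.
  have hc : (X z.1 + n.+1%:R^-1 * z.2 : R) @[n --> \oo] --> (X z.1 + 0 * z.2 : R).
    apply: cvgD; first exact: cvg_cst.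
    by apply: cvgM; [exact: cvg_harmonic|exact: cvg_cst].
  exact: (cvg_comp _ _ hc (cg _)).
Qed.

End smoothing.

Section ramp_functions.
Context {R : realType}.
Local Notation RB := (measurableTypeR R).

(** Continuity is what [cvg_smooth] asks for in order to remove the smoothing. The ramp vanishes
    from [x] on, so its limit is the indicator of an open half-line. *)
Definition ramp (x : R) (n : nat) (u : R) : R :=
  Order.min 1 (Order.max 0 (n.+1%:R * (x - u))).

Lemma continuous_ramp x n : continuous (ramp x n).
Proof.
move=> u; pose l (v : R) : R := n.+1%:R * (x - v).
have cl : {for u, continuous l}.
  by apply: cvgM; [exact: cvg_cst|apply: cvgB; [exact: cvg_cst|exact: cvg_id]].
have c0 : {for u, continuous (cst 0 : R -> R)} by exact: cvg_cst.
have c1 : {for u, continuous (cst 1 : R -> R)} by exact: cvg_cst.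
exact: (continuous_min c1 (continuous_max c0 cl)).
Qed.

Lemma ramp_ge0 x n u : 0 <= ramp x n u.
Proof. by rewrite /ramp le_min ler01 le_max lexx. Qed.

Lemma ramp_le1 x n u : ramp x n u <= 1.
Proof. by rewrite /ramp ge_min lexx. Qed.

Lemma bmf_ramp x n : bounded_measurable (ramp x n : RB -> R).
Proof.
split.
  by apply: continuous_measurable_fun; exact: continuous_ramp.
by exists 1 => u; rewrite ger0_norm ?ramp_ge0 // ramp_le1.
Qed.

Lemma cvg_ramp (x u : R) : ramp x n u @[n --> \oo] --> (\1_(`]-oo, x[ : set R) u : R).
Proof.
rewrite indicE; have [ux|xu] := ltP u x.
  rewrite mem_set /= ?in_itv //=; apply: cvg_near_cst; near=> n.
  apply/min_idPl; rewrite le_max; apply/orP; right.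
  rewrite -ler_pdivrMr ?subr_gt0 // -natr1 ler_wpDr //.
  by near: n; exact: nbhs_infty_ger.
rewrite memNset /= ?in_itv /=; last by apply/negP; rewrite -leNgt.
apply: cvg_near_cst; near=> n; rewrite /ramp (max_idPl _) ?(min_idPr _) //.
by rewrite pmulr_rle0 // subr_le0.
Unshelve. all: by end_near. Qed.

End ramp_functions.

Section fourier_uniqueness.
Context {d1 d2} {T1 : measurableType d1} {T2 : measurableType d2} {R : realType}.
Local Notation RB := (measurableTypeR R).
Variables (P1 : probability T1 R) (P2 : probability T2 R).
Variables (X1 : T1 -> RB) (X2 : T2 -> RB).
Hypotheses (mX1 : measurable_fun setT X1) (mX2 : measurable_fun setT X2).

Section weights.
Variables (h1 : T1 -> R) (h2 : T2 -> R).
Hypotheses (bh1 : bounded_measurable h1) (bh2 : bounded_measurable h2).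

Let same (f : RB -> R) :=
  Ex P1 (fun w => h1 w * f (X1 w)) = Ex P2 (fun w => h2 w * f (X2 w)).

Let sum1 (f : RB -> R) : bounded_measurable f -> summable_rv P1 (fun w => h1 w * f (X1 w)).
Proof. by move=> bf; apply/summable_bmf/bmfM => //; exact: (bmf_comp bf mX1). Qed.

Let sum2 (f : RB -> R) : bounded_measurable f -> summable_rv P2 (fun w => h2 w * f (X2 w)).
Proof. by move=> bf; apply/summable_bmf/bmfM => //; exact: (bmf_comp bf mX2). Qed.

Let same_lim (F : nat -> RB -> R) (f : RB -> R) (M : R) :
  (forall n, measurable_fun setT (F n)) -> measurable_fun setT f ->
  (forall n x, `|F n x| <= M) -> (forall x, F n x @[n --> \oo] --> f x) ->
  (forall n, same (F n)) -> same f.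
Proof.
move=> mF mf FM Ff sF.
have [_ [M1 hM1]] := bh1; have [_ [M2 hM2]] := bh2.
have c1 : Ex P1 (fun w => h1 w * F n (X1 w)) @[n --> \oo] --> Ex P1 (fun w => h1 w * f (X1 w)).
  apply: (@Ex_dct _ _ _ _ _ _ (M1 * M)).
  - by move=> n; apply: measurable_funM; [case: bh1|exact: (measurableT_comp (mF n) mX1)].
  - by apply: measurable_funM; [case: bh1|exact: (measurableT_comp mf mX1)].
  - by move=> n x; rewrite normrM ler_pM.
  - by move=> x; apply: cvgM; [exact: cvg_cst|exact: Ff].
have c2 : Ex P2 (fun w => h2 w * F n (X2 w)) @[n --> \oo] --> Ex P2 (fun w => h2 w * f (X2 w)).
  apply: (@Ex_dct _ _ _ _ _ _ (M2 * M)).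
  - by move=> n; apply: measurable_funM; [case: bh2|exact: (measurableT_comp (mF n) mX2)].
  - by apply: measurable_funM; [case: bh2|exact: (measurableT_comp mf mX2)].
  - by move=> n x; rewrite normrM ler_pM.
  - by move=> x; apply: cvgM; [exact: cvg_cst|exact: Ff].
have e : (fun n => Ex P1 (fun w => h1 w * F n (X1 w))) =
    (fun n => Ex P2 (fun w => h2 w * F n (X2 w))) by apply/funext => n; exact: sF.
by rewrite e in c1; exact: (cvg_unique _ c1 c2).
Qed.

Let sameB (f g : RB -> R) : bounded_measurable f -> bounded_measurable g ->
  same f -> same g -> same (fun x => f x - g x).
Proof.
move=> bf bg sf sg; rewrite /same.
under eq_Ex do rewrite mulrBr; under [in RHS]eq_Ex do rewrite mulrBr.
by rewrite !ExB ?sf ?sg //; [exact: sum2..|exact: sum1|exact: sum1].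
Qed.

Let same_sum n (c : R) (F : nat -> RB -> R) : (forall j, bounded_measurable (F j)) ->
  (forall j, same (F j)) -> same (fun x => \sum_(j < n) c * F j x).
Proof.
move=> bF sF; rewrite /same.
under eq_Ex do rewrite mulr_sumr; under [in RHS]eq_Ex do rewrite mulr_sumr.
rewrite !Ex_sum; last 2 first.
- by move=> j; exact: (sum2 (bmfZ c (bF j))).
- by move=> j; exact: (sum1 (bmfZ c (bF j))).
apply: eq_bigr => j _.
under eq_Ex do rewrite mulrCA; under [in RHS]eq_Ex do rewrite mulrCA.
by rewrite !ExZ ?sF //; [exact: sum2|exact: sum1].
Qed.

(* open half-lines, then all Borel sets by the pi-lambda theorem, then uniform limits *)
Let same_extend : (forall x : R, same (\1_(`]-oo, x[ : set RB))) ->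
  forall f : RB -> R, bounded_measurable f -> same f.
Proof.
move=> sI.
have s1 : same (fun=> 1).
  apply: (same_lim (F := fun n => \1_(`]-oo, n%:R[ : set RB)) (M := 1)) => //.
  - by move=> n x; rewrite indicE; case: (_ \in _); rewrite ?normr1 ?normr0.
  - move=> x; apply: cvg_near_cst; near=> n; rewrite indicE mem_set //= in_itv /=.
    by near: n; exact: nbhs_infty_gtr.
have sA (A : set RB) : measurable A -> same (\1_A).
  move=> mA; have sAs : <<s [set B | exists x : R, B = `]-oo, x[%classic] >> A.
    suff <- : @measurable _ RB = <<s [set B | exists x : R, B = `]-oo, x[%classic] >> by [].
    exact: RGenInftyO.measurableE.
  apply: (@dynkin_induction _ RB [set B | exists x : R, B = `]-oo, x[%classic]
    (fun B => same (\1_B))) sAs.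
  - exact: RGenInftyO.measurableE.
  - move=> _ _ [x ->] [y ->]; exists (Order.min x y).
    by apply/seteqP; split => z; rewrite /= !in_itv /= lt_min; [case=> -> ->|case/andP].
  - by rewrite indicT.
  - by move=> _ [x ->]; exact: sI.
  - move=> S mS sS.
    rewrite (_ : \1_(~` S) = (fun x => 1 - \1_S x)); last first.
      by apply/funext => x; rewrite !indicE in_setC; case: (_ \in _); rewrite ?subrr ?subr0.
    by apply: sameB => //; exact: bmf_indic.
  - move=> F mF tF sF.
    (* By disjointness at most one indicator is nonzero at [x]; the partial sums stay in [[0, 1]]
       and dominated convergence applies. *)
    have inF k n x : F k x -> \sum_(j < n) 1 * \1_(F j) x = (k < n)%N%:R :> R.
      move=> Fkx; elim: n => [|n IH]; first by rewrite big_ord0 ltn0.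
      rewrite big_ord_recr /= IH mul1r indicE ltnS [in RHS]leq_eqVlt.
      have [kn|nk] := eqVneq k n; first by rewrite kn ltnn mem_set ?add0r // -kn.
      rewrite memNset ?addr0 // => Fnx; move/eqP: nk; apply.
      by apply: tF => //; exists x.
    have notF n x : ~ (\bigcup_k F k) x -> \sum_(j < n) 1 * \1_(F j) x = 0 :> R.
      move=> Fx; rewrite big1 // => j _; rewrite mul1r indicE memNset // => Fjx.
      by apply: Fx; exists j.
    apply: (same_lim (F := fun n x => \sum_(j < n) 1 * \1_(F j) x) (M := 1)).
    + by move=> n; apply: measurable_sum => j; apply: measurable_funM.
    + by apply: measurable_indic; exact: bigcup_measurable.
    + move=> n x; have [[k _ /inF ->]|/notF ->] := pselect ((\bigcup_k F k) x); last by rewrite normr0.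
      by case: (_ < _)%N; rewrite ?normr1 ?normr0.
    + move=> x; rewrite indicE; have [Fx|Fx] := pselect ((\bigcup_k F k) x).
        rewrite mem_set //; case: Fx => k _ Fkx; apply: cvg_near_cst; near=> n.
        have kn : (k < n)%N by near: n; exact: nbhs_infty_gt.
        by rewrite (inF k) // kn.
      by rewrite memNset //; apply: cvg_near_cst; near=> n; exact: notF.
    + by move=> n; exact: (@same_sum n 1 (fun j => \1_(F j)) (fun j => bmf_indic (mF j)) sF).
have sP (f : RB -> R) : bounded_measurable f -> (forall x, 0 <= f x) -> same f.
  move=> bf f0; have [mf [C fC]] := bf.
  have C0 : 0 < `|C| + 1 by rewrite ltr_wpDl.
  have fC' x : f x <= `|C| + 1.
    by rewrite (le_trans (ler_norm _)) // (le_trans (fC x)) // ler_wpDr // ler_norm.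
  apply: (same_lim (F := fun n x => \sum_(j < n.+1) (`|C| + 1) / n.+1%:R * \1_(layer f (`|C| + 1) n j) x)
     (M := 2 * (`|C| + 1))).
  - by move=> n; apply: measurable_sum => j; apply: measurable_funM => //;
      apply: measurable_indic; exact: measurable_layer.
  - by [].
  - have triv (q D v S : R) : q <= D -> 0 <= v -> v <= D -> - q <= S - v <= q ->
        - (2 * D) <= S <= 2 * D.
      by move=> ? ? ? /andP[? ?]; apply/andP; split; lra.
    move=> n x; have := layer_cake f0 fC' C0 n x.
    have C1 : (`|C| + 1) / n.+1%:R <= `|C| + 1.
      by rewrite ler_pdivrMr // ler_peMr ?(ltW C0) // ler1n.
    have := fC' x; have := f0 x; set S := \sum_(_ < _) _; rewrite !ler_norml.
    exact: triv C1.
  - move=> x; apply/cvgrPdist_le => e e0; near=> n.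
    rewrite distrC (le_trans (layer_cake f0 fC' C0 n x)) //.
    rewrite ler_pdivrMr // mulrC -ler_pdivrMr // -natr1 ler_wpDr //.
    by near: n; apply: nbhs_infty_ger.
  - move=> n; have mL j : measurable (layer f (`|C| + 1) n j) by exact: measurable_layer.
    exact: (@same_sum n.+1 _ (fun j => \1_(layer f (`|C| + 1) n j))
      (fun j => bmf_indic (mL j)) (fun j => sA _ (mL j))).
move=> f bf; have [mf [C fC]] := bf.
rewrite (_ : f = (fun x => (f x + C) - C)); last by apply/funext => x; rewrite addrK.
have C0 : 0 <= C by rewrite (le_trans _ (fC 0)).
apply: sameB => //; first exact: bmfD.
  apply: sP; first exact: bmfD.
  by move=> x; have := fC x; rewrite ler_norml -lerBlDr sub0r => /andP[].
by apply: sP.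
Unshelve. all: by end_near. Qed.

(** Equal cosine transforms give equal densities after smoothing; letting the noise vanish gives
    equality on continuous functions, in particular on ramps, and these tend to indicators of
    half-lines. *)
Lemma fourier_unique_ge0 : (forall w, 0 <= h1 w) -> (forall w, 0 <= h2 w) ->
  (forall t b, Ex P1 (fun w => h1 w * cos (t * X1 w + b)) =
               Ex P2 (fun w => h2 w * cos (t * X2 w + b))) ->
  forall f : RB -> R, bounded_measurable f ->
  Ex P1 (fun w => h1 w * f (X1 w)) = Ex P2 (fun w => h2 w * f (X2 w)).
Proof.
move=> h10 h20 H; apply: same_extend => x.
apply: (same_lim (F := ramp x) (M := 1)).
- by move=> n; case: (bmf_ramp x n).
- by [].
- by move=> n u; rewrite ger0_norm ?ramp_ge0 // ramp_le1.
- exact: cvg_ramp.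
move=> n; have bg := bmf_ramp x n; have cg : continuous (ramp x n) by exact: continuous_ramp.
have c1 := @cvg_smooth _ T1 R P1 h1 X1 bh1 mX1 _ bg cg.
have c2 := @cvg_smooth _ T2 R P2 h2 X2 bh2 mX2 _ bg cg.
have e : (fun m => Ex P1 (fun w => h1 w * Ex gauss (fun y => ramp x n (X1 w + m.+1%:R^-1 * y)))) =
   (fun m => Ex P2 (fun w => h2 w * Ex gauss (fun y => ramp x n (X2 w + m.+1%:R^-1 * y)))).
  apply/funext => m; have m0 : 0 < m.+1%:R^-1 :> R by [].
  apply: EFin_inj; rewrite (Ex_smooth_fourier P1 bh1 mX1 h10 m0 bg (ramp_ge0 x n)).
  rewrite (Ex_smooth_fourier P2 bh2 mX2 h20 m0 bg (ramp_ge0 x n)).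
  apply: eq_integral => v _; congr (_ * _%:E)%E.
  rewrite (Ex_normal_pdf_fourier P1 bh1 mX1 v m0) (Ex_normal_pdf_fourier P2 bh2 mX2 v m0).
  by congr (_ * _); apply: eq_Ex => t; exact: H.
by rewrite e in c1; exact: (cvg_unique _ c1 c2).
Qed.

End weights.

(** Weights of arbitrary sign occur below, since they contain cosines. A common constant [M] makes
    them nonnegative, and equality of the unweighted transforms keeps the hypothesis true for the
    shifted weights. *)
Lemma fourier_unique (h1 : T1 -> R) (h2 : T2 -> R) :
  bounded_measurable h1 -> bounded_measurable h2 ->
  (forall t b, Ex P1 (fun w => h1 w * cos (t * X1 w + b)) =
               Ex P2 (fun w => h2 w * cos (t * X2 w + b))) ->
  (forall t b, Ex P1 (fun w => cos (t * X1 w + b)) = Ex P2 (fun w => cos (t * X2 w + b))) ->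
  forall f : RB -> R, bounded_measurable f ->
  Ex P1 (fun w => h1 w * f (X1 w)) = Ex P2 (fun w => h2 w * f (X2 w)).
Proof.
move=> bh1 bh2 H H1 f bf; have [_ [M1 hM1]] := bh1; have [_ [M2 hM2]] := bh2.
pose M := `|M1| + `|M2|.
have M0 : 0 <= M by rewrite addr_ge0.
have p1 w : 0 <= h1 w + M.
  have := hM1 w; rewrite ler_norml => /andP[+ _]; have := ler_norm M1; have := normr_ge0 M2.
  by rewrite /M; lra.
have p2 w : 0 <= h2 w + M.
  have := hM2 w; rewrite ler_norml => /andP[+ _]; have := ler_norm M2; have := normr_ge0 M1.
  by rewrite /M; lra.
have i1 (g : RB -> R) : bounded_measurable g -> bounded_measurable (fun w => g (X1 w)).
  by move=> bg; exact: (bmf_comp bg mX1).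
have i2 (g : RB -> R) : bounded_measurable g -> bounded_measurable (fun w => g (X2 w)).
  by move=> bg; exact: (bmf_comp bg mX2).
have s1 (g : RB -> R) : bounded_measurable g ->
    Ex P1 (fun w => (h1 w + M) * g (X1 w)) =
    Ex P1 (fun w => h1 w * g (X1 w)) + Ex P1 (fun w => M * g (X1 w)).
  move=> bg; rewrite -ExD; last 2 first.
  - exact: (summable_bmf P1 (bmfM bh1 (i1 _ bg))).
  - exact: (summable_bmf P1 (bmfZ M (i1 _ bg))).
  by apply: eq_Ex => w; rewrite mulrDl.
have s2 (g : RB -> R) : bounded_measurable g ->
    Ex P2 (fun w => (h2 w + M) * g (X2 w)) =
    Ex P2 (fun w => h2 w * g (X2 w)) + Ex P2 (fun w => M * g (X2 w)).
  move=> bg; rewrite -ExD; last 2 first.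
  - exact: (summable_bmf P2 (bmfM bh2 (i2 _ bg))).
  - exact: (summable_bmf P2 (bmfZ M (i2 _ bg))).
  by apply: eq_Ex => w; rewrite mulrDl.
have HM t b : Ex P1 (fun w => M * cos (t * X1 w + b)) = Ex P2 (fun w => M * cos (t * X2 w + b)).
  rewrite !ExZ ?H1 //; first exact: (summable_bmf P2 (i2 _ (bmf_trig t b))).
  exact: (summable_bmf P1 (i1 _ (bmf_trig t b))).
have A := fourier_unique_ge0 (bmfD bh1 (bmf_cst M)) (bmfD bh2 (bmf_cst M)) p1 p2.
have B := fourier_unique_ge0 (bmf_cst M) (bmf_cst M) (fun=> M0) (fun=> M0) HM bf.
have : Ex P1 (fun w => (h1 w + M) * f (X1 w)) = Ex P2 (fun w => (h2 w + M) * f (X2 w)).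
  apply: A => // t b; rewrite (s1 _ (bmf_trig t b)) (s2 _ (bmf_trig t b)).
  by rewrite H HM.
by rewrite (s1 _ bf) (s2 _ bf) B => /addIr.
Qed.

End fourier_uniqueness.

Section fourier_uniqueness_joint.
Context {d1 d2} {T1 : measurableType d1} {T2 : measurableType d2} {R : realType}.
Local Notation RB := (measurableTypeR R).
Variables (P1 : probability T1 R) (P2 : probability T2 R).
Variables (X1 : nat -> T1 -> RB) (X2 : nat -> T2 -> RB) (n : nat).
Hypotheses (mX1 : forall i, measurable_fun setT (X1 i))
  (mX2 : forall i, measurable_fun setT (X2 i)).
Hypothesis same_cos : forall (c : nat -> R) (b : R),
  Ex P1 (fun w => cos (\sum_(i < n) c i * X1 i w + b)) =
  Ex P2 (fun w => cos (\sum_(i < n) c i * X2 i w + b)).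

Let bmf_tail {d} {T : measurableType d} (X : nat -> T -> RB) m c b :
  (forall i, measurable_fun setT (X i)) ->
  bounded_measurable (fun w => cos (\sum_(m <= i < n) c i * X i w + b)).
Proof.
move=> mX; apply: bmf_cos; apply: measurable_funD => //.
apply: measurable_sum => i; apply: measurable_funM => //; exact: mX.
Qed.

Let bmf_head {d} {T : measurableType d} (X : nat -> T -> RB) m (f : nat -> RB -> R) :
  (forall i, measurable_fun setT (X i)) -> (forall i, bounded_measurable (f i)) ->
  bounded_measurable (fun w => \prod_(i < m) f i (X i w)).
Proof. by move=> mX bf; apply: bmf_prod => i; exact: (bmf_comp (bf i) (mX i)). Qed.

Let cos_prod (x y : R) : cos x * cos y = 2^-1 * cos (x + y) + 2^-1 * cos (x + - 1 * y).
Proof. by rewrite mulN1r !cosD cosN sinN; field. Qed.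

Let head_cosM {d} {T : measurableType d} (P : probability T R) (X : nat -> T -> RB)
    m (f : nat -> RB -> R) c b t b' : (m < n)%N ->
  (forall i, measurable_fun setT (X i)) -> (forall i, bounded_measurable (f i)) ->
  let c' (s : R) := fun i => if i == m then s * t else c i in
  Ex P (fun w => \prod_(i < m) f i (X i w) * cos (\sum_(m.+1 <= i < n) c i * X i w + b)
                 * cos (t * X m w + b')) =
  2^-1 * Ex P (fun w => \prod_(i < m) f i (X i w) * cos (\sum_(m <= i < n) c' 1 i * X i w + (b + b'))) +
  2^-1 * Ex P (fun w => \prod_(i < m) f i (X i w) * cos (\sum_(m <= i < n) c' (- 1) i * X i w + (b - b'))).
Proof.
move=> mn mX bf c'.
have e s w : \sum_(m <= i < n) c' s i * X i w =
    s * t * X m w + \sum_(m.+1 <= i < n) c i * X i w.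
  rewrite big_ltn // /c' eqxx; congr (_ + _); apply: eq_big_nat => i /andP[mi _].
  by rewrite gtn_eqF.
have bp s b0 : bounded_measurable (fun w => \prod_(i < m) f i (X i w) *
    cos (\sum_(m <= i < n) c' s i * X i w + b0)).
  exact: (bmfM (bmf_head m mX bf) (bmf_tail m _ b0 mX)).
rewrite -!ExZ -?ExD; try by do ?apply: summableZ; exact/summable_bmf/bp.
apply: eq_Ex => w; rewrite -mulrA cos_prod mulrDr !e; congr (_ + _).
- by rewrite mulrCA; congr (_ * (_ * cos _)); ring.
- by rewrite mulrCA; congr (_ * (_ * cos _)); ring.
Qed.

(** Cosines are replaced by arbitrary functions one coordinate at a time. The cosine of the
    remaining coordinates belongs to the weight; [head_cosM] linearises its product with
    [cos (t X_m + b')] into two cosines with coefficients [t] and [- t] at [m], which the induction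
    hypothesis covers. *)
Let same_mixed m : (m <= n)%N -> forall (f : nat -> RB -> R), (forall i, bounded_measurable (f i)) ->
  forall c b,
  Ex P1 (fun w => \prod_(i < m) f i (X1 i w) * cos (\sum_(m <= i < n) c i * X1 i w + b)) =
  Ex P2 (fun w => \prod_(i < m) f i (X2 i w) * cos (\sum_(m <= i < n) c i * X2 i w + b)).
Proof.
elim: m => [|m IH] mn f bf c b.
  have := same_cos c b; rewrite (eq_Ex P1 (g := fun w => \prod_(i < 0) f i (X1 i w) * cos (\sum_(0 <= i < n) c i * X1 i w + b))).
    rewrite (eq_Ex P2 (g := fun w => \prod_(i < 0) f i (X2 i w) * cos (\sum_(0 <= i < n) c i * X2 i w + b))) //.
    by move=> w; rewrite big_ord0 mul1r big_mkord.
  by move=> w; rewrite big_ord0 mul1r big_mkord.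
have IH' := IH (ltnW mn).
transitivity (Ex P1 (fun w => \prod_(i < m) f i (X1 i w) *
    cos (\sum_(m.+1 <= i < n) c i * X1 i w + b) * f m (X1 m w))).
  by apply: eq_Ex => w; rewrite big_ord_recr /= mulrAC.
transitivity (Ex P2 (fun w => \prod_(i < m) f i (X2 i w) *
    cos (\sum_(m.+1 <= i < n) c i * X2 i w + b) * f m (X2 m w))); last first.
  by apply: eq_Ex => w; rewrite big_ord_recr /= mulrAC.
apply: fourier_unique => //.
- exact: (bmfM (bmf_head m mX1 bf) (bmf_tail m.+1 c b mX1)).
- exact: (bmfM (bmf_head m mX2 bf) (bmf_tail m.+1 c b mX2)).
- by move=> t b'; rewrite !head_cosM // !IH'.
(* The unweighted transform of [X_m] is the case where all earlier functions are 1 and [m] carries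
   the only nonzero coefficient. *)
- move=> t b'; have := IH' (fun _ _ => 1) (fun=> bmf_cst 1) (fun i => if i == m then t else 0) b'.
  have e (T : Type) (X : nat -> T -> RB) w : \prod_(i < m) 1 *
      cos (\sum_(m <= i < n) (if i == m then t else 0) * X i w + b') = cos (t * X m w + b').
    rewrite big1_eq mul1r big_ltn // eqxx big_nat_cond big1 ?addr0 // => i /andP[/andP[mi _] _].
    by rewrite gtn_eqF // mul0r.
  by rewrite (eq_Ex P1 (e _ X1)) (eq_Ex P2 (e _ X2)).
Qed.

(** A Cramer-Wold theorem, stated for product functions because the probability of a word given the
    process is such a product. *)
Lemma fourier_unique_joint (f : nat -> RB -> R) : (forall i, bounded_measurable (f i)) ->
  Ex P1 (fun w => \prod_(i < n) f i (X1 i w)) = Ex P2 (fun w => \prod_(i < n) f i (X2 i w)).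
Proof.
move=> bf; have := same_mixed (leqnn n) bf (fun=> 0) 0.
have e (T : Type) (X : nat -> T -> RB) w : \prod_(i < n) f i (X i w) *
    cos (\sum_(n <= i < n) 0 * X i w + 0) = \prod_(i < n) f i (X i w).
  by rewrite big_geq // add0r cos0 mulr1.
by rewrite (eq_Ex P1 (e _ X1)) (eq_Ex P2 (e _ X2)).
Qed.

End fourier_uniqueness_joint.

(* Keeps [//] and unification from unfolding integrals. *)
Opaque Ex iid_gauss.

(** The bound of entropy by chi-square: for [x = b / q], [ln x <= x - 1] gives
    [x ln x - x <= (x - 1)^2 - 1], and [fenchel_exp] concludes. *)
Lemma divergence_ratio {R : realType} (b q r g : R) : 0 <= b -> 0 <= q ->
  `|b - q| <= r * q -> b * g <= q * expR g - q + r ^+ 2 * q.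
Proof.
move=> b0; rewrite le_eqVlt => /predU1P[<-|q0].
  by rewrite mulr0 subr0 normr_le0 => /eqP ->; rewrite !mul0r subr0 mulr0 addr0.
move=> bq; pose x := b / q.
have bE : b = x * q by rewrite /x divfK ?gt_eqF.
have x0 : 0 <= x by rewrite divr_ge0 // ltW.
have xr : (x - 1) ^+ 2 <= r ^+ 2.
  have h : `|x - 1| <= r.
    have := bq; rewrite bE -{2}[q]mul1r -mulrBl normrM (gtr0_norm q0).
    by rewrite ler_pM2r.
  by rewrite -real_normK ?num_real // lerXn2r ?nnegrE // (le_trans _ h).
suff h : x * g <= (x - 1) ^+ 2 - 1 + expR g.
  have : x * g * q <= (r ^+ 2 - 1 + expR g) * q by rewrite ler_pM2r //; lra.
  by rewrite bE; lra.
move: x0; rewrite le_eqVlt => /predU1P[<-|x0].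
  by rewrite mul0r sub0r sqrrN expr1n subrr add0r expR_ge0.
have := fenchel_exp g x0; have : ln x <= x - 1.
  by have := expR_ge1Dx (ln x); rewrite lnK ?posrE //; lra.
nra.
Qed.

(** * Divergence of a quantised moving average *)

Section words.
Context {R : realType} {T : finType}.

Definition ext n (wd : {ffun 'I_n -> T}) (t : T) : {ffun 'I_n.+1 -> T} :=
  [ffun i => if unlift ord_max i is Some j then wd j else t].

Lemma ext_max n (wd : {ffun 'I_n -> T}) t : ext wd t ord_max = t.
Proof. by rewrite ffunE unlift_none. Qed.

Lemma ext_widen n (wd : {ffun 'I_n -> T}) t (i : 'I_n) :
  ext wd t (widen_ord (leqnSn n) i) = wd i.
Proof.
have -> : widen_ord (leqnSn n) i = lift ord_max i.
  by apply: val_inj; rewrite /= /bump leqNgt ltn_ord.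
by rewrite ffunE liftK.
Qed.

Lemma sum_ext n (F : {ffun 'I_n.+1 -> T} -> R) :
  \sum_wd F wd = \sum_(wd : {ffun 'I_n -> T}) \sum_t F (ext wd t).
Proof.
rewrite pair_big /= (reindex (fun p : {ffun 'I_n -> T} * T => ext p.1 p.2)) //=.
exists (fun wd => ([ffun i => wd (lift ord_max i)], wd ord_max)) => [[wd t] _|wd _] /=.
  rewrite ext_max; congr pair; apply/ffunP => i; rewrite !ffunE liftK //.
apply/ffunP => i; rewrite ffunE; case: unliftP => [j ->|->] //.
by rewrite ffunE.
Qed.

Lemma prod_ext n (F : nat -> T -> R) (wd : {ffun 'I_n -> T}) t :
  \prod_(i < n.+1) F i (ext wd t i) = (\prod_(i < n) F i (wd i)) * F n t.
Proof.
rewrite big_ord_recr /= ext_max; congr (_ * _).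
by apply: eq_bigr => i _; rewrite ext_widen.
Qed.

Lemma sum_prod_words n (F : nat -> T -> R) :
  \sum_(wd : {ffun 'I_n -> T}) \prod_(i < n) F i (wd i) = \prod_(i < n) \sum_t F i t.
Proof. by rewrite bigA_distr_bigA. Qed.

End words.

Section moving_average.
Context {R : realType}.
Local Notation RB := (measurableTypeR R).
Local Notation Om := (prod_space (fun _ : nat => RB)).
Variables (T : finType) (h M : nat) (rho E : R) (K : nat -> RB -> T -> R).
Hypothesis h_gt0 : (0 < h)%N.
Hypothesis bK : forall i t, bounded_measurable (fun v => K i v t).
Hypothesis K_ge0 : forall i v t, 0 <= K i v t.
Hypothesis sumK : forall i v, \sum_t K i v t = 1.
Hypothesis E_ge1 : 1 <= E.
Hypothesis K_ratio : forall i v v' t, K i v t <= E * K i v' t.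
Implicit Types (w : Om) (y : RB).

Definition mov_avg w (i : nat) : RB := w (i + h)%N + rho * w i.

Definition likelihood n (wd : {ffun 'I_n -> T}) w : R := \prod_(i < n) K i (mov_avg w i) (wd i).

Definition word_prob n (wd : {ffun 'I_n -> T}) : R := Ex (iid_gauss M) (likelihood wd).

(** Law of letter [i] given the old noise [w i = y], the fresh noise [w (i + h)] being integrated
    out. *)
Definition Kbar i (y : RB) t : R := Ex gauss (fun e => K i (e + rho * y) t).

Definition Kmarg i t : R := Ex gauss (fun y => Kbar i y t).

(** Law of the word when the moving average is replaced by independent normal variables of variance
    [1 + rho^2]. *)
Definition indep_prob n (wd : {ffun 'I_n -> T}) : R := \prod_(i < n) Kmarg i (wd i).

Lemma measurable_ma i : measurable_fun setT (fun w => mov_avg w i).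
Proof.
apply: measurable_funD; first exact: measurable_coordR.
by apply: measurable_funM => //; exact: measurable_coordR.
Qed.

Lemma bmf_like n (wd : {ffun 'I_n -> T}) : bounded_measurable (likelihood wd).
Proof. by apply: bmf_prod => i; exact: (bmf_comp (bK i (wd i)) (measurable_ma i)). Qed.

Lemma bmf_Kbar2 i t : bounded_measurable (fun z : RB * RB => K i (z.2 + rho * z.1) t).
Proof.
apply: (bmf_comp (bK i t)); apply: measurable_funD; first exact: measurable_snd.
by apply: measurable_funM => //; exact: measurable_fst.
Qed.

Lemma bmf_Kshift i y t : bounded_measurable (fun e : RB => K i (e + rho * y) t).
Proof. exact: (bmf_fst (bmf_Kbar2 i t) y). Qed.

Lemma bmf_Kbar i t : bounded_measurable (fun y => Kbar i y t).
Proof. exact: (bmf_Ex_l gauss gauss (bmf_Kbar2 i t)). Qed.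

Lemma like_ge0 n (wd : {ffun 'I_n -> T}) w : 0 <= likelihood wd w.
Proof. by apply: prodr_ge0 => i _. Qed.

Lemma Kbar_ge0 i y t : 0 <= Kbar i y t.
Proof. exact: Ex_ge0. Qed.

Lemma Kmarg_ge0 i t : 0 <= Kmarg i t.
Proof. by apply: Ex_ge0 => y; exact: Kbar_ge0. Qed.

Lemma sum_Kbar i y : \sum_t Kbar i y t = 1.
Proof.
rewrite -Ex_sum; last by move=> t; apply: summable_bmf; exact: bmf_Kshift.
by rewrite -[RHS](Ex_cst gauss); apply: eq_Ex => e; exact: sumK.
Qed.

Lemma sum_Kmarg i : \sum_t Kmarg i t = 1.
Proof.
rewrite -Ex_sum; last by move=> t; apply: summable_bmf; exact: bmf_Kbar.
by rewrite -[RHS](Ex_cst gauss); apply: eq_Ex => e; exact: sum_Kbar.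
Qed.

Lemma Ex_Kbar_sum i y (f : T -> R) :
  Ex gauss (fun e => \sum_t K i (e + rho * y) t * f t) = \sum_t Kbar i y t * f t.
Proof.
rewrite Ex_sum; last by move=> t; apply/summable_bmf/bmfM => //; exact: bmf_Kshift.
apply: eq_bigr => t _; rewrite /Kbar [RHS]mulrC -ExZ; last by apply: summable_bmf; exact: bmf_Kshift.
by apply: eq_Ex => e; rewrite mulrC.
Qed.

Lemma bmf_Kbar_sum i (f : T -> R) : bounded_measurable (fun y : RB => \sum_t Kbar i y t * f t).
Proof. by apply: bmf_sum => t; apply: bmfM => //; exact: bmf_Kbar. Qed.

Lemma Ex_Kmarg_sum i (f : T -> R) :
  Ex gauss (fun y => \sum_t Kbar i y t * f t) = \sum_t Kmarg i t * f t.
Proof.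
rewrite Ex_sum; last by move=> t; apply/summable_bmf/bmfM => //; exact: bmf_Kbar.
apply: eq_bigr => t _; rewrite /Kmarg [RHS]mulrC -ExZ; last by apply: summable_bmf; exact: bmf_Kbar.
by apply: eq_Ex => e; rewrite mulrC.
Qed.

Lemma sum_like n w : \sum_wd likelihood (n := n) wd w = 1.
Proof.
rewrite (sum_prod_words n (fun i => K i (mov_avg w i))).
by rewrite big1.
Qed.

Lemma like_ext n (wd : {ffun 'I_n -> T}) t w : likelihood (ext wd t) w = likelihood wd w * K n (mov_avg w n) t.
Proof. exact: (prod_ext (fun i => K i (mov_avg w i))). Qed.

(** Noise coordinate [j] enters only the letters [j] and [j - h]; the two hypotheses exclude both
    from the word. *)
Lemma like_upd n (wd : {ffun 'I_n -> T}) w j y :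
  (n <= j)%N -> (forall i, (i < n)%N -> (i + h)%N != j) -> likelihood wd (upd w j y) = likelihood wd w.
Proof.
move=> nj ij; apply: eq_bigr => i _; congr (K i _ _).
rewrite /mov_avg /upd (negbTE (ij i (ltn_ord i))) ifN_eq //.
by rewrite neq_ltn (leq_trans (ltn_ord i) nj).
Qed.

(** The coordinate [w (n + h)] is seen by no earlier letter, so it can be integrated out;
    [n + h < M] guarantees that it is random and not one of the vanishing coordinates. *)
Lemma word_prob_ext n (wd : {ffun 'I_n -> T}) t : (n + h < M)%N ->
  word_prob (ext wd t) = Ex (iid_gauss M) (fun w => likelihood wd w * Kbar n (w n) t).
Proof.
move=> nM; rewrite /word_prob (resample nM); last exact: bmf_like.
apply: eq_Ex => w; rewrite -ExZ; last by apply: summable_bmf; exact: bmf_Kshift.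
apply: eq_Ex => y; rewrite like_ext like_upd ?leq_addr //; last first.
  by move=> i ni; rewrite eqn_add2r ltn_eqF.
rewrite /mov_avg /upd eqxx ifN_eq //.
by rewrite -[X in X == _]addn0 eqn_add2l eq_sym -lt0n.
Qed.

Lemma sum_word_prob_ext n (wd : {ffun 'I_n -> T}) :
  \sum_t word_prob (ext wd t) = word_prob wd.
Proof.
rewrite -Ex_sum; last by move=> t; apply: summable_bmf; exact: bmf_like.
apply: eq_Ex => w; rewrite (eq_bigr (fun t => likelihood wd w * K n (mov_avg w n) t)).
  by rewrite -mulr_sumr sumK mulr1.
by move=> t _; rewrite like_ext.
Qed.

Lemma word_prob_ge0 n (wd : {ffun 'I_n -> T}) : 0 <= word_prob wd.
Proof. by apply: Ex_ge0 => w; exact: like_ge0. Qed.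

Lemma sum_word_prob n : \sum_(wd : {ffun 'I_n -> T}) word_prob wd = 1.
Proof.
rewrite -Ex_sum; last by move=> wd; apply: summable_bmf; exact: bmf_like.
by rewrite -[RHS](Ex_cst (iid_gauss M)); apply: eq_Ex => w; exact: sum_like.
Qed.

(** Letters before [n < h] involve [w i] with [i < n] and [w (i + h)] with [i + h > n], never [w n],
    which can therefore be averaged separately. *)
Lemma word_prob_ext_indep n (wd : {ffun 'I_n -> T}) t : (n < h)%N -> (n + h < M)%N ->
  word_prob (ext wd t) = word_prob wd * Kmarg n t.
Proof.
move=> nh nM; have nM' : (n < M)%N by rewrite (leq_ltn_trans _ nM) // leq_addr.
have bl := bmf_like wd; have bk := bmf_comp (bmf_Kbar n t) (measurable_coordR n).
rewrite word_prob_ext // (resample nM'); last exact: bmfM.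
rewrite /word_prob mulrC -ExZ; last exact: summable_bmf.
apply: eq_Ex => w; rewrite mulrC -ExZ; last by apply: summable_bmf; exact: bmf_Kbar.
apply: eq_Ex => y; rewrite like_upd // ?/upd ?eqxx //.
by move=> i _; rewrite gtn_eqF // (leq_trans nh) // leq_addl.
Qed.

Lemma indep_prob_ext n (wd : {ffun 'I_n -> T}) t :
  indep_prob (ext wd t) = indep_prob wd * Kmarg n t.
Proof. exact: (prod_ext Kmarg). Qed.

Lemma word_prob_indep n (wd : {ffun 'I_n -> T}) : (n <= h)%N -> (n + h <= M)%N ->
  word_prob wd = indep_prob wd.
Proof.
elim: n wd => [|n IH] wd nh nM.
  rewrite /indep_prob big_ord0 -[RHS](Ex_cst (iid_gauss M)).
  by apply: eq_Ex => w; rewrite /likelihood big_ord0.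
have -> : wd = ext [ffun i => wd (widen_ord (leqnSn n) i)] (wd ord_max).
  apply/ffunP => i; rewrite ffunE; case: unliftP => [j ->|-> //].
  rewrite ffunE; congr (wd _); apply: val_inj; rewrite /= /bump leqNgt ltn_ord //.
rewrite word_prob_ext_indep // indep_prob_ext IH //; first exact: ltnW.
by rewrite ltnW.
Qed.

Section step.
Variables (n : nat) (g : {ffun 'I_n -> T} -> T -> R).
Hypothesis nM : (n + h < M)%N.
(** For test functions normalised in this way the term [E_Q exp g - 1] vanishes for the law of the
    new letter. *)
Hypothesis g1 : forall wd, \sum_t Kmarg n t * expR (g wd t) = 1.

Lemma step_independent : (n < h)%N ->
  \sum_(wd : {ffun 'I_n -> T}) \sum_t word_prob (ext wd t) * g wd t <= 0.
Proof.
move=> nh.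
apply: sumr_le0 => wd _; rewrite (eq_bigr (fun t => word_prob wd * (Kmarg n t * g wd t))).
  rewrite -mulr_sumr mulr_ge0_le0 ?word_prob_ge0 //.
  apply: (@le_trans _ _ (\sum_t (Kmarg n t * expR (g wd t) - Kmarg n t))).
    apply: ler_sum => t _; rewrite -[X in _ - X]mulr1 -mulrBr ler_wpM2l ?Kmarg_ge0 //.
    by have := expR_ge1Dx (g wd t); lra.
  by rewrite sumrB g1 sum_Kmarg subrr.
by move=> t _; rewrite word_prob_ext_indep // mulrA.
Qed.

Lemma Ex_sqr_diff (y : R) :
  Ex gauss (fun y' => (rho * y - rho * y') ^+ 2 / 2) = rho ^+ 2 * (y ^+ 2 + 1) / 2.
Proof.
have s1 := summable_gauss_id (R := R); have s2 := summable_gauss_sqr (R := R).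
have s3 : summable_rv gauss (fun=> y ^+ 2) by exact: summable_bmf.
have s4 := summableZ (- 2 * y) s1.
transitivity (Ex gauss (fun y' => rho ^+ 2 / 2 * (y ^+ 2 + - 2 * y * y' + y' ^+ 2))).
  by apply: eq_Ex => y'; field.
rewrite ExZ; last by apply: summableD => //; exact: summableD.
rewrite ExD ?ExD ?Ex_cst ?(ExZ (- 2 * y)) ?Ex_gauss_id ?Ex_gauss_sqr //; last exact: summableD.
by field.
Qed.

Lemma summable_sqr_diff (y : R) : summable_rv gauss (fun y' => (rho * y - rho * y') ^+ 2 / 2).
Proof.
have s1 := summable_gauss_id (R := R); have s2 := summable_gauss_sqr (R := R).
have s3 : summable_rv gauss (fun=> y ^+ 2) by exact: summable_bmf.
have := summableZ (rho ^+ 2 / 2) (summableD (summableD s3 (summableZ (- 2 * y) s1)) s2).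
by congr summable_rv; apply/funext => y'; field.
Qed.

(** [Kmarg] is a mixture of the laws [Kbar n y'], and the inequality is affine in the second law:
    the shift bound is used for each [y'] and averaged. *)
Lemma Kbar_divergence y wd :
  \sum_t Kbar n y t * g wd t <= rho ^+ 2 * (y ^+ 2 + 1) / 2.
Proof.
have c1 : summable_rv gauss (fun=> 1 : R) by exact: summable_bmf.
have sb : summable_rv gauss (fun y' => \sum_t Kbar n y' t * expR (g wd t)).
  by apply: summable_bmf; exact: bmf_Kbar_sum.
have sq := summable_sqr_diff y; have sd := summableB sb c1.
apply: (@le_trans _ _ (Ex gauss (fun y' =>
    \sum_t Kbar n y' t * expR (g wd t) - 1 + (rho * y - rho * y') ^+ 2 / 2))).
  rewrite -[leLHS](Ex_cst gauss); apply: Ex_le; [exact: summable_bmf|exact: summableD|] => y'.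
  rewrite -!Ex_Kbar_sum; exact: gauss_shift_kl.
by rewrite ExD // ExB // Ex_cst Ex_Kmarg_sum g1 subrr add0r Ex_sqr_diff.
Qed.

(** [Kbar_divergence] holds for every value of [w n], so the dependence of the past on [w n] does no
    harm: the likelihoods sum to 1 pointwise, and [(w n)^2 + 1] has expectation 2. *)
Lemma step_divergence :
  \sum_(wd : {ffun 'I_n -> T}) \sum_t word_prob (ext wd t) * g wd t <= rho ^+ 2.
Proof.
have nM' : (n < M)%N by rewrite (leq_ltn_trans _ nM) // leq_addr.
have bsk wd : bounded_measurable (fun w => \sum_t Kbar n (w n) t * g wd t).
  exact: (bmf_comp (bmf_Kbar_sum n (g wd)) (measurable_coordR n)).
have bk t := bmf_comp (bmf_Kbar n t) (measurable_coordR n).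
have bt wd t : bounded_measurable (fun w => likelihood (n := n) wd w * Kbar n (w n) t).
  by apply: bmfM; [exact: bmf_like|exact: bk].
have -> : \sum_(wd : {ffun 'I_n -> T}) \sum_t word_prob (ext wd t) * g wd t =
    Ex (iid_gauss M) (fun w => \sum_(wd : {ffun 'I_n -> T}) likelihood wd w * \sum_t Kbar n (w n) t * g wd t).
  rewrite Ex_sum; last by move=> wd; apply: summable_bmf; apply: bmfM; [exact: bmf_like|exact: bsk].
  apply: eq_bigr => wd _.
  transitivity (Ex (iid_gauss M) (fun w => \sum_t g wd t * (likelihood wd w * Kbar n (w n) t))).
    rewrite Ex_sum; last by move=> t; apply/summableZ/summable_bmf/bt.
    by apply: eq_bigr => t _; rewrite word_prob_ext // (ExZ _ (summable_bmf _ (bt wd t))) mulrC.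
  by apply: eq_Ex => w; rewrite mulr_sumr; apply: eq_bigr => t _; rewrite mulrC mulrA.
have sq : summable_rv gauss (fun y => rho ^+ 2 * (y ^+ 2 + 1) / 2).
  have c1 : summable_rv gauss (fun=> 1 : R) by exact: summable_bmf.
  have := summableZ (rho ^+ 2 / 2) (summableD (summable_gauss_sqr (R := R)) c1).
  by congr summable_rv; apply/funext => y; field.
have -> : rho ^+ 2 = Ex (iid_gauss M) (fun w => rho ^+ 2 * (w n ^+ 2 + 1) / 2).
  rewrite (Ex_coord nM' sq).
  have c1 : summable_rv gauss (fun=> 1 : R) by exact: summable_bmf.
  have s2 := summable_gauss_sqr (R := R).
  transitivity (Ex gauss (fun y => rho ^+ 2 / 2 * (y ^+ 2 + 1))).
    by rewrite ExZ ?ExD ?Ex_cst ?Ex_gauss_sqr //; [field|exact: summableD].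
  by apply: eq_Ex => y; field.
apply: Ex_le.
- by apply/summable_bmf/bmf_sum => wd; apply: bmfM; [exact: bmf_like|exact: bsk].
- exact: (summable_coord nM' sq).
- move=> w; rewrite (_ : rho ^+ 2 * _ / 2 =
      \sum_(wd : {ffun 'I_n -> T}) likelihood wd w * (rho ^+ 2 * (w n ^+ 2 + 1) / 2)).
    by apply: ler_sum => wd _; rewrite ler_wpM2l ?like_ge0 ?Kbar_divergence.
  by rewrite -mulr_suml sum_like mul1r.
Qed.

Lemma K_osc v t : `|K n v t - K n 0 t| <= (E - 1) * K n 0 t.
Proof.
have h1 := K_ratio n v 0 t; have h2 := K_ratio n 0 v t; have h3 := K_ge0 n v t.
have h4 := K_ge0 n 0 t; have := E_ge1.
by rewrite ler_norml => h5; apply/andP; split; nra.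
Qed.

Lemma K0_le_Kmarg t : K n 0 t <= E * Kmarg n t.
Proof.
have le_Kbar y : K n 0 t <= E * Kbar n y t.
  rewrite -[leLHS](Ex_cst gauss) -ExZ; last by apply: summable_bmf; exact: bmf_Kshift.
  apply: Ex_le => [||e]; first exact: summable_bmf.
    by apply/summableZ/summable_bmf; exact: bmf_Kshift.
  exact: K_ratio.
rewrite -[leLHS](Ex_cst gauss) -ExZ; last by apply: summable_bmf; exact: bmf_Kbar.
apply: Ex_le => [||e]; first exact: summable_bmf.
  by apply/summableZ/summable_bmf; exact: bmf_Kbar.
exact: le_Kbar.
Qed.

(** Two small factors meet here: privacy bounds the oscillation of [K n] by [E - 1] times its size,
    and the shift bound brings in [|rho|]. *)
Lemma Kbar_osc y t : `|Kbar n y t - Kmarg n t| <=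
  3 * ((E - 1) * (E * Kmarg n t)) * `|rho| * (`|y| + 1).
Proof.
have bkb := bmf_Kbar n t.
pose c := 3 * ((E - 1) * K n 0 t) * `|rho|.
have c0 : 0 <= c by rewrite !mulr_ge0 ?K_ge0 // subr_ge0.
have osc y' : `|Kbar n y t - Kbar n y' t| <= c * (`|y| + `|y'|).
  (* Subtracting the constant [K n 0 t] does not change differences but reduces the supremum norm to
     [(E - 1) * K n 0 t]. *)
  have e z : Kbar n z t = Ex gauss (fun e => K n (e + rho * z) t - K n 0 t) + K n 0 t.
    rewrite ExB ?Ex_cst ?subrK //; apply: summable_bmf => //; exact: bmf_Kshift.
  rewrite (e y) (e y') opprD addrACA subrr addr0.
  have mF : measurable_fun setT (fun v : RB => K n v t - K n 0 t).
    by case: (bmfB (bK n t) (bmf_cst (K n 0 t))).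
  rewrite (le_trans (gauss_shift_tv (F := fun v => K n v t - K n 0 t) _ _ mF (fun v => K_osc v t))) //.
  rewrite /c -[X in _ <= X]mulrA ler_wpM2l ?mulr_ge0 ?K_ge0 ?subr_ge0 //.
  by rewrite -mulrBr normrM ler_wpM2l // ler_normB.
have c1 : summable_rv gauss (fun=> `|y| : R) by exact: summable_bmf.
have sn : summable_rv gauss (fun y' => `|y'|) by apply: summable_norm; exact: summable_gauss_id.
have bd : bounded_measurable (fun y' => Kbar n y t - Kbar n y' t) by exact: bmfB.
have -> : Kbar n y t - Kmarg n t = Ex gauss (fun y' => Kbar n y t - Kbar n y' t).
  by rewrite ExB ?Ex_cst //; exact: summable_bmf.
rewrite (le_trans (Ex_norm (summable_bmf gauss bd))) //.
apply: (@le_trans _ _ (Ex gauss (fun y' => c * (`|y| + `|y'|)))).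
  apply: Ex_le => //; first by apply: summable_bmf; exact: bmf_norm.
  by apply: summableZ; exact: summableD.
rewrite (ExZ _ (summableD c1 sn)) ExD // Ex_cst.
apply: (@le_trans _ _ (c * (`|y| + 1))).
  by rewrite ler_wpM2l // lerD2l Ex_gauss_norm.
rewrite ler_wpM2r ?addr_ge0 // /c ler_wpM2r // ler_wpM2l // ler_wpM2l ?subr_ge0 //.
exact: K0_le_Kmarg.
Qed.

(** The 6 is the 3 of the shift bound times 2, a bound for the expectation of [|y| + 1]. One factor
    [E - 1] comes from the new letter, the other from the past. *)
Let r := 6 * (E - 1) ^+ 2 * E * `|rho|.

(** Among the past letters only [n - h] can see [w n], so the privacy ratio is paid once; for
    [n < h] no past letter sees it. *)
Lemma like_upd_ratio (wd : {ffun 'I_n -> T}) w y y' :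
  likelihood wd (upd w n y) <= E * likelihood wd (upd w n y').
Proof.
have E0 : 0 <= E by rewrite (le_trans ler01).
have same i : (i < n)%N -> (i + h)%N != n -> forall z, mov_avg (upd w n z) i = mov_avg w i.
  by move=> ni inh z; rewrite /mov_avg /upd (negbTE inh) ltn_eqF.
have [hn|nh] := leqP h n; last first.
  rewrite (_ : likelihood wd (upd w n y) = likelihood wd (upd w n y')).
    by rewrite ler_peMl ?like_ge0.
  apply: eq_bigr => i _; congr (K i _ _).
  by rewrite !same // gtn_eqF // (leq_trans nh) // leq_addl.
have kn : (n - h < n)%N by rewrite ltn_subrL h_gt0 (leq_trans h_gt0).
rewrite /likelihood (bigD1 (Ordinal kn)) //= [in leRHS](bigD1 (Ordinal kn)) //= mulrA.
rewrite (eq_bigr (fun i : 'I_n => K i (mov_avg (upd w n y') i) (wd i))); last first.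
  move=> i ik; congr (K i _ _); rewrite !same //;
    apply: contra ik => e; apply/eqP/val_inj => /=; apply/eqP; rewrite -(eqn_add2r h) subnK //.
by rewrite ler_wpM2r ?K_ratio //; apply: prodr_ge0.
Qed.

(* The likelihood of the past and the conditional law of the next letter both depend on [w n], and
   [Kbar - Kmarg] is centred, so only the product of the two oscillations contributes. *)
Lemma word_prob_ratio (wd : {ffun 'I_n -> T}) t :
  `|word_prob (ext wd t) - word_prob wd * Kmarg n t| <= r * (word_prob wd * Kmarg n t).
Proof.
have nM' : (n < M)%N by rewrite (leq_ltn_trans _ nM) // leq_addr.
have bk := bmf_comp (bmf_Kbar n t) (measurable_coordR n).
have bl := bmf_like wd; have bkb := bmf_Kbar n t.
have ble w : bounded_measurable (fun y => likelihood wd (upd w n y)) by exact: bmf_upd_pt.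
have bpsi : bounded_measurable (fun y => Kbar n y t - Kmarg n t) by exact: bmfB.
have spsi := summable_bmf gauss (bmf_norm bpsi).
pose D := 6 * ((E - 1) * (E * Kmarg n t)) * `|rho|.
have psiD : Ex gauss (fun y => `|Kbar n y t - Kmarg n t|) <= D.
  have c1 : summable_rv gauss (fun=> 1 : R) by exact: summable_bmf.
  have sn : summable_rv gauss (fun y' => `|y'|) by apply: summable_norm; exact: summable_gauss_id.
  apply: (@le_trans _ _ (Ex gauss (fun y => 3 * ((E - 1) * (E * Kmarg n t)) * `|rho| * (`|y| + 1)))).
    apply: (Ex_le spsi (summableZ _ (summableD sn c1))) => y; exact: (Kbar_osc y t).
  rewrite (ExZ _ (summableD sn c1)) ExD // Ex_cst /D.
  have := Ex_gauss_norm (R := R).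
  have : 0 <= 3 * ((E - 1) * (E * Kmarg n t)) * `|rho|.
    by rewrite !mulr_ge0 ?subr_ge0 ?Kmarg_ge0 // (le_trans ler01).
  by set a := (E - 1) * _; nra.
have psi0 : Ex gauss (fun y => Kbar n y t - Kmarg n t) = 0.
  by rewrite ExB ?Ex_cst ?subrr //; exact: summable_bmf.
have inner w : `|Ex gauss (fun y => likelihood wd (upd w n y) * (Kbar n y t - Kmarg n t))| <=
    (E - 1) * D * Ex gauss (fun y => likelihood wd (upd w n y)).
  rewrite -ExZ; last exact: summable_bmf.
  (* The bound is proved against a fixed reference value [y0], whose likelihood may be subtracted
     because [Kbar - Kmarg] is centred; averaging over [y0] then restores the mean likelihood on the
     right. *)
  rewrite -[leLHS](Ex_cst gauss); apply: Ex_le; [exact: summable_bmf|by apply: summableZ; exact: summable_bmf|] => y0.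
  have -> : Ex gauss (fun y => likelihood wd (upd w n y) * (Kbar n y t - Kmarg n t)) =
      Ex gauss (fun y => (likelihood wd (upd w n y) - likelihood wd (upd w n y0)) * (Kbar n y t - Kmarg n t)).
    rewrite -[LHS]subr0 -(mulr0 (likelihood wd (upd w n y0))) -psi0 -ExZ; last exact: summable_bmf.
    rewrite -ExB; [|by apply: summable_bmf; exact: bmfM|by apply: summableZ; exact: summable_bmf].
    by apply: eq_Ex => y; rewrite mulrBl.
  have bb : bounded_measurable (fun y => (likelihood wd (upd w n y) - likelihood wd (upd w n y0)) * (Kbar n y t - Kmarg n t)).
    by apply: bmfM => //; exact: bmfB.
  rewrite (le_trans (Ex_norm (summable_bmf gauss bb))) //.
  have l0 := like_ge0 wd (upd w n y0).
  apply: (@le_trans _ _ (Ex gauss (fun y => (E - 1) * likelihood wd (upd w n y0) * `|Kbar n y t - Kmarg n t|))).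
    apply: Ex_le; [by apply: summable_bmf; exact: bmf_norm|exact: summableZ|] => y.
    rewrite normrM ler_wpM2r // ler_norml.
    have h1 := like_upd_ratio wd w y y0; have h2 := like_upd_ratio wd w y0 y.
    by have h3 := like_ge0 wd (upd w n y); have h4 := E_ge1; apply/andP; split; nra.
  rewrite (ExZ _ spsi) mulrAC ler_wpM2r // ler_wpM2l ?subr_ge0 //.
have -> : word_prob (ext wd t) - word_prob wd * Kmarg n t =
    Ex (iid_gauss M) (fun w => likelihood wd w * (Kbar n (w n) t - Kmarg n t)).
  rewrite word_prob_ext // /word_prob [_ * Kmarg n t]mulrC -ExZ; last exact: summable_bmf.
  rewrite -ExB; [|by apply: summable_bmf; exact: bmfM|by apply: summableZ; exact: summable_bmf].
  by apply: eq_Ex => w; rewrite mulrBr [Kmarg n t * _]mulrC.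
have bt : bounded_measurable (fun w => likelihood wd w * (Kbar n (w n) t - Kmarg n t)).
  by apply: bmfM => //; exact: bmfB.
rewrite (resample nM' bt) (le_trans (Ex_norm (summable_bmf _ (bmf_resample n bt)))) //.
have rE : r * (word_prob wd * Kmarg n t) = (E - 1) * D * word_prob wd by rewrite /r /D; ring.
rewrite rE /word_prob (resample nM' bl) -ExZ; last by apply: summable_bmf; exact: bmf_resample.
apply: Ex_le.
- exact: (summable_bmf _ (bmf_norm (bmf_resample n bt))).
- exact: (summableZ _ (summable_bmf _ (bmf_resample n bl))).
- move=> w; apply: le_trans (inner w).
  by rewrite le_eqVlt; apply/orP; left; apply/eqP; congr `|_|; apply: eq_Ex => y; rewrite /upd eqxx.
Qed.

Lemma step_private :
  \sum_(wd : {ffun 'I_n -> T}) \sum_t word_prob (ext wd t) * g wd t <= r ^+ 2.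
Proof.
rewrite -[leRHS]mul1r -{1}(sum_word_prob n) mulr_suml; apply: ler_sum => wd _.
apply: (@le_trans _ _ (\sum_t (word_prob wd * Kmarg n t * expR (g wd t) -
   word_prob wd * Kmarg n t + r ^+ 2 * (word_prob wd * Kmarg n t)))).
  apply: ler_sum => t _; apply: divergence_ratio; first exact: word_prob_ge0.
    by rewrite mulr_ge0 ?word_prob_ge0 ?Kmarg_ge0.
  exact: word_prob_ratio.
rewrite big_split sumrB /= -!mulr_sumr sum_Kmarg.
under eq_bigr do rewrite -mulrA.
by rewrite -mulr_sumr g1 subrr add0r mulr1 mulrC.
Qed.

End step.

Variable eta : R.
(** Either one-letter bound will do; the size of [alpha] decides between them in the application. *)
Hypothesis eta_step : rho ^+ 2 <= eta \/ (6 * (E - 1) ^+ 2 * E * `|rho|) ^+ 2 <= eta.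

(** Chain rule, one letter at a time: [g] is the sum of its log-normaliser [gh], a function of the
    past to which the induction hypothesis applies, and of the normalised remainder [gt], to which a
    one-letter bound applies. *)
Lemma word_divergence n (g : {ffun 'I_n -> T} -> R) : (n + h <= M)%N ->
  \sum_wd word_prob wd * g wd <= \sum_wd indep_prob wd * expR (g wd) - 1 + (n - h)%:R * eta.
Proof.
elim: n g => [|n IH] g nM.
  have e (wd : {ffun 'I_0 -> T}) : word_prob wd = 1.
    by rewrite -[RHS](Ex_cst (iid_gauss M)); apply: eq_Ex => w; rewrite /likelihood big_ord0.
  have e' (wd : {ffun 'I_0 -> T}) : indep_prob wd = 1 by rewrite /indep_prob big_ord0.
  have s1 := sum_word_prob 0; rewrite sub0n mul0r addr0.
  rewrite -[X in _ - X]s1 -sumrB; apply: ler_sum => wd _; rewrite e e' !mul1r.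
  by have := expR_ge1Dx (g wd); lra.
pose Z (wd : {ffun 'I_n -> T}) := \sum_t Kmarg n t * expR (g (ext wd t)).
have Z0 wd : 0 < Z wd.
  rewrite lt_neqAle sumr_ge0 ?andbT; last by move=> t _; rewrite mulr_ge0 ?Kmarg_ge0 ?expR_ge0.
  rewrite eq_sym; apply/eqP => /psumr_eq0P e0.
  have := sum_Kmarg n; rewrite big1 => [/eqP|t _]; first by rewrite eq_sym oner_eq0.
  have := e0 (fun t _ => mulr_ge0 (Kmarg_ge0 n t) (expR_ge0 _)) t isT.
  by move/eqP; rewrite mulf_eq0 (gt_eqF (expR_gt0 _)) orbF => /eqP.
pose gh (wd : {ffun 'I_n -> T}) := ln (Z wd).
pose gt (wd : {ffun 'I_n -> T}) t := g (ext wd t) - gh wd.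
have g1 wd : \sum_t Kmarg n t * expR (gt wd t) = 1.
  rewrite /gt; under eq_bigr do rewrite expRB lnK ?posrE // mulrA.
  by rewrite -mulr_suml -/(Z wd) divff // gt_eqF.
have step : \sum_(wd : {ffun 'I_n -> T}) \sum_t word_prob (ext wd t) * gt wd t <=
    (n.+1 - h)%:R * eta - (n - h)%:R * eta.
  have nM' : (n + h < M)%N by rewrite -addSn.
  have [hn|nh] := leqP h n.
    rewrite subSn // -natr1 mulrDl mul1r addrAC subrr add0r.
    by case: eta_step; apply: le_trans; [exact: step_divergence|exact: step_private].
  (* For [n < h] both truncated differences are zero: the first [h] letters are free. *)
  rewrite (eqP (nh : (n.+1 - h)%N == 0)) (eqP (ltnW nh : (n - h)%N == 0)) subrr.
  exact: step_independent.
have IHg := IH gh (ltnW nM).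
rewrite !sum_ext.
have -> : \sum_(wd : {ffun 'I_n -> T}) \sum_t word_prob (ext wd t) * g (ext wd t) =
    \sum_(wd : {ffun 'I_n -> T}) \sum_t word_prob (ext wd t) * gt wd t +
    \sum_(wd : {ffun 'I_n -> T}) word_prob wd * gh wd.
  rewrite -big_split; apply: eq_bigr => wd _ /=.
  rewrite -sum_word_prob_ext mulr_suml -big_split; apply: eq_bigr => t _ /=.
  by rewrite /gt; ring.
have -> : \sum_(wd : {ffun 'I_n -> T}) \sum_t indep_prob (ext wd t) * expR (g (ext wd t)) =
    \sum_(wd : {ffun 'I_n -> T}) indep_prob wd * expR (gh wd).
  apply: eq_bigr => wd _; rewrite lnK ?posrE // /Z mulr_sumr; apply: eq_bigr => t _.
  by rewrite indep_prob_ext mulrA.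
lra.
Qed.

End moving_average.

(** * Stationary Gaussian processes *)

Section gaussian_process_law.
Context {R : realType}.
Local Notation RB := (measurableTypeR R).
Local Notation mu := (@lebesgue_measure R).

(** Taking [|s|] as scale treats negative parameters, and scale 0 turns the Dirac case into a
    constant, so that one formula covers all Gaussian laws. *)
Lemma gaussian_affine_law {d} {T : measurableType d} (P : probability T R) (W : T -> RB)
    (mW : measurable_fun setT W) :
  univariate_gaussian (fun A => P [set x | A (W x)]) ->
  exists m s : R, 0 <= s /\ forall A : set RB, measurable A ->
    push P mW A = push gauss (measurable_affine m s) A.
Proof.
move=> [m [s H]]; exists m, `|s|; split => // A mA.
transitivity (if s == 0 then \d_m A else normal_prob m s A).
  by rewrite -H.
have [->|s0] := eqVneq s 0.
  have -> := pushE gauss (measurable_affine m `|0|) A.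
  rewrite diracE; have [mA'|mA'] := boolP (m \in A).
    rewrite (_ : _ @^-1` _ = setT) ?probability_setT //; apply/seteqP; split => x //= _.
    by rewrite normr0 mul0r addr0; exact: set_mem.
  rewrite (_ : _ @^-1` _ = set0) ?measure0 //; apply/seteqP; split => x //=.
  by rewrite normr0 mul0r addr0 => /mem_set; rewrite (negbTE mA').
transitivity (normal_prob m `|s| A); first exact: normal_prob_norm.
by apply/esym/gauss_affine => //; rewrite normr_gt0.
Qed.

Lemma summable_same_law {d d'} {T : measurableType d} {T' : measurableType d'}
    (P : probability T R) (Q : probability T' R) (X : T -> RB) (Y : T' -> RB)
    (mX : measurable_fun setT X) (mY : measurable_fun setT Y) (f : RB -> R) :
  (forall A : set RB, measurable A -> push P mX A = push Q mY A) ->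
  measurable_fun setT f -> summable_rv Q (fun y => f (Y y)) ->
  summable_rv P (fun x => f (X x)).
Proof.
move=> e mf /integrableP[_ hf]; apply/integrableP; split.
  by apply/measurable_EFinP; exact: (measurableT_comp mf mX).
have mff : measurable_fun setT (fun x : RB => `|(f x)%:E|%E).
  by apply: measurableT_comp => //; exact/measurable_EFinP.
have <- := ge0_integral_push P mX mff (fun x => abse_ge0 _).
have e1 := ge0_integral_push Q mY mff (fun x => abse_ge0 _).
rewrite (eq_measure_integral (push Q mY)) ?e1 // => A mA _; exact: e.
Qed.

Lemma Ex_same_law {d d'} {T : measurableType d} {T' : measurableType d'}
    (P : probability T R) (Q : probability T' R) (X : T -> RB) (Y : T' -> RB)
    (mX : measurable_fun setT X) (mY : measurable_fun setT Y) (f : RB -> R) :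
  (forall A : set RB, measurable A -> push P mX A = push Q mY A) ->
  measurable_fun setT f -> summable_rv Q (fun y => f (Y y)) ->
  Ex P (fun x => f (X x)) = Ex Q (fun y => f (Y y)).
Proof.
move=> e mf sf; have sf' := summable_same_law e mf sf.
have <- := Ex_push mX mf sf'; have <- := Ex_push mY mf sf.
exact: eq_Ex_prob.
Qed.

Lemma summable_affine (m s : R) : summable_rv gauss (fun x => m + s * x).
Proof.
by apply: summableD; [exact: summable_bmf|apply: summableZ; exact: summable_gauss_id].
Qed.

Lemma summable_affine_sqr (m s : R) : summable_rv gauss (fun x => (m + s * x) ^+ 2).
Proof.
have c : summable_rv gauss (fun=> m ^+ 2 : R) by exact: summable_bmf.
have := summableD (summableD c (summableZ (2 * m * s) (summable_gauss_id (R := R))))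
  (summableZ (s ^+ 2) (summable_gauss_sqr (R := R))).
by congr summable_rv; apply/funext => x; ring.
Qed.

Lemma Ex_affine (m s : R) : Ex gauss (fun x => m + s * x) = m.
Proof.
have c : summable_rv gauss (fun=> m : R) by exact: summable_bmf.
have i := summable_gauss_id (R := R).
by rewrite (ExD c (summableZ s i)) (ExZ s i) Ex_cst Ex_gauss_id mulr0 addr0.
Qed.

Lemma Ex_affine_sqr (m s : R) : Ex gauss (fun x => (m + s * x) ^+ 2) = m ^+ 2 + s ^+ 2.
Proof.
have c : summable_rv gauss (fun=> m ^+ 2 : R) by exact: summable_bmf.
have i := summable_gauss_id (R := R); have q := summable_gauss_sqr (R := R).
transitivity (Ex gauss (fun x => m ^+ 2 + (2 * m * s) * x + s ^+ 2 * x ^+ 2)).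
  by apply: eq_Ex => x; ring.
rewrite (ExD (summableD c (summableZ _ i)) (summableZ _ q)) (ExD c (summableZ _ i)) !(ExZ _ i) (ExZ _ q).
by rewrite Ex_cst Ex_gauss_id Ex_gauss_sqr mulr0 addr0 mulr1.
Qed.

(** The representation [m + s x] under [gauss] supplies both the integrability and the values of the
    moments; once the mean is zero the cosine transform depends on the second moment only. *)
Lemma gaussian_cos {d} {T : measurableType d} (P : probability T R) (W : T -> RB)
    (mW : measurable_fun setT W) :
  univariate_gaussian (fun A => P [set x | A (W x)]) ->
  [/\ summable_rv P W, summable_rv P (fun x => W x ^+ 2) &
   Ex P W = 0 -> forall b,
   Ex P (fun x => cos (W x + b)) = expR (- (Ex P (fun x => W x ^+ 2) / 2)) * cos b].
Proof.
move=> /(gaussian_affine_law mW)[m [s [s0 H]]].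
have m2 : measurable_fun setT (fun x : RB => x ^+ 2) by exact: measurable_funX.
have sa : summable_rv gauss (fun x => m + s * x) := summable_affine m s.
have sa2 : summable_rv gauss (fun x => (m + s * x) ^+ 2) := summable_affine_sqr m s.
split.
- exact: (summable_same_law (f := fun x => x) H).
- exact: (summable_same_law (f := fun x => x ^+ 2) H).
have -> : Ex P W = m.
  by rewrite (Ex_same_law (f := fun x => x) H) // Ex_affine.
have -> : Ex P (fun x => W x ^+ 2) = m ^+ 2 + s ^+ 2.
  by rewrite (Ex_same_law (f := fun x => x ^+ 2) H) // Ex_affine_sqr.
move=> m0 b; rewrite m0 expr0n add0r.
have mc : bounded_measurable (fun x : RB => cos (x + b)) by apply: bmf_cos; exact: measurable_funD.
rewrite (Ex_same_law (f := fun x => cos (x + b)) H).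
- by rewrite -Ex_gauss_cos; apply: eq_Ex => x; rewrite m0 add0r.
- by case: mc.
- by apply: summable_bmf; apply: (bmf_comp mc); exact: measurable_affine.
Qed.

End gaussian_process_law.

Section process_law.
Context {R : realType}.
Local Notation RB := (measurableTypeR R).
Local Notation mu := (@lebesgue_measure R).
Variables (f : R -> R) (P : probability (path_space R) R).
Hypothesis fP : stationary_gaussian_law f P.

Definition autocov (k : int) : R := \int[mu]_(l in `[- pi, pi]) (f l * cos (k%:~R * l)).

Lemma measurable_path (k : int) : measurable_fun setT (fun x : path_space R => x k : RB).
Proof. exact (@measurable_coord int _ (fun _ : int => RB) k). Qed.

Lemma measurable_time_shift (s : int) : measurable_fun setT (@time_shift R s).
Proof. by apply: measurable_prod_space => i; exact: measurable_path. Qed.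

Lemma measurable_path_sum n (k : 'I_n -> int) (c : 'I_n -> R) :
  measurable_fun setT (fun x : path_space R => \sum_(i < n) c i * x (k i) : RB).
Proof.
by apply: measurable_sum => i; apply: measurable_funM => //; exact: measurable_path.
Qed.

Lemma path_sum_cos n (k : 'I_n -> int) (c : 'I_n -> R) :
  let W := fun x : path_space R => \sum_(i < n) c i * x (k i) in
  [/\ summable_rv P W, summable_rv P (fun x => W x ^+ 2) &
   Ex P W = 0 -> forall b,
   Ex P (fun x => cos (W x + b)) = expR (- (Ex P (fun x => W x ^+ 2) / 2)) * cos b].
Proof.
move=> W; have [H _ _ _ _] := fP.
exact: (gaussian_cos (measurable_path_sum k c) (H n k c)).
Qed.

Lemma summable_path k : summable_rv P (fun x => x k) /\ summable_rv P (fun x => x k ^+ 2).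
Proof.
have [s1 s2 _] := @path_sum_cos 1 (fun=> k) (fun=> 1).
split; [move: s1|move: s2]; congr summable_rv; apply/funext => x;
  by rewrite big_ord1 mul1r.
Qed.

Lemma summable_path_mul i j : summable_rv P (fun x => x i * x j).
Proof.
apply: (@summable_le _ _ _ _ _ (fun x : path_space R => x i ^+ 2 + x j ^+ 2)).
- by apply: measurable_funM; exact: measurable_path.
- by apply: summableD; [case: (summable_path i)|case: (summable_path j)].
- move=> x; rewrite normrM -[x i ^+ 2]real_normK ?num_real // -[x j ^+ 2]real_normK ?num_real //.
  by have := normr_ge0 (x i); have := normr_ge0 (x j); nra.
Qed.

Lemma Ex_path k : Ex P (fun x => x k) = 0.
Proof.
have [_ H _ _ _] := fP; have := H k.
by rewrite unlock ExE => ->.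
Qed.

Lemma Ex_path_mul0 k : Ex P (fun x => x 0 * x k) = autocov k.
Proof.
have [_ H _ H2 _] := fP; have := H2 k.
rewrite unlock !H unlock /= => e.
rewrite /autocov /Rintegral -e ExE; congr fine.
by apply: eq_integral => x _; transitivity ((x 0 - 0) * (x k - 0))%:E; [rewrite !subr0|].
Qed.

(** Covariances are prescribed from time 0 only; invariance under the shift by [i] gives the
    others. *)
Lemma Ex_path_mul i j : Ex P (fun x => x i * x j) = autocov (j - i).
Proof.
rewrite -Ex_path_mul0.
have [_ _ H _ _] := fP.
have mm : measurable_fun setT (fun x : path_space R => x 0 * x (j - i)).
  by apply: measurable_funM; exact: measurable_path.
transitivity (Ex (push P (measurable_time_shift i)) (fun x => x 0 * x (j - i))); last first.
  by apply: eq_Ex_prob => A mA; rewrite pushE; exact: H.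
rewrite Ex_push //.
  by apply: eq_Ex => x; rewrite /time_shift /= add0r subrK.
have := summable_path_mul i j; congr summable_rv; apply/funext => x.
by rewrite /time_shift /= add0r subrK.
Qed.

Lemma process_cos n (c : nat -> R) b :
  Ex P (fun x => cos (\sum_(i < n) c i * x i.+1%:Z + b)) =
  expR (- ((\sum_(i < n) \sum_(j < n) c i * c j * autocov (j%:Z - i%:Z)) / 2)) * cos b.
Proof.
have [s1 s2 H] := path_sum_cos (fun i : 'I_n => i.+1%:Z) (fun i : 'I_n => c i).
rewrite H; last first.
  rewrite Ex_sum; last by move=> i; apply: summableZ; case: (summable_path i.+1%:Z).
  rewrite big1 // => i _; rewrite ExZ ?Ex_path ?mulr0 //.
  by case: (summable_path i.+1%:Z).
congr (expR (- (_ / 2)) * _).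
transitivity (Ex P (fun x => \sum_(i < n) \sum_(j < n) c i * c j * (x i.+1%:Z * x j.+1%:Z))).
  apply: eq_Ex => x; rewrite expr2 mulr_suml; apply: eq_bigr => i _.
  by rewrite mulr_sumr; apply: eq_bigr => j _; ring.
have sij i j : summable_rv P (fun x => c i * c j * (x i.+1%:Z * x j.+1%:Z)).
  by apply: summableZ; exact: summable_path_mul.
rewrite Ex_sum; last by move=> i; apply: summable_sum.
apply: eq_bigr => i _; rewrite Ex_sum //; apply: eq_bigr => j _.
rewrite ExZ ?Ex_path_mul; last exact: summable_path_mul.
by congr (_ * autocov _); rewrite !intS; ring.
Qed.

End process_law.

(** * Spectral densities: autocovariances and their quadratic forms *)

Section spectral.
Context {R : realType}.
Local Notation mu := (@lebesgue_measure R).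
Local Notation I := [set` `[(- pi : R), pi]].

Lemma sin_int_pi (k : int) : sin (k%:~R * pi) = 0 :> R.
Proof.
have hn (n : nat) : sin (n%:R * pi) = 0 :> R.
  elim: n => [|n IH]; first by rewrite mul0r sin0.
  by rewrite -natr1 mulrDl mul1r sinD IH sinpi; ring.
by case: k => n; rewrite ?NegzE ?rmorphN /= ?mulNr ?sinN ?hn ?oppr0.
Qed.

Lemma integrable_continuous (F : R -> R) : continuous F -> mu.-integrable I (EFin \o F).
Proof.
move=> cF; apply: continuous_compact_integrable; first exact: segment_compact.
exact: continuous_subspaceT.
Qed.

Lemma continuous_cosM (k : R) : continuous (fun l : R => cos (k * l)).
Proof.
move=> x; apply: continuous_comp; last exact: continuous_cos.
by apply: cvgM; [exact: cvg_cst|exact: cvg_id].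
Qed.

Lemma integral_cos_int (k : int) :
  \int[mu]_(l in I) cos (k%:~R * l) = (if k == 0 then 2 * pi else 0) :> R.
Proof.
have pi0 := @pi_gt0 R.
have [->|k0] := eqVneq k 0.
  rewrite (@eq_Rintegral _ _ _ mu _ (fun=> 1)); last by move=> x _; rewrite mul0r cos0.
  rewrite Rintegral_cst; last exact: measurable_itv.
  have e : mu I = (2 * pi)%:E.
    rewrite /= lebesgue_measure_itv /= lte_fin gtrN // -EFinD; congr EFin; ring.
  by rewrite mul1r -[2 * pi]/(fine (2 * pi)%:E) -e.
have kR0 : k%:~R != 0 :> R by rewrite intr_eq0.
pose F (l : R) := sin (k%:~R * l) / k%:~R.
have cF : continuous F.
  move=> x; apply: cvgM; last exact: cvg_cst.
  apply: continuous_comp; last exact: continuous_sin.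
  by apply: cvgM; [exact: cvg_cst|exact: cvg_id].
have dF x : is_derive x (1 : R) F (cos (k%:~R * x)).
  apply: (@is_derive_eq _ _ _ (fun l : R => sin (k%:~R * l) / k%:~R)).
  by rewrite /GRing.scale /=; field.
rewrite /Rintegral (@continuous_FTC2 _ _ F).
- by rewrite /F mulrN sinN sin_int_pi oppr0 mul0r /= subrr.
- by rewrite gtrN.
- exact/continuous_subspaceT/continuous_cosM.
- split; first by move=> x _; exact: ex_derive.
    exact/cvg_at_right_filter/cF.
  exact/cvg_at_left_filter/cF.
- by move=> x _; rewrite derive1E; exact: derive_val.
Qed.

Lemma integral_cos_mul (h : nat) (k : int) : (0 < h)%N ->
  \int[mu]_(l in I) (cos (h%:R * l) * cos (k%:~R * l)) =
  (pi * ((k == h :> int)%:R + (k == - h%:Z :> int)%:R)) :> R.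
Proof.
move=> h0.
have c k' := integrable_continuous (@continuous_cosM k').
rewrite (@eq_Rintegral _ _ _ mu _ (fun l => 2^-1 * (cos ((k - h%:Z)%:~R * l) + cos ((k + h%:Z)%:~R * l)))); last first.
  by move=> l _; rewrite !rmorphD rmorphN /= !mulrDl !cosD mulNr cosN sinN -pmulrn; field.
rewrite RintegralZl //; last first.
  by have := @integrableD _ _ R mu I (measurable_itv _) _ _ (c (k - h%:Z)%:~R) (c (k + h%:Z)%:~R).
rewrite RintegralD // !integral_cos_int subr_eq0 addr_eq0.
by do 2 case: eqP => _ /=; field.
Qed.

Lemma measurable_cosM (k : R) : measurable_fun setT (fun l : R => cos (k * l)).
Proof. by apply: continuous_measurable_fun; exact: continuous_cosM. Qed.

Lemma integrable_mul_cos (f : R -> R) (k : R) : mu.-integrable I (EFin \o f) ->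
  mu.-integrable I (EFin \o (fun l => f l * cos (k * l))).
Proof.
move=> fi; have mf : measurable_fun I f by case/integrableP: fi => /measurable_EFinP.
apply: (le_integrable _ _ _ fi) => //.
  apply/measurable_EFinP; apply: measurable_funM => //.
  by apply: measurable_funTS; exact: measurable_cosM.
by move=> x _ /=; rewrite lee_fin normrM ler_piMr // cos_max.
Qed.

(** By orthogonality [cos (h l)] contributes at the lags [h] and [-h] only, and there [cos^2 (h l)]
    has integral [pi], which cancels the denominator. *)
Lemma autocov_diff (fp fm : R -> R) (b : R) (h : nat) (k : int) : (0 < h)%N ->
  mu.-integrable I (EFin \o fp) -> mu.-integrable I (EFin \o fm) ->
  (forall l, l \in `[- pi, pi] -> fp l - fm l = b / pi * cos (h%:R * l)) ->
  autocov fp k = autocov fm k + b * ((k == h :> int)%:R + (k == - h%:Z :> int)%:R).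
Proof.
move=> h0 ip im d; apply/eqP; rewrite addrC -subr_eq; apply/eqP.
have mI := measurable_itv `[(- pi : R), pi].
rewrite /autocov -RintegralB //; [|exact: integrable_mul_cos..].
rewrite (@eq_Rintegral _ _ _ mu _ (fun l => b / pi * (cos (h%:R * l) * cos (k%:~R * l)))); last first.
  by move=> l /set_mem /= lI; rewrite -mulrBl d // mulrA.
rewrite RintegralZl //.
  by rewrite integral_cos_mul // mulrA divfK // gt_eqF // pi_gt0.
have c : mu.-integrable I (EFin \o (fun l => cos (h%:R * l))).
  exact/integrable_continuous/continuous_cosM.
exact: integrable_mul_cos.
Qed.

(** The squared modulus of the trigonometric polynomial with coefficients [c], written in real form
    to exhibit its sign. *)
Lemma sum_cos_sqr (n : nat) (c : nat -> R) (l : R) :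
  \sum_(i < n) \sum_(j < n) c i * c j * cos ((j%:Z - i%:Z)%:~R * l) =
  (\sum_(i < n) c i * cos (i%:R * l)) ^+ 2 + (\sum_(i < n) c i * sin (i%:R * l)) ^+ 2.
Proof.
rewrite !expr2 !mulr_suml -big_split; apply: eq_bigr => i _ /=.
rewrite !mulr_sumr -big_split; apply: eq_bigr => j _ /=.
rewrite rmorphD rmorphN /= mulrDl mulNr cosD cosN sinN; ring.
Qed.

Lemma integrable_sum_real (n : nat) (F : nat -> R -> R) :
  (forall i, mu.-integrable I (EFin \o F i)) ->
  mu.-integrable I (EFin \o (fun l => \sum_(i < n) F i l)).
Proof.
move=> iF; have mI := measurable_itv `[(- pi : R), pi].
elim: n => [|n IH].
  have := iF 0%N => /(@integrableZl _ _ _ mu I mI 0); congr (mu.-integrable I _).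
  by apply/funext => l /=; rewrite big_ord0 -EFinM mul0r.
have := @integrableD _ _ R mu I mI _ _ IH (iF n); congr (mu.-integrable I _).
by apply/funext => l /=; rewrite big_ord_recr.
Qed.

Lemma Rintegral_sum_real (n : nat) (F : nat -> R -> R) :
  (forall i, mu.-integrable I (EFin \o F i)) ->
  \int[mu]_(l in I) (\sum_(i < n) F i l) = \sum_(i < n) \int[mu]_(l in I) F i l.
Proof.
move=> iF; have mI := measurable_itv `[(- pi : R), pi].
elim: n => [|n IH].
  rewrite big_ord0 (@eq_Rintegral _ _ _ mu _ (fun=> 0)); last by move=> l _; rewrite big_ord0.
  by rewrite Rintegral_cst // mul0r.
rewrite big_ord_recr /= -IH -RintegralD //; last exact: integrable_sum_real.
by apply: eq_Rintegral => l _; rewrite big_ord_recr.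
Qed.

Lemma autocov_form (n : nat) (c : nat -> R) (f : R -> R) :
  mu.-integrable I (EFin \o f) ->
  \sum_(i < n) \sum_(j < n) c i * c j * autocov f (j%:Z - i%:Z) =
  \int[mu]_(l in I) (\sum_(i < n) \sum_(j < n) c i * c j * (f l * cos ((j%:Z - i%:Z)%:~R * l))).
Proof.
move=> fi; have mI := measurable_itv `[(- pi : R), pi].
have ij i j : mu.-integrable I (EFin \o (fun l => c i * c j * (f l * cos ((j%:Z - i%:Z)%:~R * l)))).
  by have := @integrableZl _ _ R mu I mI (c i * c j) _ (integrable_mul_cos (j%:Z - i%:Z)%:~R fi).
rewrite (Rintegral_sum_real n (F := fun i l => \sum_(j < n) c i * c j * (f l * cos ((j%:Z - i%:Z)%:~R * l)))).
  apply: eq_bigr => i _.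
  rewrite (Rintegral_sum_real n (F := fun j l => c i * c j * (f l * cos ((j%:Z - i%:Z)%:~R * l)))) //.
  by apply: eq_bigr => j _; rewrite RintegralZl //; exact: integrable_mul_cos.
by move=> i; exact: (integrable_sum_real n (F := fun j l => c i * c j * (f l * cos ((j%:Z - i%:Z)%:~R * l)))).
Qed.

(** The form is the integral of [f] against a squared modulus, hence monotone in [f]; the constant
    density [kappa] is white noise of variance [2 pi kappa]. *)
Lemma autocov_lower (n : nat) (c : nat -> R) (f : R -> R) (kappa : R) :
  mu.-integrable I (EFin \o f) -> (forall l, l \in `[- pi, pi] -> kappa <= f l) ->
  2 * pi * kappa * \sum_(i < n) c i ^+ 2 <=
  \sum_(i < n) \sum_(j < n) c i * c j * autocov f (j%:Z - i%:Z).
Proof.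
move=> fi kf; have mI := measurable_itv `[(- pi : R), pi].
have ik : mu.-integrable I (EFin \o (fun=> kappa)).
  by apply: integrable_continuous => x; exact: cvg_cst.
have -> : 2 * pi * kappa * \sum_(i < n) c i ^+ 2 =
    \sum_(i < n) \sum_(j < n) c i * c j * autocov (fun=> kappa) (j%:Z - i%:Z).
  rewrite mulr_sumr; apply: eq_bigr => i _; rewrite (bigD1 i) //= big1 => [|j ji].
    rewrite addr0 /autocov RintegralZl //; last exact/integrable_continuous/continuous_cosM.
    by rewrite integral_cos_int subrr eqxx; ring.
  rewrite /autocov RintegralZl //; last exact/integrable_continuous/continuous_cosM.
  by rewrite integral_cos_int subr_eq0 eqz_nat (inj_eq val_inj) (negbTE ji) !mulr0.
rewrite !autocov_form //.
have ii g : mu.-integrable I (EFin \o g) -> mu.-integrable I (EFin \o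
    (fun l => \sum_(i < n) \sum_(j < n) c i * c j * (g l * cos ((j%:Z - i%:Z)%:~R * l)))).
  move=> ig; apply: (integrable_sum_real n (F := fun i l => \sum_(j < n) c i * c j * (g l * cos ((j%:Z - i%:Z)%:~R * l)))) => i.
  apply: (integrable_sum_real n (F := fun j l => c i * c j * (g l * cos ((j%:Z - i%:Z)%:~R * l)))) => j.
  by have := @integrableZl _ _ R mu I mI (c i * c j) _ (integrable_mul_cos (j%:Z - i%:Z)%:~R ig).
apply: le_Rintegral => //; [exact: ii|exact: ii|] => l lI.
have e (r : R) : \sum_(i < n) \sum_(j < n) c i * c j * (r * cos ((j%:Z - i%:Z)%:~R * l)) =
    r * ((\sum_(i < n) c i * cos (i%:R * l)) ^+ 2 + (\sum_(i < n) c i * sin (i%:R * l)) ^+ 2).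
  rewrite -sum_cos_sqr mulr_sumr; apply: eq_bigr => i _; rewrite mulr_sumr.
  by apply: eq_bigr => j _; ring.
by rewrite !e ler_wpM2r ?kf // addr_ge0 ?sqr_ge0.
Qed.

End spectral.

(* Completing the square in the last variable; the Schur complement inherits the lower bound. *)
Lemma quadratic_form_squares {R : realType} (n : nat) (S : nat -> nat -> R) (kappa : R) :
  0 < kappa -> (forall i j, S i j = S j i) ->
  (forall c : nat -> R, kappa * \sum_(i < n) c i ^+ 2 <= \sum_(i < n) \sum_(j < n) c i * c j * S i j) ->
  exists L : nat -> nat -> R, forall c : nat -> R,
    \sum_(i < n) \sum_(j < n) c i * c j * S i j = \sum_(j < n) (\sum_(i < n) c i * L i j) ^+ 2.
Proof.
move=> k0; elim: n S => [|n IH] S symS posS.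
  by exists (fun _ _ => 0) => c; rewrite !big_ord0.
pose s := S n n.
have exp_form (c : nat -> R) (A : nat -> nat -> R) : \sum_(i < n.+1) \sum_(j < n.+1) c i * c j * A i j =
    \sum_(i < n) \sum_(j < n) c i * c j * A i j +
    \sum_(i < n) c i * c n * A i n + \sum_(i < n) c n * c i * A n i + c n * c n * A n n.
  rewrite big_ord_recr /= (eq_bigr (fun i : 'I_n => \sum_(j < n) c i * c j * A i j + c i * c n * A i n)).
    by rewrite big_split /= big_ord_recr /= addrA.
  by move=> i _; rewrite big_ord_recr.
have s0 : 0 < s.
  (* The vector supported at [n] yields [kappa <= s]. *)
  pose c0 (i : nat) : R := (i == n)%:R.
  have := posS c0; rewrite (exp_form c0 S) big_ord_recr /= /c0 eqxx.
  rewrite big1 => [|i _]; last by rewrite ltn_eqF // expr0n.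
  rewrite big1 => [|i _]; last by rewrite big1 // => j _; rewrite ltn_eqF // !mul0r.
  rewrite big1 => [|i _]; last by rewrite ltn_eqF // !mul0r.
  rewrite big1 => [|i _]; last by rewrite (ltn_eqF (ltn_ord i)) mulr0 mul0r.
  by rewrite !add0r expr1n !mul1r mulr1 => /(lt_le_trans k0).
pose S' i j := S i j - S i n * S j n / s.
pose b (c : nat -> R) := \sum_(i < n) c i * S i n.
have complete (c : nat -> R) : \sum_(i < n.+1) \sum_(j < n.+1) c i * c j * S i j =
    \sum_(i < n) \sum_(j < n) c i * c j * S' i j + s * (c n + b c / s) ^+ 2.
  rewrite exp_form -/s.
  have -> : \sum_(i < n) c i * c n * S i n = c n * b c.
    by rewrite mulr_sumr; apply: eq_bigr => i _; ring.
  have -> : \sum_(i < n) c n * c i * S n i = c n * b c.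
    by rewrite mulr_sumr; apply: eq_bigr => i _; rewrite symS; ring.
  have -> : \sum_(i < n) \sum_(j < n) c i * c j * S' i j =
      \sum_(i < n) \sum_(j < n) c i * c j * S i j - b c ^+ 2 / s.
    rewrite expr2 {1}/b mulr_suml mulr_suml -sumrB; apply: eq_bigr => i _.
    rewrite /b mulr_sumr mulr_suml -sumrB; apply: eq_bigr => j _; rewrite /S'; ring.
  by field; rewrite gt_eqF.
have [L' HL'] : exists L : nat -> nat -> R, forall c : nat -> R,
    \sum_(i < n) \sum_(j < n) c i * c j * S' i j = \sum_(j < n) (\sum_(i < n) c i * L i j) ^+ 2.
  apply: IH => [i j|c]; first by rewrite /S' symS mulrAC [S j n * _]mulrC mulrAC.
  (* This last entry makes the completed square vanish, and its own contribution to the sum of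
     squares is nonnegative, so the lower bound survives. *)
  pose c' i := if i == n then - (b c / s) else c i.
  have := posS c'; rewrite (complete c') big_ord_recr /=.
  have bc' : b c' = b c by apply: eq_bigr => i _; rewrite /c' ltn_eqF.
  have -> : \sum_(i < n) \sum_(j < n) c' i * c' j * S' i j = \sum_(i < n) \sum_(j < n) c i * c j * S' i j.
    by apply: eq_bigr => i _; apply: eq_bigr => j _; rewrite /c' !ltn_eqF.
  have -> : \sum_(i < n) c' i ^+ 2 = \sum_(i < n) c i ^+ 2.
    by apply: eq_bigr => i _; rewrite /c' ltn_eqF.
  rewrite bc' {2}/c' eqxx addNr expr0n mulr0 addr0; apply: le_trans.
  by rewrite mulrDr lerDl mulr_ge0 ?sqr_ge0 // ltW.
(* The last column of a triangular factor: its square is [s * (c n + b c / s) ^+ 2]. *)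
exists (fun i j => if j == n then (if i == n then Num.sqrt s else S i n / Num.sqrt s)
                   else if i == n then 0 else L' i j) => c.
have q0 : Num.sqrt s != 0 by rewrite gt_eqF // sqrtr_gt0.
have q2 : Num.sqrt s ^+ 2 = s by rewrite sqr_sqrtr // ltW.
rewrite complete HL' [in RHS]big_ord_recr /=; congr (_ + _).
  apply: eq_bigr => j _; rewrite big_ord_recr /= eqxx ltn_eqF // mulr0 addr0; congr (_ ^+ 2).
  by apply: eq_bigr => i _; rewrite ltn_eqF.
rewrite big_ord_recr /= !eqxx (eq_bigr (fun i : 'I_n => c i * S i n / Num.sqrt s)); last first.
  by move=> i _; rewrite ltn_eqF // mulrA.
have -> : \sum_(i < n) c i * S i n / Num.sqrt s = b c / Num.sqrt s by rewrite mulr_suml.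
by move: (Num.sqrt s) q0 q2 => q q0 <-; field.
Qed.

(** * Moving-average model of the process *)

Section shifted_sums.
Context {R : realType}.
Implicit Types (G : nat -> R) (c : nat -> R).

Lemma sum_shift_right (N h : nat) G :
  \sum_(j < N + h) (if (h <= j)%N then G j else 0) = \sum_(i < N) G (i + h)%N.
Proof.
rewrite addnC big_split_ord /= big1 ?add0r => [|i _]; last by rewrite leqNgt ltn_ord.
by apply: eq_bigr => i _; rewrite leq_addr addnC.
Qed.

Lemma sum_restrict (N h : nat) G :
  \sum_(j < N + h) (if (j < N)%N then G j else 0) = \sum_(i < N) G i.
Proof.
rewrite big_split_ord /= [X in _ + X]big1 ?addr0 => [|i _]; last by rewrite ltnNge leq_addr.
by apply: eq_bigr => i _; rewrite ltn_ord.
Qed.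

(* Coefficient of [w j] in [sum_i c i * (w (i + h) + rho * w i)]. *)
Definition ma_coef (N h : nat) (rho : R) c (j : nat) : R :=
  (if (h <= j)%N then c (j - h)%N else 0) + rho * (if (j < N)%N then c j else 0).

Lemma sum_ma (N h : nat) (rho : R) c (w : nat -> R) :
  \sum_(i < N) c i * (w (i + h)%N + rho * w i) = \sum_(j < N + h) ma_coef N h rho c j * w j.
Proof.
rewrite (eq_bigr (fun i : 'I_N => c ((i + h) - h)%N * w (i + h)%N + c i * (rho * w i))); last first.
  by move=> i _; rewrite addnK mulrDr.
rewrite big_split -(sum_shift_right N h (fun j => c (j - h)%N * w j)) /=.
rewrite -(sum_restrict N h (fun j => c j * (rho * w j))) -big_split; apply: eq_bigr => j _.
rewrite /ma_coef /=; case: ifP => _; case: ifP => _; ring.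
Qed.

Definition lag_form (N h : nat) c : R := \sum_(i < N) c i * (if (i + h < N)%N then c (i + h)%N else 0).

Lemma sum_ma_coef_sqr (N h : nat) (rho : R) c :
  \sum_(j < N + h) ma_coef N h rho c j ^+ 2 =
  (1 + rho ^+ 2) * \sum_(i < N) c i ^+ 2 + 2 * rho * lag_form N h c.
Proof.
pose r j := if (j < N)%N then c j else 0.
rewrite (eq_bigr (fun j : 'I_(N + h) => (if (h <= j)%N then c (j - h)%N ^+ 2 + 2 * rho * (c (j - h)%N * r j) else 0)
   + (if (j < N)%N then (rho * c j) ^+ 2 else 0))); last first.
  by move=> j _; rewrite /ma_coef /r; case: ifP => _; case: ifP => _; ring.
rewrite big_split /= (sum_restrict N h (fun j => (rho * c j) ^+ 2)).
rewrite (sum_shift_right N h (fun j => c (j - h)%N ^+ 2 + 2 * rho * (c (j - h)%N * r j))).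
transitivity (\sum_(i < N) c i ^+ 2 + 2 * rho * lag_form N h c + rho ^+ 2 * \sum_(i < N) c i ^+ 2);
  last by ring.
congr (_ + _); last by rewrite mulr_sumr; apply: eq_bigr => i _; rewrite exprMn.
by rewrite /lag_form mulr_sumr -big_split; apply: eq_bigr => i _; rewrite addnK.
Qed.

Lemma lag_form0 (N h : nat) c : (N <= h)%N -> lag_form N h c = 0.
Proof.
by move=> Nh; rewrite /lag_form big1 // => i _; rewrite ltnNge (leq_trans Nh) ?leq_addl // mulr0.
Qed.

(** The lag [-h] part is the lag [h] part with [i] and [j] exchanged, hence the factor 2. *)
Lemma toeplitz_lag (N h : nat) c (b : R) :
  \sum_(i < N) \sum_(j < N) c i * c j * (b * (((j%:Z - i%:Z) == h :> int)%:R + ((j%:Z - i%:Z) == - h%:Z :> int)%:R)) =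
  2 * b * lag_form N h c.
Proof.
have one (i : 'I_N) : \sum_(j < N) c i * c j * (b * ((j%:Z - i%:Z) == h :> int)%:R) =
    b * (c i * (if (i + h < N)%N then c (i + h)%N else 0)).
  have e (j : nat) : (j%:Z - i%:Z == h :> int) = (j == i + h)%N.
    by rewrite subr_eq -PoszD eqz_nat addnC.
  case: ifP => ih.
    rewrite (bigD1 (Ordinal ih)) //= big1 => [|j jn]; last first.
      rewrite e (_ : _ == _ = false) ?mulr0 //.
      by apply/negbTE; move: jn; apply: contraNN => /eqP ji; apply/eqP/val_inj.
    by rewrite e eqxx mulr1 addr0; ring.
  rewrite big1 ?mulr0 // => j _; rewrite e (_ : _ == _ = false) ?mulr0 //.
  by apply/negbTE; apply: contraFN ih => /eqP <-.
have half : \sum_(i < N) \sum_(j < N) c i * c j * (b * ((j%:Z - i%:Z) == h :> int)%:R) = b * lag_form N h c.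
  by rewrite /lag_form mulr_sumr; apply: eq_bigr => i _; exact: one.
transitivity (b * lag_form N h c + b * lag_form N h c); last by ring.
rewrite -{1}half -half [X in _ + X]exchange_big /= -big_split; apply: eq_bigr => i _ /=.
rewrite -big_split; apply: eq_bigr => j _ /=.
have -> : (j%:Z - i%:Z == - h%:Z :> int) = (i%:Z - j%:Z == h :> int).
  by rewrite -eqr_opp opprK opprB.
ring.
Qed.

End shifted_sums.

Section model.
Context {R : realType}.
Local Notation RB := (measurableTypeR R).
Local Notation Om := (prod_space (fun _ : nat => RB)).
Variables (N h : nat) (s rho : R) (L : nat -> nat -> R).

Definition lin (z : Om) (i : nat) : RB := \sum_(j < N) L i j * z j.

Lemma measurable_lin i : measurable_fun setT (lin ^~ i).
Proof.
by apply: measurable_sum => j; apply: measurable_funM => //; exact: measurable_coordR.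
Qed.

(** [p.1] drives the Gaussian part common to both laws, [p.2] is the white noise of the moving
    average. *)
Definition model (p : Om * Om) (i : nat) : RB := lin p.1 i + s * mov_avg h rho p.2 i.

Lemma measurable_model i : measurable_fun setT (model ^~ i).
Proof.
apply: measurable_funD; first exact: (measurableT_comp (measurable_lin i) measurable_fst).
by apply: measurable_funM => //; exact: (measurableT_comp (measurable_ma h rho i) measurable_snd).
Qed.

Lemma model_cos (c : nat -> R) b :
  Ex (prodP (iid_gauss N) (iid_gauss (N + h))) (fun p => cos (\sum_(i < N) c i * model p i + b)) =
  expR (- ((\sum_(j < N) (\sum_(i < N) c i * L i j) ^+ 2 +
            s ^+ 2 * \sum_(j < N + h) ma_coef N h rho c j ^+ 2) / 2)) * cos b.
Proof.
have mm : measurable_fun setT (fun p => \sum_(i < N) c i * model p i + b).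
  apply: measurable_funD => //; apply: measurable_sum => i.
  by apply: measurable_funM => //; exact: measurable_model.
rewrite Ex_prod_l; last exact: bmf_cos.
pose d j := \sum_(i < N) c i * L i j.
pose v := s ^+ 2 * \sum_(j < N + h) ma_coef N h rho c j ^+ 2.
transitivity (Ex (iid_gauss N) (fun z => expR (- (v / 2)) * cos (\sum_(j < N) d j * z j + b))).
  apply: eq_Ex => z.
  transitivity (Ex (iid_gauss (N + h)) (fun w => cos (\sum_(j < N + h) (s * ma_coef N h rho c j) * w j +
      (\sum_(j < N) d j * z j + b)))).
    apply: eq_Ex => w; congr cos; rewrite addrA; congr (_ + _).
    rewrite (eq_bigr (fun i : 'I_N => s * (c i * (w (i + h)%N + rho * w i)) + c i * lin z i)).
      rewrite big_split /= -mulr_sumr sum_ma mulr_sumr; congr (_ + _).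
        by apply: eq_bigr => j _; rewrite mulrA.
      rewrite (eq_bigr (fun i : 'I_N => \sum_(j < N) c i * L i j * z j)).
        by rewrite exchange_big; apply: eq_bigr => j _; rewrite mulr_suml.
      by move=> i _; rewrite /lin mulr_sumr; apply: eq_bigr => j _; rewrite mulrA.
    by move=> i _; rewrite /model /mov_avg /=; ring.
  rewrite (Ex_iid_gauss_cos_sum (fun j => s * ma_coef N h rho c j)) //; congr (expR (- (_ / 2)) * _).
  by rewrite /v mulr_sumr; apply: eq_bigr => j _; rewrite exprMn.
rewrite ExZ; last first.
  apply/summable_bmf/bmf_cos/measurable_funD => //; apply: measurable_sum => j.
  by apply: measurable_funM => //; exact: measurable_coordR.
rewrite (Ex_iid_gauss_cos_sum d) // mulrA -expRD; congr (expR _ * _).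
by rewrite -/v -opprD -mulrDl addrC.
Qed.

Variables (f : R -> R) (P : probability (path_space R) R).
Hypothesis fP : stationary_gaussian_law f P.
Hypothesis f_form : forall c : nat -> R,
  \sum_(i < N) \sum_(j < N) c i * c j * autocov f (j%:Z - i%:Z) =
  \sum_(j < N) (\sum_(i < N) c i * L i j) ^+ 2 +
  s ^+ 2 * ((1 + rho ^+ 2) * \sum_(i < N) c i ^+ 2 + 2 * rho * lag_form N h c).

(** Process and model have cosine transforms given by the same quadratic form, by [f_form];
    [fourier_unique_joint] then carries the equality to products. *)
Lemma Ex_model (F : nat -> RB -> R) : (forall i, bounded_measurable (F i)) ->
  Ex P (fun x => \prod_(i < N) F i (x i.+1%:Z)) =
  Ex (iid_gauss N) (fun z => Ex (iid_gauss (N + h)) (fun w => \prod_(i < N) F i (lin z i + s * mov_avg h rho w i))).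
Proof.
move=> bF; have bp : bounded_measurable (fun p => \prod_(i < N) F i (model p i)).
  by apply: bmf_prod => i; exact: (bmf_comp (bF i) (measurable_model i)).
rewrite -(Ex_prod_l (iid_gauss N) (iid_gauss (N + h)) bp).
have m1 (i : nat) : measurable_fun setT (fun x : path_space R => x i.+1%:Z : RB).
  exact: measurable_path.
have same_cos (c : nat -> R) b : Ex P (fun x => cos (\sum_(i < N) c i * x i.+1%:Z + b)) =
    Ex (prodP (iid_gauss N) (iid_gauss (N + h))) (fun p => cos (\sum_(i < N) c i * model p i + b)).
  by rewrite (process_cos fP) model_cos f_form sum_ma_coef_sqr.
exact: (fourier_unique_joint m1 measurable_model same_cos bF).
Qed.

End model.

(** * Comparison of the two laws for a fixed quantisation *)

Section quantization.
Context {R : realType}.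
Local Notation RB := (measurableTypeR R).
Variables (N h : nat) (a delta : R) (fp fm : R -> R) (Pp Pm : probability (path_space R) R).
Hypotheses (N_gt0 : (0 < N)%N) (h_gt0 : (0 < h)%N) (a_gt0 : 0 < a) (delta_le1 : -1 <= delta <= 1).
Hypotheses (sfp : spectral_density fp) (sfm : spectral_density fm).
Hypothesis fm_ge : forall l, l \in `[- pi, pi] -> 3 * a / (4 * pi) <= fm l.
Hypothesis f_diff : forall l, l \in `[- pi, pi] ->
  fp l - fm l = a * delta / (2 * pi) * cos (h%:R * l).
Hypotheses (lawp : stationary_gaussian_law fp Pp) (lawm : stationary_gaussian_law fm Pm).
Let s := Num.sqrt a.
Let rho := delta / 2.

Lemma autocov_form_diff (c : nat -> R) :
  \sum_(i < N) \sum_(j < N) c i * c j * autocov fp (j%:Z - i%:Z) =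
  \sum_(i < N) \sum_(j < N) c i * c j * autocov fm (j%:Z - i%:Z) + a * (2 * rho * lag_form N h c).
Proof.
have [_ _ ip] := sfp; have [_ _ im] := sfm.
have -> : a * (2 * rho * lag_form N h c) = 2 * (a * rho) * lag_form N h c by ring.
rewrite -toeplitz_lag -big_split; apply: eq_bigr => i _.
rewrite -big_split; apply: eq_bigr => j _ /=.
rewrite (autocov_diff (j%:Z - i%:Z) h_gt0 (b := a * rho) ip im) ?mulrDr // => l lI.
rewrite f_diff //; congr (_ * _); rewrite /rho.
by have /lt0r_neq0 := @pi_gt0 R; move: (pi : R) => p p0; field.
Qed.

Lemma residual_squares : exists L : nat -> nat -> R, forall c : nat -> R,
  \sum_(i < N) \sum_(j < N) c i * c j * autocov fm (j%:Z - i%:Z) =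
  \sum_(j < N) (\sum_(i < N) c i * L i j) ^+ 2 + a * ((1 + rho ^+ 2) * \sum_(i < N) c i ^+ 2).
Proof.
have [_ _ im] := sfm.
pose S (i j : nat) := autocov fm (j%:Z - i%:Z) - a * (1 + rho ^+ 2) * (i == j)%:R.
have S_form (c : nat -> R) : \sum_(i < N) \sum_(j < N) c i * c j * S i j =
    \sum_(i < N) \sum_(j < N) c i * c j * autocov fm (j%:Z - i%:Z) -
    a * ((1 + rho ^+ 2) * \sum_(i < N) c i ^+ 2).
  rewrite mulrA mulr_sumr -sumrB; apply: eq_bigr => i _.
  rewrite [in RHS](bigD1 i) // [in LHS](bigD1 i) //= /S eqxx mulr1 mulrBr addrAC.
  congr (_ + _ - _); last by ring.
  apply: eq_bigr => j ji; rewrite (_ : (_ == _) = false) ?mulr0 ?subr0 //.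
  by apply/negbTE; apply: contra ji => /eqP ij; apply/eqP/val_inj.
(* The margin: [2 pi * (3 a / (4 pi)) = 3 a / 2], while [a (1 + rho^2) <= 5 a / 4]. *)
have q0 : 0 < a / 4 by rewrite divr_gt0.
have symS i j : S i j = S j i.
  rewrite /S eq_sym; congr (_ - _); apply: eq_Rintegral => l _.
  by rewrite -[i%:Z - j%:Z]opprB rmorphN mulNr cosN.
have [c|L HL] := quadratic_form_squares (n := N) q0 symS.
  rewrite S_form; have := autocov_lower N c im fm_ge.
  have -> : 2 * pi * (3 * a / (4 * pi)) = 3 / 2 * a by have /lt0r_neq0 := @pi_gt0 R; move: (pi : R) => p p0; field.
  have c0 : 0 <= \sum_(i < N) c i ^+ 2 by apply: sumr_ge0 => i _; exact: sqr_ge0.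
  have r0 : rho ^+ 2 <= 1 / 4 by case/andP: delta_le1 => d1 d2; rewrite /rho; nra.
  move: (\sum_(i < N) c i ^+ 2) c0 => W c0; move: (\sum_(i < N) _) => V H.
  have : a * W * (rho ^+ 2) <= a * W * (1 / 4) by rewrite ler_wpM2l // mulr_ge0 // ltW.
  by nra.
by exists L => c; rewrite -HL S_form subrK.
Qed.

Variables (T : finType) (k : nat -> RB -> T -> R) (E eta : R).
Hypothesis bk : forall i t, bounded_measurable (fun v => k i v t).
Hypothesis k_ge0 : forall i v t, 0 <= k i v t.
Hypothesis sumk : forall i v, \sum_t k i v t = 1.
Hypothesis E_ge1 : 1 <= E.
Hypothesis k_ratio : forall i v v' t, k i v t <= E * k i v' t.
Hypothesis eta_step : rho ^+ 2 <= eta \/ (6 * (E - 1) ^+ 2 * E * `|rho|) ^+ 2 <= eta.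

Definition quantized_prob (P : probability (path_space R) R) (wd : {ffun 'I_N -> T}) : R :=
  Ex P (fun x => \prod_(i < N) k i (x i.+1%:Z) (wd i)).

Lemma quantized_divergence (g : {ffun 'I_N -> T} -> R) :
  \sum_wd quantized_prob Pp wd * g wd <=
  \sum_wd quantized_prob Pm wd * expR (g wd) - 1 + (N - h)%:R * eta.
Proof.
have [L HL] := residual_squares.
have s2 : s ^+ 2 = a by rewrite sqr_sqrtr // ltW.
pose K z i v t := k i (lin N L z i + s * v) t.
have bw (wd : {ffun 'I_N -> T}) h' : bounded_measurable
    (fun z => word_prob h' (N + h') rho (K z) wd).
  have bp : bounded_measurable (fun p => \prod_(i < N) k i (model N h' s rho L p i) (wd i)).
    by apply: bmf_prod => i; exact: (bmf_comp (bk i (wd i)) (measurable_model N h' s rho L i)).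
  exact: (bmf_Ex_l (iid_gauss N) (iid_gauss (N + h')) bp).
(* Both laws share [L] and [rho] and differ only in the lag: [h' = h] for [fp], and [h' = N] for
   [fm]. A lag of [N] is never reached by [N] observations, so [lag_form] vanishes and the word has
   independent letters. *)
have law_model f P h' (wd : {ffun 'I_N -> T}) : stationary_gaussian_law f P ->
    (forall c : nat -> R, \sum_(i < N) \sum_(j < N) c i * c j * autocov f (j%:Z - i%:Z) =
      \sum_(j < N) (\sum_(i < N) c i * L i j) ^+ 2 +
      s ^+ 2 * ((1 + rho ^+ 2) * \sum_(i < N) c i ^+ 2 + 2 * rho * lag_form N h' c)) ->
    quantized_prob P wd = Ex (iid_gauss N) (fun z => word_prob h' (N + h') rho (K z) wd).
  move=> fP form.
  have e (X : nat -> RB) : \prod_(i < N) k i (X i) (wd i) =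
      \prod_(i < N) k i (X i) (wd (insubd (Ordinal N_gt0) (i : nat))).
    by apply: eq_bigr => i _; rewrite valKd.
  have /= H := Ex_model fP form (fun i => bk i (wd (insubd (Ordinal N_gt0) i))).
  rewrite /quantized_prob (eq_Ex P (fun x => e (fun i => x i.+1%:Z))) H.
  by apply: eq_Ex => z; apply: eq_Ex => w; rewrite -(e (fun i => lin N L z i + s * mov_avg h' rho w i)).
have plus wd : quantized_prob Pp wd = Ex (iid_gauss N) (fun z => word_prob h (N + h) rho (K z) wd).
  by apply: (law_model _ _ _ _ lawp) => c; rewrite autocov_form_diff HL s2 mulrDr addrA.
have minus wd : quantized_prob Pm wd = Ex (iid_gauss N) (fun z => word_prob N (N + N) rho (K z) wd).
  by apply: (law_model _ _ _ _ lawm) => c; rewrite HL s2 lag_form0 // mulr0 addr0.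
have iw wd h' := summable_bmf (iid_gauss N) (bw wd h').
have -> : \sum_wd quantized_prob Pp wd * g wd =
    Ex (iid_gauss N) (fun z => \sum_wd g wd * word_prob h (N + h) rho (K z) wd).
  rewrite Ex_sum; last by move=> wd; apply: summableZ; exact: iw.
  by apply: eq_bigr => wd _; rewrite ExZ ?plus 1?mulrC //; exact: iw.
have -> : \sum_wd quantized_prob Pm wd * expR (g wd) - 1 + (N - h)%:R * eta =
    Ex (iid_gauss N) (fun z => \sum_wd expR (g wd) * word_prob N (N + N) rho (K z) wd +
      (- 1 + (N - h)%:R * eta)).
  rewrite ExD; [|by apply: summable_sum => wd; apply: summableZ; exact: iw|exact: summable_bmf].
  rewrite Ex_cst addrA Ex_sum; last by move=> wd; apply: summableZ; exact: iw.
  congr (_ - _ + _).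
  by apply: eq_bigr => wd _; rewrite ExZ ?minus 1?mulrC //; exact: iw.
apply: Ex_le.
- by apply: summable_sum => wd; apply: summableZ; exact: iw.
- by apply: summableD; [apply: summable_sum => wd; apply: summableZ; exact: iw|exact: summable_bmf].
move=> z; rewrite addrA.
have bK i t : bounded_measurable (fun v => K z i v t).
  by apply: (bmf_comp (bk i t)); exact: measurable_affine.
have := word_divergence (rho := rho) (K := K z) (E := E) (eta := eta) (h := h) (M := (N + h)%N) (n := N)
  h_gt0 bK (fun i v t => k_ge0 i _ t) (fun i v => sumk i _) E_ge1
  (fun i v v' t => k_ratio i _ _ t) eta_step g (leqnn _).
have ind (wd : {ffun 'I_N -> T}) : word_prob N (N + N) rho (K z) wd = indep_prob rho (K z) wd.
  by apply: word_prob_indep.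
rewrite (eq_bigr (fun wd => g wd * word_prob h (N + h) rho (K z) wd)); last by move=> wd _; rewrite mulrC.
by rewrite [X in _ <= X - _ + _](eq_bigr (fun wd => expR (g wd) * word_prob N (N + N) rho (K z) wd)) //
  => wd _; rewrite mulrC ind.
Qed.

End quantization.

(** * From quantised outputs to the divergence *)

Section cylindric_approximation.
Context {R : realType} {I : finType} {d : I -> measure_display}.
Variable T_ : forall i, measurableType (d i).
Local Notation Om := (prod_space T_).

Definition quantizer (T : finType) (q : forall i, T_ i -> T) : Prop :=
  forall i t, measurable (q i @^-1` [set t]).

Definition word (T : finType) (q : forall i, T_ i -> T) (z : Om) : {ffun I -> T} :=
  [ffun i => q i (z i)].

(** One finite alphabet serves all coordinates, as the estimates on words require. *)
Definition cylindric (F : Om -> R) : Prop :=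
  exists (T : finType) (q : forall i, T_ i -> T) (g : {ffun I -> T} -> R),
    quantizer q /\ F = fun z => g (word q z).

Lemma word_sum (T : finType) (q : forall i, T_ i -> T) (g : {ffun I -> T} -> R) z :
  g (word q z) = \sum_wd g wd * \prod_i \1_(q i @^-1` [set wd i]) (z i).
Proof.
rewrite (bigD1 (word q z)) //= big1 ?mulr1 ?addr0 => [|i _]; last first.
  by rewrite indicE mem_set // ffunE.
rewrite big1 ?addr0 // => wd; rewrite eq_sym => wdz.
have /existsP[i /eqP qi] : [exists i, word q z i != wd i].
  by apply: contraR wdz; rewrite negb_exists => /forallP e; apply/eqP/ffunP => i; exact/eqP/negPn/e.
rewrite (bigD1 i) //= indicE memNset ?mul0r ?mulr0 // => /= e; apply: qi.
by rewrite ffunE.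
Qed.

Lemma bmf_cylindric F : cylindric F -> bounded_measurable F.
Proof.
move=> [T [q [g [mq ->]]]].
rewrite (_ : (fun z => _) = fun z => \sum_wd g wd * \prod_i \1_(q i @^-1` [set wd i]) (z i)).
  apply: bmf_sum => wd; apply: bmfZ; apply: bmf_prod => i.
  by apply: (bmf_comp (bmf_indic (mq i (wd i)))); exact: measurable_coord.
by apply/funext => z; exact: word_sum.
Qed.

Lemma cylindric_cst r : cylindric (fun=> r).
Proof.
exists unit, (fun _ _ => tt), (fun=> r); split=> // i t.
rewrite (_ : _ @^-1` _ = setT) //; apply/seteqP; split => //= x _; by case: t.
Qed.

(** Two quantisations are merged by the product alphabet. *)
Lemma cylindric_comp2 (op : R -> R -> R) F G : cylindric F -> cylindric G ->
  cylindric (fun z => op (F z) (G z)).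
Proof.
move=> [T [q [g [mq ->]]]] [T' [q' [g' [mq' ->]]]].
exists (T * T')%type, (fun i x => (q i x, q' i x)),
  (fun wd => op (g [ffun i => (wd i).1]) (g' [ffun i => (wd i).2])); split.
  move=> i [t t']; rewrite (_ : _ @^-1` _ = (q i @^-1` [set t]) `&` (q' i @^-1` [set t'])).
    exact: measurableI.
  by apply/seteqP; split => x /= [-> ->].
apply/funext => z; congr (op (g _) (g' _)); apply/ffunP => i; rewrite !ffunE //.
Qed.

Lemma cylindric_cylinder i (B : set (T_ i)) : measurable B ->
  cylindric (\1_((fun w : Om => w i) @^-1` B)).
Proof.
(* [B] at coordinate [i] and the full space elsewhere, so that every coordinate has a Boolean
   quantiser. *)
move=> mB; pose B' : forall j, set (T_ j) := @dfwith I (fun j => set (T_ j)) (fun j => setT) i B.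
have mB' j : measurable (B' j) by rewrite /B'; case: dfwithP.
exists bool, (fun j x => `[< B' j x >]), (fun wd : {ffun I -> bool} => (wd i : nat)%:R); split.
  move=> j t; rewrite (_ : _ @^-1` _ = if t then B' j else ~` B' j).
    by case: t => //; exact: measurableC.
  apply/seteqP; split => x /=.
    by move=> <-; case: asboolP.
  by case: t => // ?; apply/asboolP.
apply/funext => z; rewrite ffunE indicE; congr (nat_of_bool _)%:R.
rewrite /B' dfwithin; apply/idP/asboolP; first by rewrite inE.
by move=> ?; rewrite inE.
Qed.

Variables P Q : probability Om R.

(** The variational inequality involves both measures, so one approximant has to be close for both
    at once. *)
Definition l1_dist (F G : Om -> R) : R :=
  Ex P (fun z => `|F z - G z|) + Ex Q (fun z => `|F z - G z|).

Definition approximable (F : Om -> R) : Prop :=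
  bounded_measurable F /\
  forall e : R, 0 < e -> exists2 G, cylindric G & l1_dist F G <= e.

Lemma l1_dist_le F1 G1 F2 G2 F G (a b : R) :
  bounded_measurable F1 -> bounded_measurable G1 -> bounded_measurable F2 -> bounded_measurable G2 ->
  bounded_measurable F -> bounded_measurable G ->
  (forall z, `|F z - G z| <= a * `|F1 z - G1 z| + b * `|F2 z - G2 z|) ->
  l1_dist F G <= a * l1_dist F1 G1 + b * l1_dist F2 G2.
Proof.
move=> bF1 bG1 bF2 bG2 bF bG FG.
have d1 P' := summable_bmf P' (bmf_norm (bmfB bF1 bG1)).
have d2 P' := summable_bmf P' (bmf_norm (bmfB bF2 bG2)).
have d0 P' := summable_bmf P' (bmf_norm (bmfB bF bG)).
have le (P' : probability Om R) : Ex P' (fun z => `|F z - G z|) <=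
    a * Ex P' (fun z => `|F1 z - G1 z|) + b * Ex P' (fun z => `|F2 z - G2 z|).
  rewrite -(ExZ a (d1 P')) -(ExZ b (d2 P')) -(ExD (summableZ a (d1 P')) (summableZ b (d2 P'))).
  by apply: Ex_le => //; apply: summableD; exact: summableZ.
have := le P; have := le Q; rewrite /l1_dist; lra.
Qed.

Lemma approximable_lim (F : Om -> R) (B : R) (Fn : nat -> Om -> R) : measurable_fun setT F ->
  (forall n, approximable (Fn n)) -> (forall n z, `|Fn n z| <= B) ->
  (forall z, Fn n z @[n --> \oo] --> F z) -> approximable F.
Proof.
move=> mF aFn FnB FnF.
have FB z : `|F z| <= B.
  have c : `|Fn n z| @[n --> \oo] --> `|F z| by apply: cvg_norm; exact: FnF.
  have -> : `|F z| = limn (fun n => `|Fn n z|) by apply/esym/cvg_lim.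
  by apply: limr_le; [apply/cvg_ex; exists `|F z| | near=> n; exact: FnB].
have bF : bounded_measurable F by split=> //; exists B.
split=> // e e0.
have lim0 (P' : probability Om R) : Ex P' (fun z => `|F z - Fn n z|) @[n --> \oo] --> 0.
  rewrite -[X in _ --> X](Ex_cst P').
  apply: (@Ex_dct _ _ _ _ _ _ (B + B)) => //.
  - move=> n; apply: measurableT_comp => //; apply: measurable_funB => //.
    by case: (aFn n) => -[].
  - by move=> n z; rewrite normr_id (le_trans (ler_normB _ _)) // lerD.
  - move=> z; rewrite -[X in _ --> X](normr0 R) -(subrr (F z)); apply: cvg_norm.
    by apply: cvgB; [exact: cvg_cst|exact: FnF].
have /cvgrPdist_le/(_ (e / 2)) : l1_dist F (Fn n) @[n --> \oo] --> 0.
  by rewrite -[X in _ --> X](addr0 0); apply: cvgD.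
rewrite divr_gt0 // => /(_ isT)[n _ /(_ n (leqnn n))].
rewrite /= sub0r normrN => Fn_e.
have [bFn /(_ (e / 2))] := aFn n; rewrite divr_gt0 // => /(_ isT)[G cG GFn].
exists G => //; have bG := bmf_cylindric cG.
have tri z : `|F z - G z| <= 1 * `|F z - Fn n z| + 1 * `|Fn n z - G z|.
  by rewrite !mul1r; exact: ler_distD.
have := l1_dist_le bF bFn bFn bG bF bG tri.
have := ler_norm (l1_dist F (Fn n)); lra.
Unshelve. all: by end_near.
Qed.

(** A Lipschitz operation preserves [L^1] approximation; it is applied to [1 - x], to the maximum
    and to linear combinations. *)
Lemma approximable_comp2 (op : R -> R -> R) (C : R) F G : 0 < C ->
  approximable F -> approximable G -> bounded_measurable (fun z => op (F z) (G z)) ->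
  (forall x y x' y', `|op x y - op x' y'| <= C * `|x - x'| + C * `|y - y'|) ->
  approximable (fun z => op (F z) (G z)).
Proof.
move=> C0 [bF aF] [bG aG] bop lip; split=> // e e0.
have e0' : 0 < e / (2 * C) by rewrite divr_gt0 // mulr_gt0.
have [F' cF' FF'] := aF _ e0'; have [G' cG' GG'] := aG _ e0'.
have cop := cylindric_comp2 op cF' cG'.
exists (fun z => op (F' z) (G' z)) => //.
have bF' := bmf_cylindric cF'; have bG' := bmf_cylindric cG'.
have := l1_dist_le bF bF' bG bG' bop (bmf_cylindric cop) (fun z => lip _ _ _ _).
move=> /le_trans; apply.
have -> : e = C * (e / (2 * C)) + C * (e / (2 * C)) by field; rewrite gt_eqF.
by apply: lerD; rewrite ler_pM2l.
Qed.

Lemma approximable_cylindric F : cylindric F -> approximable F.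
Proof.
move=> cF; split=> [|e e0]; first exact: bmf_cylindric.
exists F => //; rewrite /l1_dist.
have z0 (P' : probability Om R) : Ex P' (fun z => `|F z - F z|) = 0.
  by rewrite -[RHS](Ex_cst P'); apply: eq_Ex => z; rewrite subrr normr0.
by rewrite !z0 addr0 ltW.
Qed.

Lemma approximable_sum n (r : R) (F : nat -> Om -> R) : (forall i, approximable (F i)) ->
  approximable (fun z => \sum_(i < n) r * F i z).
Proof.
move=> aF; elim: n => [|n IH].
  rewrite (_ : (fun z => _) = fun=> 0); first exact/approximable_cylindric/cylindric_cst.
  by apply/funext => z; rewrite big_ord0.
rewrite (_ : (fun z => _) = fun z => (\sum_(i < n) r * F i z) + r * F n z); last first.
  by apply/funext => z; rewrite big_ord_recr.
have [bF _] := aF n; have [bS _] := IH.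
apply: (@approximable_comp2 (fun x y => x + r * y) (1 + `|r|) _ _ _ IH (aF n)).
- by rewrite ltr_wpDr.
- by apply: bmfD => //; exact: bmfZ.
- move=> x y x' y'; rewrite opprD addrACA -mulrBr.
  rewrite (le_trans (ler_normD _ _)) // normrM; have := normr_ge0 r.
  by have := normr_ge0 (x - x'); have := normr_ge0 (y - y'); nra.
Qed.

Definition approximable_set (A : set Om) : Prop := measurable A /\ approximable \1_A.

Lemma approximable_setC A : approximable_set A -> approximable_set (~` A).
Proof.
move=> [mA aA]; split; first exact: measurableC.
have e : \1_(~` A) = (fun z => 1 - \1_A z) :> (Om -> R).
  by apply/funext => z; rewrite !indicE in_setC; case: (_ \in _); rewrite ?subrr ?subr0.
rewrite e; apply: (@approximable_comp2 (fun x _ => 1 - x) 1 _ _ _ aA aA) => //.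
  by rewrite -e; apply: bmf_indic; exact: measurableC.
move=> x y x' y'; have -> : 1 - x - (1 - x') = - (x - x') by ring.
by rewrite normrN !mul1r lerDl.
Qed.

Lemma approximable_setU A B : approximable_set A -> approximable_set B ->
  approximable_set (A `|` B).
Proof.
move=> [mA aA] [mB aB]; split; first exact: measurableU.
have e : \1_(A `|` B) = (fun z => Num.max (\1_A z) (\1_B z)) :> (Om -> R).
  apply/funext => z; rewrite !indicE in_setU; case: (_ \in _); case: (_ \in _) => /=;
  by rewrite ?maxxx // ?(max_l ler01) ?(max_r ler01).
rewrite e; apply: (@approximable_comp2 Num.max 1 _ _ _ aA aB) => //.
  by rewrite -e; apply: bmf_indic; exact: measurableU.
move=> x y x' y'; rewrite !mul1r.
have := normr_ge0 (x - x'); have := normr_ge0 (y - y').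
have := ler_norm (x - x'); have := ler_norm (y - y').
have := ler_norm (- (x - x')); have := ler_norm (- (y - y')); rewrite !normrN ler_norml.
by have [?|?] := leP x y; have [?|?] := leP x' y'; move=> *; apply/andP; split; lra.
Qed.

Lemma approximable_bigcup (A : nat -> set Om) : (forall n, approximable_set (A n)) ->
  approximable_set (\bigcup_n A n).
Proof.
move=> aA; split; first by apply: bigcup_measurable => n _; case: (aA n).
have aU n : approximable_set (\big[setU/set0]_(i < n) A i).
  elim: n => [|n IH]; last by rewrite big_ord_recr; exact: approximable_setU.
  rewrite big_ord0; split=> //; rewrite indic0.
  exact/approximable_cylindric/cylindric_cst.
apply: (@approximable_lim _ 1 (fun n => \1_(\big[setU/set0]_(i < n) A i))).
- by apply: measurable_indic; apply: bigcup_measurable => n _; case: (aA n).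
- by move=> n; case: (aU n).
- by move=> n z; rewrite indicE; case: (_ \in _); rewrite ?normr1 ?normr0.
move=> z; rewrite [X in _ --> X]indicE; have [/set_mem[n _ An]|nA] := boolP (z \in \bigcup_n A n).
  apply: (@cvg_near_cst); exists n.+1 => // m /= nm.
  rewrite indicE mem_set // -bigcup_mkord; exists n => //.
apply: (@cvg_near_cst); exists 0%N => // m _ /=.
rewrite indicE memNset // -bigcup_mkord => -[n _ An].
by move/negP: nA; apply; rewrite inE; exists n.
Qed.

(** Approximable sets form a sigma-algebra that contains the cylinders. *)
Lemma measurable_approximable (A : set Om) : measurable A -> approximable_set A.
Proof.
apply: smallest_sub; first split.
- rewrite /approximable_set indic0; split=> //.
  exact/approximable_cylindric/cylindric_cst.
- by move=> B; rewrite setTD; exact: approximable_setC.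
- exact: approximable_bigcup.
move=> _ [i _ [B mB <-]]; rewrite setTI; split; last exact/approximable_cylindric/cylindric_cylinder.
by have := @measurable_coord I d T_ i measurableT B mB; rewrite setTI.
Qed.

Lemma bmf_approximable F : bounded_measurable F -> approximable F.
Proof.
move=> bF; have [mF [B0 FB0]] := bF; pose B := `|B0| + 1.
have B_gt0 : 0 < B by rewrite ltr_wpDl.
have FB z : `|F z| <= B by rewrite (le_trans (FB0 z)) // /B; have := ler_norm B0; lra.
pose f z := F z + B; pose C := 2 * B.
have mf : measurable_fun setT f by exact: measurable_funD.
have f0 z : 0 <= f z by have := FB z; rewrite ler_norml /f => /andP[]; lra.
have fC z : f z <= C by have := FB z; rewrite ler_norml /f /C => /andP[]; lra.
have C0 : 0 < C by rewrite mulr_gt0.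
pose Fn n z := \sum_(j < n.+1) C / n.+1%:R * \1_(layer f C n j) z.
have lc n z : `|Fn n z - f z| <= C / n.+1%:R by exact: layer_cake.
have af : approximable f.
  apply: (@approximable_lim f (C + C) Fn) => //.
  - move=> n; apply: (@approximable_sum n.+1 (C / n.+1%:R) (fun j => \1_(layer f C n j))) => j.
    by have [] := measurable_approximable (measurable_layer C mf n j).
  - move=> n z; rewrite -[Fn n z](subrK (f z)) (le_trans (ler_normD _ _)) // lerD //.
      rewrite (le_trans (lc n z)) // ler_pdivrMr ?ltr0n // ler_peMr ?ler1n //; exact: ltW.
    by rewrite ger0_norm.
  move=> z; apply/cvgrPdist_le => e e0.
  have : C / n.+1%:R @[n --> \oo] --> (0 : R).
    by rewrite -[X in _ --> X](mulr0 C); apply: cvgM; [exact: cvg_cst|exact: cvg_harmonic].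
  move=> /cvgrPdist_le/(_ _ e0); apply: filterS => n; rewrite sub0r normrN => h.
  by rewrite distrC (le_trans (lc n z)) // (le_trans (ler_norm _)).
have -> : F = (fun z => f z - B) by apply/funext => z; rewrite /f addrK.
apply: (@approximable_comp2 (fun x _ => x - B) 1 _ _ _ af af) => //.
  by apply: bmfB => //; case: af.
move=> x y x' y'; have -> : x - B - (x' - B) = x - x' by ring.
by rewrite !mul1r lerDl.
Qed.

End cylindric_approximation.

Lemma expR_lipschitz {R : realType} (B x y : R) : x <= B -> y <= B ->
  `|expR x - expR y| <= expR B * `|x - y|.
Proof.
wlog xy : x y / y <= x.
  move=> H xB yB; have [yx|xy] := leP y x; first exact: H.
  by rewrite distrC [`|x - y|]distrC; apply: H => //; exact: ltW.
move=> xB yB; rewrite !ger0_norm ?subr_ge0 ?ler_expR //.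
have -> : expR y = expR x * expR (y - x) by rewrite -expRD addrC subrK.
apply: (@le_trans _ _ (expR x * (x - y))).
  have := expR_gt0 x; have := expR_ge1Dx (y - x); nra.
by rewrite ler_wpM2r ?subr_ge0 // ler_expR.
Qed.

Definition clamp {R : realType} (M x : R) : R := Num.max (- M) (Num.min M x).

Lemma clamp_le {R : realType} (M x : R) : 0 <= M -> clamp M x <= M.
Proof.
by move=> M0; rewrite /clamp ge_max ge_min lexx /= andbT; lra.
Qed.

Lemma clamp_dist {R : realType} (M x y : R) : - M <= x -> x <= M ->
  `|x - clamp M y| <= `|x - y|.
Proof.
rewrite /clamp => Mx xM.
have := ler_norm (x - y); have := ler_norm (- (x - y)); rewrite normrN ler_norml.
by have [?|?] := leP M y; [have [?|?] := leP (- M) M|have [?|?] := leP (- M) y];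
  move=> *; apply/andP; split; lra.
Qed.

(** * The variational inequality and the divergence *)

Section variational_lift.
Context {R : realType} {I : finType} {d : I -> measure_display}.
Variables (T_ : forall i, measurableType (d i)) (P Q : probability (prod_space T_) R) (B : R).

(** The approximant is clamped to [[-M, M]]: it stays cylindric, does not move away from [G], and
    the exponential is Lipschitz there with constant [expR M]. The total error is then at most
    [1 + expR M] times the [L^1] distance. *)
Lemma variational_lift :
  (forall F : prod_space T_ -> R, cylindric F -> Ex P F <= Ex Q (fun z => expR (F z)) - 1 + B) ->
  forall G : prod_space T_ -> R, bounded_measurable G ->
  Ex P G <= Ex Q (fun z => expR (G z)) - 1 + B.
Proof.
move=> dv G bG; have [mG [M GM]] := bG; apply/ler_addgt0Pr => e e0.
have [_ /(_ (e / (1 + expR M)))] := bmf_approximable P Q bG.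
have M0 := expR_gt0 M.
rewrite divr_gt0 ?addr_gt0 // => /(_ isT)[F0 cF0].
pose F z := clamp M (F0 z).
have cF : cylindric F := cylindric_comp2 (fun x _ => clamp M x) cF0 cF0.
have bF0 := bmf_cylindric cF0; have bF := bmf_cylindric cF.
have GlM z : G z <= M by rewrite (le_trans (ler_norm _)).
have GgM z : - M <= G z by have := GM z; rewrite ler_norml => /andP[].
have FM z : F z <= M by apply: clamp_le; exact: le_trans (normr_ge0 (G z)) (GM z).
have clamp_le z : `|G z - F z| <= `|G z - F0 z| by exact: clamp_dist.
have dGF P' := summable_bmf P' (bmf_norm (bmfB bG bF)).
have d0 P' := summable_bmf P' (bmf_norm (bmfB bG bF0)).
have bEG := bmf_expR bG; have bEF := bmf_expR bF.
have l1 P' : Ex P' (fun z => `|G z - F z|) <= Ex P' (fun z => `|G z - F0 z|) by exact: Ex_le.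
have hP : Ex P G <= Ex P F + Ex P (fun z => `|G z - F z|).
  rewrite -(ExD (summable_bmf P bF) (dGF P)); apply: Ex_le; [exact: summable_bmf|exact: summableD (summable_bmf P bF) (dGF P)|].
  by move=> z; have := ler_norm (G z - F z); lra.
have hQ : Ex Q (fun z => expR (F z)) <= Ex Q (fun z => expR (G z)) + expR M * Ex Q (fun z => `|G z - F z|).
  rewrite -(ExZ _ (dGF Q)) -(ExD (summable_bmf Q bEG) (summableZ _ (dGF Q))).
  apply: Ex_le; [exact: summable_bmf|exact: summableD (summable_bmf Q bEG) (summableZ _ (dGF Q))|].
  move=> z; have := expR_lipschitz (FM z) (GlM z); rewrite distrC [`|F z - _|]distrC.
  have := ler_norm (expR (F z) - expR (G z)); rewrite distrC; lra.
rewrite /l1_dist ler_pdivlMr ?addr_gt0 // => He.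
have p0 : 0 <= Ex P (fun z => `|G z - F0 z|) by apply: Ex_ge0 => z.
have q0 : 0 <= Ex Q (fun z => `|G z - F0 z|) by apply: Ex_ge0 => z.
have lP := l1 P; have lQ := l1 Q.
move: He hP hQ lP lQ p0 q0 (dv F cF).
move: (Ex P G) (Ex Q (fun z => expR (G z))) (Ex P F) (Ex Q (fun z => expR (F z)))
  (Ex P (fun z => `|G z - F z|)) (Ex Q (fun z => `|G z - F z|))
  (Ex P (fun z => `|G z - F0 z|)) (Ex Q (fun z => `|G z - F0 z|)) (expR M) M0.
clear; move=> g g' f f' a b a0 b0 m m0; nra.
Qed.

End variational_lift.

Section kl_bound.
Context {R : realType} {d} {T : measurableType d}.
Variables (P Q : probability T R) (B : R).
Hypothesis dv : forall G : T -> R, bounded_measurable G ->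
  Ex P G <= Ex Q (fun z => expR (G z)) - 1 + B.

(** Testing with [l * 1_A] on a [Q]-null set [A] gives [l * P A <= B] for every real [l], which
    forces [P A = 0]. *)
Lemma variational_dominates : P `<< Q.
Proof.
apply/null_content_dominatesP => A mA QA0.
have bA : bounded_measurable (\1_A : T -> R) := bmf_indic mA.
have le l : l * Ex P \1_A <= B.
  have := dv (bmfZ l bA); rewrite ExZ; last exact: summable_bmf.
  have -> : Ex Q (fun z => expR (l * \1_A z)) = 1; last by rewrite subrr add0r.
  transitivity (Ex Q (fun z => 1 + (expR l - 1) * \1_A z)).
    apply: eq_Ex => z; rewrite indicE; case: (_ \in _); rewrite ?mulr1 ?mulr0 ?expR0 ?addr0 //.
    by rewrite addrC subrK.
  rewrite ExD ?Ex_cst; [|exact: summable_bmf|by apply/summable_bmf/bmfZ].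
  by rewrite ExZ ?Ex_indic ?QA0 /= ?mulr0 ?addr0 //; exact: summable_bmf.
have p0 : 0 <= Ex P \1_A by apply: Ex_ge0 => z; rewrite indicE.
have PA0 : Ex P \1_A = 0.
  apply/eqP; rewrite eq_le p0 andbT leNgt; apply/negP => p_gt0.
  by have := le ((B + 1) / Ex P \1_A); rewrite divfK ?gt_eqF //; lra.
rewrite -[LHS]fineK; last exact: fin_num_measure.
by rewrite -Ex_indic // PA0.
Qed.

Let L : T -> \bar R := Radon_Nikodym (charge_of_finite_measure P) Q.
Let l (x : T) : R := fine (L x).

Let PQ : charge_of_finite_measure P `<< Q := variational_dominates.

Let L_l x : L x = (l x)%:E.
Proof. by rewrite fineK //; exact: (Radon_Nikodym_fin_num x PQ). Qed.

Let L_int : Q.-integrable setT L.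
Proof. exact: (Radon_Nikodym_integrable PQ). Qed.

Let l_summable : summable_rv Q l.
Proof.
have := L_int; congr (Q.-integrable _ _); apply/funext => x; exact: L_l.
Qed.

Let ml : measurable_fun setT l.
Proof. exact: summable_measurable l_summable. Qed.

Let l_max : summable_rv Q (fun x => Num.max (l x) 0).
Proof.
apply: (summable_le _ (summable_norm l_summable)); first exact: measurable_maxr.
by move=> x; case: (leP (l x) 0) => h; rewrite ?normr0.
Qed.

(** As the derivative of a charge, [l] is a version whose sign is controlled only almost everywhere,
    hence the positive part; its integral is the mass [P] gives to the set where [l >= 0]. *)
Let l_mass : Ex Q (fun x => Num.max (l x) 0) <= 1.
Proof.
have mA : measurable [set x | 0 <= l x].
  have := ml measurableT (measurable_itv `[0, +oo[); rewrite setTI.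
  by congr (measurable _); apply/seteqP; split => x; rewrite /= in_itv /= andbT.
have : (\int[Q]_x (Num.max (l x) 0)%:E <= 1)%E.
  rewrite (eq_integral (L \_ [set x | 0 <= l x])); last first.
    move=> x _; rewrite patchE; have [/set_mem /= h|h] := boolP (x \in _).
      by rewrite max_l.
    rewrite max_r // leNgt; apply: contra h => h; apply: mem_set; exact: ltW.
  rewrite -integral_mkcond -(Radon_Nikodym_integral PQ mA).
  exact: probability_le1.
by rewrite (EFin_Ex l_max) lee_fin.
Qed.

(** The optimal test function is [ln l]; truncating [l] to [[a, b]] makes it bounded. *)
Let G (a b : R) (x : T) : R := ln (Num.max a (Num.min b (l x))).

Let mG a b : measurable_fun setT (G a b).
Proof.
apply: (measurableT_comp (@measurable_ln R)).
by apply: measurable_maxr => //; exact: measurable_minr.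
Qed.

Let bG a b : 0 < a -> bounded_measurable (G a b).
Proof.
move=> a0; split; first exact: mG.
exists (`|ln a| + `|ln (Num.max a b)|) => x; rewrite /G.
have h1 : ln a <= ln (Num.max a (Num.min b (l x))).
  by rewrite ler_ln ?posrE ?lt_max ?a0 // le_max lexx.
have h2 : ln (Num.max a (Num.min b (l x))) <= ln (Num.max a b).
  rewrite ler_ln ?posrE ?lt_max ?a0 // ge_max !le_max lexx /=.
  by rewrite !ge_min lexx !orbT.
have := ler_norm (ln (Num.max a b)); have := ler_norm (- ln a).
have := normr_ge0 (ln a); have := normr_ge0 (ln (Num.max a b)).
by rewrite normrN ler_norml => *; apply/andP; split; lra.
Qed.

(** [exp G] is at most [a] plus the positive part of [l], so its [Q]-expectation exceeds 1 by at
    most [a]. *)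
Let G_le a b : 0 < a -> Ex P (G a b) <= a + B.
Proof.
move=> a0; apply: le_trans (dv (bG b a0)) _.
have bE := bmf_expR (bG b a0).
suff : Ex Q (fun x => expR (G a b x)) <= a + 1 by lra.
apply: (@le_trans _ _ (Ex Q (fun x => a + Num.max (l x) 0))).
  apply: Ex_le; [exact: summable_bmf|by apply: summableD => //; exact: summable_bmf|move=> x].
  rewrite /G lnK ?posrE ?lt_max ?a0 // ge_max; apply/andP; split.
    by rewrite lerDl le_max lexx orbT.
  by rewrite ge_min; apply/orP; right; case: (leP (l x) 0) => h; lra.
by rewrite ExD ?Ex_cst ?lerD2l //; exact: summable_bmf.
Qed.

Let f (x : T) : \bar R := lne (L x).

Let fE x : f x = if 0 < l x then (ln (l x))%:E else -oo%E.
Proof.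
rewrite /f L_l; case: ltP => h; first by rewrite lne_EFin.
by rewrite le0_lneNy // lee_fin.
Qed.

Let mf : measurable_fun setT f.
Proof.
rewrite (_ : f = fun x => if 0 < l x then (ln (l x))%:E else -oo%E); last exact/funext/fE.
apply: measurable_fun_ifT => //; first exact: measurable_fun_ltr.
apply/measurable_EFinP; exact: (measurableT_comp (@measurable_ln R)).
Qed.

Let funepos_f x : (f^\+ x)%E = (ln (Num.max 1 (l x)))%:E.
Proof.
rewrite funeposE fE; case: ltP => h; last by rewrite max_r ?leNye // max_l ?ln1 // (le_trans h).
rewrite -EFin_max; congr EFin; have [l1|l1] := leP 1 (l x).
  by rewrite max_l // ln_ge0.
by rewrite ln1 max_r // ln_le0 // ltW.
Qed.

(** The difference is 0 where [l >= 1] and [- ln (max a l)] elsewhere: the negative part of [ln l],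
    cut off at [- ln a]. *)
Let funeneg_f a b x : 0 < a <= 1 -> 1 <= b -> ((G 1 b x - G a b x)%:E <= f^\- x)%E.
Proof.
move=> /andP[a0 a1] b1; rewrite funenegE fE; case: ltP => h; last by rewrite /= max_l ?leey.
rewrite -EFinN -EFin_max lee_fin /G.
have [l1|l1] := leP 1 (l x).
  have m1 : 1 <= Num.min b (l x) by rewrite le_min b1.
  by rewrite (max_r m1) (max_r (le_trans a1 m1)) subrr le_max lexx orbT.
rewrite (min_r (ltW (lt_le_trans l1 b1))) (max_l (ltW l1)) ln1 sub0r le_max lerN2.
by rewrite ler_ln ?posrE ?lt_max ?a0 // le_max lexx orbT.
Qed.

Lemma kl_le : (kl P Q <= B%:E)%E.
Proof.
rewrite /kl; case: pselect => [PQ'|]; last by have := variational_dominates.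
rewrite -/L -/f integralE.
have c0 : (0 <= \int[P]_x f^\- x)%E by apply: integral_ge0 => x _; exact: funeneg_ge0.
(* With an infinite negative part the integral is [-oo] by the convention for differences, and the
   bound is immediate. *)
have [cy|cy] := eqVneq (\int[P]_x f^\- x)%E +oo%E; first by rewrite cy addeNy leNye.
have cfin : (\int[P]_x f^\- x)%E \is a fin_num by rewrite ge0_fin_numE // ltey.
rewrite leeBlDr // -(fineK cfin) -EFinD; set r := fine _.
pose hn (n : nat) x := (G 1 (expR n%:R) x)%:E.
have e1 n : 1 <= expR n%:R :> R by rewrite (le_trans _ (expR_ge1Dx _)) ?lerDl ?ler0n.
have hn_le n : (\int[P]_x hn n x <= (B + r)%:E)%E.
  rewrite EFin_Ex; last exact/summable_bmf/bG.
  rewrite lee_fin; apply/ler_addgt0Pr => e e0.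
  (* The positive part of [ln l] truncated at [n] is [G 1 (expR n)]: the function [G a (expR n)]
     costs [a + B], the difference costs at most [r], and [a] is arbitrarily small. *)
  pose a := Num.min e 1.
  have a01 : 0 < a <= 1 by rewrite /a lt_min e0 ltr01 ge_min lexx orbT.
  have /andP[a0 a1] := a01.
  have ae : a <= e by rewrite /a ge_min lexx.
  have s1 := summable_bmf P (bG (expR n%:R) ltr01); have sa := summable_bmf P (bG (expR n%:R) a0).
  have : Ex P (fun x => G 1 (expR n%:R) x - G a (expR n%:R) x) <= r.
    rewrite -lee_fin -EFin_Ex; last exact: summableB.
    rewrite /r fineK //; apply: ge0_le_integral => //.
    - move=> x _; rewrite lee_fin subr_ge0 ler_ln ?posrE ?lt_max ?a0 ?ltr01 //.
      by rewrite ge_max !le_max a1 lexx orbT.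
    - by apply/measurable_EFinP; apply: measurable_funB; exact: mG.
    - exact: measurable_funeneg.
    - by move=> x _; exact: funeneg_f.
  rewrite ExB //; have := G_le (expR n%:R) a0; lra.
have lim_hn x : limn (hn ^~ x) = (f^\+ x)%E.
  apply/cvg_lim => //; rewrite funepos_f; apply: cvg_near_cst.
  near=> n; rewrite /hn /G min_r //.
  have le : l x <= n%:R by near: n; exact: nbhs_infty_ger.
  by rewrite (le_trans le) // (le_trans _ (expR_ge1Dx _)) // lerDr.
have -> : (\int[P]_x f^\+ x = \int[P]_x limn (hn ^~ x))%E.
  by apply: eq_integral => x _; rewrite lim_hn.
have mono := @cvg_monotone_convergence _ _ _ P setT measurableT hn.
have mh n : measurable_fun setT (hn n) by apply/measurable_EFinP; exact: mG.
have h0 n x : (0 <= hn n x)%E by rewrite lee_fin ln_ge0 // le_max lexx.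
have nd x : {homo hn ^~ x : n m / (n <= m)%N >-> (n <= m)%E}.
  move=> n m nm; rewrite lee_fin ler_ln ?posrE ?lt_max ?ltr01 // ge_max !le_max lexx /=.
  by rewrite le_min !ge_min lexx !orbT andbT ler_expR ler_nat nm orbT.
have {}mono := mono mh (fun n x _ => h0 n x) (fun x _ => nd x).
rewrite -(cvg_lim _ mono) //; apply: lime_le; first by apply/cvg_ex; eexists; exact: mono.
by near=> n; exact: hn_le.
Unshelve. all: by end_near.
Qed.

End kl_bound.

(** * Privatised observations *)

Section privatized_words.
Context {R : realType}.
Local Notation RB := (measurableTypeR R).
Variables (alpha : R) (N : nat) (K : 'I_N -> channel alpha).
Hypothesis N_gt0 : (0 < N)%N.
Variables (T : finType) (q : forall i, output (K i) -> T).
Hypothesis mq : forall i t, measurable (q (i := i) @^-1` [set t]).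

(** Indices beyond [N] fall back to channel 0, which gives a family indexed by [nat] as in the
    moving-average model. *)
Let chan (i : nat) : 'I_N := insubd (Ordinal N_gt0) i.
Let cell (i : nat) (t : T) := q (i := chan i) @^-1` [set t].

Let mcell i t : measurable (cell (i := i) t).
Proof. exact: mq. Qed.

Definition cell_prob (i : nat) (v : RB) (t : T) : R := fine (K (chan i) v (cell (i := i) t)).

Let cell_probE i v t : K (chan i) v (cell (i := i) t) = (cell_prob i v t)%:E.
Proof. by rewrite fineK //; exact: (finite_kernel_measure (K (chan i)) v (mcell i t)). Qed.

Lemma cell_prob_ge0 i v t : 0 <= cell_prob i v t.
Proof. by rewrite /cell_prob fine_ge0. Qed.

Lemma bmf_cell_prob i t : bounded_measurable (fun v => cell_prob i v t).
Proof.
split.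
  apply: (measurableT_comp (fine_measurable measurableT)).
  exact: (measurable_kernel (K (chan i)) _ (mcell i t)).
exists 1 => v; rewrite ger0_norm ?cell_prob_ge0 // -lee_fin -cell_probE.
rewrite -[leRHS](@prob_kernel _ _ _ _ _ (K (chan i)) v).
by apply: le_measure; rewrite ?inE.
Qed.

Lemma sum_cell_prob i v : \sum_t cell_prob i v t = 1.
Proof.
apply: EFin_inj; rewrite -sumEFin -(@prob_kernel _ _ _ _ _ (K (chan i)) v).
transitivity (\sum_(k < #|T|) K (chan i) v (cell (i := i) (enum_val k)))%E.
  rewrite -(big_enum_val (A := T) (fun t => K (chan i) v (cell (i := i) t))).
  by apply: eq_big => // t _; rewrite cell_probE.
have e : \big[setU/set0]_(k < #|T|) cell (i := i) (enum_val k) = setT.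
  rewrite -(big_enum_val (A := T) (@cell i)); apply/seteqP; split => // y _.
  by rewrite (bigD1 (q (i := chan i) y)) //=; left.
rewrite -measure_semi_additive_ord ?e //.
by move=> k k' _ _ [y /= [ky k'y]]; apply: enum_val_inj; rewrite -ky -k'y.
Qed.

Lemma cell_prob_ratio i v v' t : cell_prob i v t <= expR alpha * cell_prob i v' t.
Proof. by rewrite -lee_fin EFinM -!cell_probE; exact: channel_private. Qed.

(** The event that the outputs spell a given word is a rectangle, and rectangles are where
    [joint_law] prescribes the probability. *)
Lemma Ex_output_word (f : R -> R) (P : probability (path_space R * output_space K)%type R)
    (g : {ffun 'I_N -> T} -> R) : joint_law f P ->
  Ex (output_law P) (fun z => g (word q z)) =
  \sum_wd quantized_prob cell_prob (distribution P fst) wd * g wd.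
Proof.
move=> [_ rect].
pose ind (wd : {ffun 'I_N -> T}) (z : output_space K) : R :=
  \prod_i \1_(q (i := i) @^-1` [set wd i]) (z i).
have bi wd : bounded_measurable (ind wd).
  apply: bmf_prod => i; apply: (bmf_comp (bmf_indic (mq i (wd i)))).
  exact: measurable_coord.
transitivity (Ex (output_law P) (fun z => \sum_wd g wd * ind wd z)).
  by apply: eq_Ex => z; exact: word_sum.
rewrite Ex_sum; last by move=> wd; apply/summableZ/summable_bmf/bi.
apply: eq_bigr => wd _; rewrite ExZ; last exact/summable_bmf/bi.
rewrite mulrC; congr (_ * _).
pose A := [set z : output_space K | forall i, q (i := i) (z i) = wd i].
have indE : ind wd = \1_A.
  apply/funext => z; rewrite indicE; have [/set_mem zA|zA] := boolP (z \in A).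
    by rewrite /ind big1 // => i _; rewrite indicE mem_set //; exact: zA.
  have [i qi] : exists i, q (i := i) (z i) <> wd i.
    by apply/existsNP => h; move/negP: zA; apply; exact: mem_set.
  by rewrite /ind (bigD1 i) //= indicE memNset ?mul0r.
have mA : measurable A.
  have := (bi wd).1 measurableT [set 1] (measurable_set1 _); rewrite setTI indE.
  congr measurable; apply/seteqP; split => z /=; rewrite indicE.
    by case: (boolP (z \in A)) => [/set_mem //|_] /eqP; rewrite eq_sym oner_eq0.
  by move=> zA; rewrite mem_set.
rewrite -/(ind wd) indE Ex_indic //.
have -> : output_law P A = P (setT `*` A).
  by congr (P _); apply/seteqP; split => [[x z] /= ?|[x z] [_ ?]].
rewrite (rect setT (fun i => q (i := i) @^-1` [set wd i])) //.
rewrite /quantized_prob ExE; congr fine; apply: eq_integral => x _.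
rewrite -prodEFin; apply: eq_bigr => i _; rewrite -cell_probE /cell.
have -> : chan i = i by exact: valKd.
by [].
Qed.

End privatized_words.

(** For [alpha >= 1] the entropy bound [delta^2 / 4] is well below [eta]; for [alpha < 1] the
    privacy bound is of order [alpha^4 delta^2] and fixes the constant. *)
Lemma privacy_step {R : realType} (alpha delta : R) : 0 < alpha ->
  let E := expR alpha in let eta := 11664 * Num.min (alpha ^+ 4) 1 * delta ^+ 2 in
  (delta / 2) ^+ 2 <= eta \/ (6 * (E - 1) ^+ 2 * E * `|delta / 2|) ^+ 2 <= eta.
Proof.
move=> a0 E eta; rewrite /eta; have d0 := sqr_ge0 delta.
have [a1|a1] := leP 1 alpha.
  by left; rewrite min_r ?exprn_ege1 // mulr1; lra.
right; rewrite min_l; last by rewrite exprn_ile1 // ltW.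
rewrite exprMn real_normK ?num_real //.
(* Squaring this gives [E <= (1 + alpha)^2], hence [E - 1 <= 3 alpha] and [E <= 4] for
   [alpha < 1]. *)
have half : expR (alpha / 2) <= 1 + alpha.
  have h1 : expR (alpha / 2) * (1 - alpha / 2) <= 1.
    rewrite -[leRHS](expRxMexpNx_1 (alpha / 2)) ler_wpM2l ?expR_ge0 //.
    by have := expR_ge1Dx (- (alpha / 2)).
  have h2 : 1 <= (1 + alpha) * (1 - alpha / 2) by nra.
  have h3 : 0 < 1 - alpha / 2 by lra.
  by rewrite -(ler_pM2r h3); exact: le_trans h2.
have Eh : E = expR (alpha / 2) ^+ 2.
  by rewrite /E expr2 -expRD -splitr.
have E1 : 1 <= E by rewrite (le_trans _ (expR_ge1Dx _)) // lerDl ltW.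
have EU : E - 1 <= 3 * alpha.
  have e0 := expR_ge0 (alpha / 2).
  have : expR (alpha / 2) ^+ 2 <= (1 + alpha) ^+ 2 by rewrite ler_sqr ?nnegrE //; lra.
  rewrite -Eh; nra.
have x0 : 0 <= E - 1 by lra.
have x2 : (E - 1) ^+ 2 <= (3 * alpha) ^+ 2 by rewrite ler_sqr ?nnegrE //; lra.
have xE : (E - 1) ^+ 2 * E <= 36 * alpha ^+ 2.
  apply: (@le_trans _ _ ((3 * alpha) ^+ 2 * 4)); last by lra.
  by apply: ler_pM => //; rewrite ?sqr_ge0 //; lra.
have xE2 : ((E - 1) ^+ 2 * E) ^+ 2 <= (36 * alpha ^+ 2) ^+ 2.
  by rewrite ler_sqr ?nnegrE ?mulr_ge0 ?sqr_ge0 //; lra.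
have : ((E - 1) ^+ 2 * E) ^+ 2 * delta ^+ 2 <= (36 * alpha ^+ 2) ^+ 2 * delta ^+ 2.
  by rewrite ler_wpM2r.
have -> : (36 * alpha ^+ 2) ^+ 2 = 1296 * alpha ^+ 4 by ring.
(* [36 / 4 = 9] and [9 * 1296 = 11664], the constant of the theorem. *)
have -> : (6 * (E - 1) ^+ 2 * E) ^+ 2 * (delta / 2) ^+ 2 =
  9 * (((E - 1) ^+ 2 * E) ^+ 2 * delta ^+ 2) by field.
lra.
Qed.

Theorem theorem2 (R : realType) :
  exists C : R, forall (h N : nat) (alpha a delta : R) (fp fm : R -> R),
    (1 <= h)%N -> (1 <= N)%N -> 0 < alpha -> 0 < a -> -1 <= delta <= 1 ->
    spectral_density fp -> spectral_density fm ->
    (forall l : R, l \in `[- pi, pi] ->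
       3 * a / (4 * pi) <= Num.min (fp l) (fm l)) ->
    (forall l : R, l \in `[- pi, pi] ->
       fp l - fm l = a * delta / (2 * pi) * cos (h%:R * l)) ->
    (ereal_sup [set D | exists (K : 'I_N -> channel alpha)
        (Pp Pm : probability (path_space R * output_space K)%type R),
        [/\ joint_law fp Pp, joint_law fm Pm
          & D = kl (output_law Pp) (output_law Pm)]]
     <= (C * Num.min (alpha ^+ 4) 1 * Num.max (N%:R - h%:R) 0
         * delta ^+ 2)%:E)%E.
Proof.
exists 11664 => h N alpha a delta fp fm h1 N1 alpha0 a0 d1 sfp sfm fge fdiff.
apply: ge_ereal_sup => _ [K [Pp [Pm [jp jm ->]]]].
(* Truncated subtraction of naturals is the positive part that counts the letters with a cost. *)
have -> : Num.max (N%:R - h%:R) 0 = (N - h)%:R :> R.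
  have [Nh|/ltnW hN] := leqP N h.
    by rewrite max_r ?subr_le0 ?ler_nat // (eqP (_ : (N - h == 0)%N)) // subn_eq0.
  by rewrite max_l ?subr_ge0 ?ler_nat // natrB.
have fm_ge l : l \in `[- pi, pi] -> 3 * a / (4 * pi) <= fm l.
  by move=> /fge; rewrite le_min => /andP[].
have -> : 11664 * Num.min (alpha ^+ 4) 1 * (N - h)%:R * delta ^+ 2 =
    (N - h)%:R * (11664 * Num.min (alpha ^+ 4) 1 * delta ^+ 2) by ring.
apply: kl_le => G bG; apply: variational_lift bG => F [T [q [g [mq ->]]]].
rewrite (Ex_output_word N1 mq g jp) (Ex_output_word N1 mq (fun wd => expR (g wd)) jm).
have E1 : 1 <= expR alpha by rewrite (le_trans _ (expR_ge1Dx _)) // lerDl ltW.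
exact: (quantized_divergence N1 h1 a0 d1 sfp sfm fm_ge fdiff jp.1 jm.1
  (bmf_cell_prob N1 mq) (cell_prob_ge0 N1 q) (sum_cell_prob N1 mq) E1
  (cell_prob_ratio N1 mq) (privacy_step delta alpha0)).
Qed.
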